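(* Let $\alpha,\beta\ge 0$ with $\alpha\neq\beta$. Let $X$ and $Y$ be independent random matrices with values in $\Omega_+$, each having a density (with respect to Lebesgue measure on $\Omega$) which is strictly positive and twice differentiable on $\Omega_+$. Let $(U,V)=\phi^{(\alpha,\beta)}(X,Y)$, where $\phi^{(\alpha,\beta)}:\Omega_+^2\to\Omega_+^2$ is $$\phi^{(\alpha,\beta)}(x,y)=\left(y(I+\alpha xy)^{-1}(I+\beta xy),\; x(I+\beta yx)^{-1}(I+\alpha yx)\right).$$ If $U$ and $V$ are independent, then there exist $\lambda\in\mathbb R$ and $a,b\in\Omega_+$ such that $$(X,Y)\sim \mathrm{MGIG}(\lambda,\alpha a,b)\otimes \mathrm{MGIG}(\lambda,\beta b,a)\quad\text{and}\quad (U,V)\sim \mathrm{MGIG}(\lambda,\alpha b,a)\otimes \mathrm{MGIG}(\lambda,\beta a,b).$$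
   Context: Fix an integer $r\ge1$. $\Omega$ denotes the space of real symmetric $r\times r$ matrices with inner product $\langle x,y\rangle=\mathrm{tr}(xy)$, and $\Omega_+\subset\Omega$ the open cone of positive definite matrices; $I$ is the identity matrix. For $\lambda\in\mathbb R$ and symmetric positive semidefinite $a,b$ (such that the function below is integrable), $\mathrm{MGIG}(\lambda,a,b)$ is the probability distribution on $\Omega_+$ with density proportional to $(\det x)^{\lambda-\frac{r+1}{2}}\exp\left(-\langle a,x\rangle-\langle b,x^{-1}\rangle\right)\mathbf 1_{\Omega_+}(x)$. The map $\phi^{(\alpha,\beta)}$ sends $\Omega_+^2$ into $\Omega_+^2$. $\mu\otimes\nu$ denotes the product (independent) law. *)

(* Defs.v *)
From HB Require Import structures.
From mathcomp Require Import all_boot all_order all_algebra.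
From mathcomp Require Import all_classical all_reals all_analysis.

Set Implicit Arguments.
Unset Strict Implicit.
Unset Printing Implicit Defensive.

Import Order.TTheory GRing.Theory Num.Theory.
Import numFieldNormedType.Exports.

Local Open Scope classical_set_scope.
Local Open Scope ring_scope.

Section Defs.
Variable R : realType.

Definition posdef (r : nat) (x : 'M[R]_r) : Prop :=
  x^T = x /\ forall v : 'cV[R]_r, v != 0 -> 0 < (v^T *m x *m v) 0 0.

(** Coordinates on Omega (symmetric matrices): the entries (i,j), i <= j. *)
Definition sym_pairs (r : nat) : seq ('I_r * 'I_r) :=
  [seq p : 'I_r * 'I_r <- [seq (i, j) | i <- enum 'I_r, j <- enum 'I_r] | (nat_of_ord p.1 <= nat_of_ord p.2)%N].

Definition sym_dim (r : nat) : nat := size (sym_pairs r).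

Definition sym_pair (r : nat) (i j : 'I_r) : 'I_r * 'I_r :=
  if (i <= j)%N then (i, j) else (j, i).

Definition smx_of_seq (r : nat) (s : seq R) : 'M[R]_r :=
  \matrix_(i, j) nth 0 s (index (sym_pair i j) (sym_pairs r)).

Definition smx_of_tuple (r : nat) (t : (sym_dim r).-tuple R) : 'M[R]_r :=
  smx_of_seq r (val t).

Definition smx_of_rv (r : nat) (v : 'rV[R]_(sym_dim r)) : 'M[R]_r :=
  smx_of_seq r [seq v 0 k | k <- enum 'I_(sym_dim r)].

(** Coordinates of a matrix (inverse of smx_of_tuple on symmetric matrices). *)
Definition sym_coords (r : nat) (x : 'M[R]_r) : (sym_dim r).-tuple R :=
  map_tuple (fun p : 'I_r * 'I_r => x p.1 p.2) (in_tuple (sym_pairs r)).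

(** Lebesgue integral on R^n of a nonnegative function, written as the
    iterated (Tonelli) integral w.r.t. the Lebesgue measure on R. *)
Fixpoint iint (n : nat) : (n.-tuple R -> \bar R) -> \bar R :=
  match n return (n.-tuple R -> \bar R) -> \bar R with
  | 0 => fun f => f [tuple]
  | n'.+1 => fun f =>
      (\int[@lebesgue_measure R]_x iint (fun t : n'.-tuple R => f (cons_tuple x t)))%E
  end.

(** Integral over Omega (Lebesgue measure in the coordinates x_ij, i <= j). *)
Definition int_Omega (r : nat) (f : 'M[R]_r -> \bar R) : \bar R :=
  iint (fun t : (sym_dim r).-tuple R => f (smx_of_tuple t)).

(** Twice differentiability on a set (used on the open set Omega_+ in
    coordinates): g is differentiable, and so is each directional
    derivative w |-> 'D_e g w. *)
Definition twice_differentiable_on (n : nat) (D : set 'rV[R]_n)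
    (g : 'rV[R]_n -> R) : Prop :=
  forall v, D v ->
    differentiable g v /\ forall e : 'rV[R]_n, differentiable ('D_e g) v.

Definition mgig_kernel (r : nat) (lam : R) (a b : 'M[R]_r) (x : 'M[R]_r) : R :=
  if `[< posdef x >] then
    (\det x) `^ (lam - (r%:R + 1) / 2) * expR (- \tr (a *m x) - \tr (b *m invmx x))
  else 0.

Definition mgig_Z (r : nat) (lam : R) (a b : 'M[R]_r) : \bar R :=
  int_Omega (fun x => (mgig_kernel lam a b x)%:E).

Definition mgig_law (r : nat) (lam : R) (a b : 'M[R]_r)
    (A : set ((sym_dim r).-tuple R)) : \bar R :=
  (int_Omega (fun x => (\1_A (sym_coords x) * mgig_kernel lam a b x)%:E)
    * ((fine (mgig_Z lam a b))^-1)%:E)%E.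

Definition mgig_ok (r : nat) (lam : R) (a b : 'M[R]_r) : Prop :=
  (0 < mgig_Z lam a b < +oo)%E.

Definition phi_ab (r : nat) (alpha beta : R) (x y : 'M[R]_r)
    : 'M[R]_r * 'M[R]_r :=
  (y *m invmx (1%:M + alpha *: (x *m y)) *m (1%:M + beta *: (x *m y)),
   x *m invmx (1%:M + beta *: (y *m x)) *m (1%:M + alpha *: (y *m x))).

Definition has_density {d} {T : measurableType d} (P : probability T R)
    (r : nat) (X : T -> 'M[R]_r) (f : 'M[R]_r -> R) : Prop :=
  (forall x, 0 <= f x) /\
  forall A : set ((sym_dim r).-tuple R), measurable A ->
    P (X @^-1` ((@sym_coords r) @^-1` A)) =
    int_Omega (fun x => (\1_A (sym_coords x) * f x)%:E).

Definition random_matrix {d} {T : measurableType d} (r : nat)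
    (X : T -> 'M[R]_r) : Prop :=
  measurable_fun setT (fun w => sym_coords (X w)).

Definition indep_mx {d} {T : measurableType d} (P : probability T R)
    (r : nat) (X Y : T -> 'M[R]_r) : Prop :=
  forall A B : set ((sym_dim r).-tuple R), measurable A -> measurable B ->
    P (X @^-1` ((@sym_coords r) @^-1` A) `&` Y @^-1` ((@sym_coords r) @^-1` B)) =
    (P (X @^-1` ((@sym_coords r) @^-1` A)) * P (Y @^-1` ((@sym_coords r) @^-1` B)))%E.

(** (X,Y) ~ mu1 (x) nu1, checked on measurable rectangles (which determine
    the joint law). *)
Definition joint_law_is {d} {T : measurableType d} (P : probability T R)
    (r : nat) (X Y : T -> 'M[R]_r)
    (mu nu : set ((sym_dim r).-tuple R) -> \bar R) : Prop :=
  forall A B : set ((sym_dim r).-tuple R), measurable A -> measurable B ->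
    P (X @^-1` ((@sym_coords r) @^-1` A) `&` Y @^-1` ((@sym_coords r) @^-1` B)) =
    (mu A * nu B)%E.

End Defs.

(* Main.v *)
Require Import Defs.
From HB Require Import structures.
From mathcomp Require Import all_boot all_order all_algebra.
From mathcomp Require Import all_classical all_reals all_analysis.
From mathcomp Require Import measurable_realfun ring lra.

Set Implicit Arguments.
Unset Strict Implicit.
Unset Printing Implicit Defensive.

Import Order.TTheory GRing.Theory Num.Theory.
Import numFieldNormedType.Exports.

Local Open Scope classical_set_scope.
Local Open Scope ring_scope.

(* The matrix q = alpha x + y^-1 equals beta v + u^-1. With p = q^-1, k = beta / alpha,
   z = y - p and w = p z^-1 p, the relation (u, v) = phi (x, y) reads
     y = p + z,  u = p + k z,  x^-1 = alpha (p + w),  v^-1 = alpha (w + k p).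
   Hence phi is an involution, and (x, y) -> (q, y) -> (q, u) -> (v, u) decomposes it into
   rescaled shears whose scaling factors cancel: phi preserves Lebesgue measure (for
   beta = 0 by passing to the limit). So (U, V) has a continuous density, which factors by
   independence, and the logarithms of the densities satisfy F(x) + G(y) = H(u) + K(v).
   In the variables p, w, letting w -> oo at order 0 shows that G - H is affine, and at
   order 1 that p -> G'(p)[p P p] is affine up to a linear correction of G, for all P.
   Symmetry of the second derivative of G then forces the linear part to be
   c \tr (P e), so G is a combination of \tr (b y), \tr (a y^-1), ln (\det y) and a
   constant; F and K follow since F3 (p + w) = K3 (w + k p) has constant solutions only.
   Finally a and b are positive definite because the densities of X and U are integrable:
   if v^T a v <= 0, dilating along v an open set that is small around a suitable point gives
   disjoint sets of mass at least rho^j under the first density and, with inverse dilations,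
   rho^-j under the second. *)

(** * Positive definite matrices and the map phi *)

(** As w -> oo the matrix z = p w^-1 p tends to 0, so y and u both approach p while x and v
    degenerate to 0, where nothing is known about F and K. Hence F and K are eliminated rather than
    expanded: they depend on p and w only through p + w and w + k p, and a combination of four
    points makes their arguments cancel in pairs. They are never assumed differentiable in this
    step; G is differentiated twice and H once.

    The condition alpha <> beta enters as 1 - k <> 0: for alpha = beta the map phi is the exchange
    (x, y) -> (y, x), which preserves independence for all laws. The parametrization by p and w
    divides by alpha, so alpha > 0 is treated first and alpha = 0 follows by exchanging the two
    coordinates.

    Jacobians are never computed. Every change of variables is an additive bijection or a
    translation in one variable, and uniqueness of translation-invariant measures supplies a
    positive constant. For beta = 0 the step (q, y) -> (q, u) collapses to u = q^-1. The limit beta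
    -> 0 is taken with densities that may jump at the boundary of the cone, so only lower
    semicontinuity and one-sided inequalities are available there. *)

Section PosDef.
Variables (R : realType) (r : nat).
Implicit Types (x y m p w z : 'M[R]_r) (v : 'cV[R]_r).

Definition qf x v : R := (v^T *m x *m v) 0 0.

Lemma qfD x y v : qf (x + y) v = qf x v + qf y v.
Proof. by rewrite /qf mulmxDr mulmxDl mxE. Qed.

Lemma qfZ c x v : qf (c *: x) v = c * qf x v.
Proof. by rewrite /qf -scalemxAr -scalemxAl mxE. Qed.

Lemma qfB x y v : qf (x - y) v = qf x v - qf y v.
Proof. by rewrite -scaleN1r qfD qfZ mulN1r. Qed.

Lemma qf_congr m x v : qf (m *m x *m m^T) v = qf x (m^T *m v).
Proof. by rewrite /qf trmx_mul trmxK !mulmxA. Qed.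

Lemma qf1E v : qf 1%:M v = \sum_i v i 0 ^+ 2.
Proof.
rewrite /qf mulmx1 mxE; apply: eq_bigr => i _.
by rewrite mxE expr2.
Qed.

Lemma qf1_gt0 v : v != 0 -> 0 < qf 1%:M v.
Proof.
move=> v0; rewrite qf1E lt_neqAle sumr_ge0 ?andbT => [|i _]; last exact: sqr_ge0.
apply: contra v0; rewrite eq_sym psumr_eq0 => [/allP h|i _]; last exact: sqr_ge0.
apply/eqP/matrixP => i j; rewrite ord1 mxE.
have := h i; rewrite mem_index_enum => /(_ isT) /=.
by rewrite sqrf_eq0 => /eqP.
Qed.

Lemma posdef_sym x : posdef x -> x^T = x. Proof. by case. Qed.

Lemma posdef1 : posdef (1%:M : 'M[R]_r).
Proof. by split; [rewrite trmx1|move=> v /qf1_gt0]. Qed.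

Lemma posdefD x y : posdef x -> posdef y -> posdef (x + y).
Proof.
move=> [sx px] [sy py]; split; first by rewrite linearD /= sx sy.
by move=> v v0; rewrite -/(qf _ _) qfD addr_gt0 ?px ?py.
Qed.

Lemma posdefZ c x : 0 < c -> posdef x -> posdef (c *: x).
Proof.
move=> c0 [sx px]; split; first by rewrite linearZ /= sx.
by move=> v v0; rewrite -/(qf _ _) qfZ mulr_gt0 // px.
Qed.

Lemma posdefZV c x : 0 < c -> posdef (c *: x) -> posdef x.
Proof.
move=> c0 /(@posdefZ c^-1); rewrite invr_gt0 scalerA mulVf ?gt_eqF// scale1r.
exact.
Qed.

Lemma posdefDZ p z c : 0 <= c -> posdef p -> posdef z -> posdef (p + c *: z).
Proof.
rewrite le_eqVlt => /predU1P[<-|c0] pp pz; first by rewrite scale0r addr0.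
by apply: posdefD => //; apply: posdefZ.
Qed.

Lemma posdef_seg x y s : posdef x -> posdef y -> 0 <= s <= 1 -> posdef (x + s *: (y - x)).
Proof.
move=> px py /andP[s0 s1].
have -> : x + s *: (y - x) = (1 - s) *: x + s *: y.
  by rewrite scalerBr scalerBl scale1r addrAC addrA.
have [->|sn0] := eqVneq s 0; first by rewrite subr0 scale0r scale1r addr0.
rewrite addrC; apply: posdefDZ; rewrite ?subr_ge0 //.
by apply: posdefZ; rewrite // lt_neqAle eq_sym sn0.
Qed.

Lemma posdef_unit x : posdef x -> x \in unitmx.
Proof.
move=> [sx px]; rewrite unitmxE unitfE; apply/det0P => -[v v0 vx].
have v0' : v^T != 0.
  by apply: contra v0 => /eqP h; rewrite -[v]trmxK h trmx0.
by have := px _ v0'; rewrite trmxK vx mul0mx mxE ltxx.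
Qed.

Lemma posdef_congr m x : m \in unitmx -> posdef x -> posdef (m *m x *m m^T).
Proof.
move=> um [sx px]; split; first by rewrite !trmx_mul trmxK sx mulmxA.
move=> v v0; rewrite -/(qf _ _) qf_congr; apply: px.
apply: contra v0 => /eqP h.
by rewrite -[v]mul1mx -trmx1 -(mulmxV um) trmx_mul -mulmxA h mulmx0.
Qed.

Lemma posdef_inv x : posdef x -> posdef (invmx x).
Proof.
move=> px; have ux := posdef_unit px.
have ui : invmx x \in unitmx by rewrite unitmx_inv.
have := posdef_congr ui px.
by rewrite mulVmx // mul1mx trmx_inv (posdef_sym px).
Qed.

Lemma posdef_conj m x : m^T = m -> m \in unitmx -> posdef x -> posdef (m *m x *m m).
Proof. by move=> sm um px; have := posdef_congr um px; rewrite sm. Qed.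

Lemma detpolyE x y : exists q : {poly R}, forall s, \det (x + s *: y) = q.[s].
Proof.
exists (\det (map_mx polyC x + 'X *: map_mx polyC y)) => s.
rewrite -[RHS]/(horner_eval s _) -det_map_mx; congr (\det _).
by apply/matrixP => i j; rewrite !mxE -[RHS]/(((x i j)%:P + 'X * (y i j)%:P).[s]) !hornerE.
Qed.

(** The segment from I to x stays in the cone, where the determinant has no zero. It is a polynomial
    in the parameter with value 1 at I, so a negative value at x would force a root in between. *)
Lemma det_gt0 x : posdef x -> 0 < \det x.
Proof.
move=> px; have [q qE] := detpolyE 1%:M (x - 1%:M).
have seg s : 0 <= s <= 1 -> q.[s] != 0.
  move=> s01; rewrite -qE -unitfE -unitmxE.
  by apply/posdef_unit/posdef_seg => //; exact: posdef1.
have q0 : q.[0] = 1 by rewrite -qE scale0r addr0 det1.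
have q1 : q.[1] = \det x by rewrite -qE scale1r addrC subrK.
rewrite lt_neqAle eq_sym -q1 seg ?lexx ?ler01 //= leNgt; apply/negP => qlt.
have := @poly_ivt R (- q) 0 1 ler01.
rewrite !hornerN q0 oppr_le0 ler01 oppr_ge0 (ltW qlt) => /(_ isT)[s /seg /negPf h].
by rewrite rootN rootE h.
Qed.

(** A crude operator norm bound, from 2 |v_i v_j| <= v_i^2 + v_j^2. It converts entrywise closeness
    of matrices into closeness of their quadratic forms. *)
Lemma qf_continuity_bound x v : `|qf x v| <= (\sum_i \sum_j `|x i j|) * qf 1%:M v.
Proof.
rewrite [qf x v]/qf -mulmxA mxE; apply: le_trans (ler_norm_sum _ _ _) _.
rewrite mulr_suml; apply: ler_sum => i _; rewrite normrM !mxE.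
apply: le_trans (ler_wpM2l (normr_ge0 _) (ler_norm_sum _ _ _)) _.
rewrite mulr_sumr mulr_suml; apply: ler_sum => j _.
rewrite normrM mulrCA; apply: ler_wpM2l => //.
rewrite qf1E.
have h k : `|v k 0| ^+ 2 <= \sum_l v l 0 ^+ 2.
  by rewrite real_normK ?num_real // (bigD1 k) //= lerDl sumr_ge0 // => *; exact: sqr_ge0.
have [hi hj] := (h i, h j).
have := sqr_ge0 (`|v i 0| - `|v j 0|).
move: hi hj; nra.
Qed.

Definition bil x (u v : 'cV[R]_r) : R := (u^T *m x *m v) 0 0.

Lemma qf_comb x a b (u v : 'cV[R]_r) : qf x (a *: u - b *: v) =
  a ^+ 2 * qf x u - a * b * (bil x u v + bil x v u) + b ^+ 2 * qf x v.
Proof.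
have e : (a *: u - b *: v)^T = a *: u^T - b *: v^T by rewrite linearB /= !linearZ.
rewrite /qf /bil e !mulmxBl !mulmxBr -!scalemxAl -!scalemxAr.
rewrite !mxE; ring.
Qed.

Lemma posdef_cauchy x (u v : 'cV[R]_r) : posdef x ->
  bil x u v ^+ 2 <= qf x u * qf x v.
Proof.
move=> [sx px].
have ge0 t : 0 <= qf x t.
  have [->|/px/ltW//] := eqVneq t 0.
  by rewrite /qf mulmx0 mxE.
have [->|v0] := eqVneq v 0.
  by rewrite /bil /qf !mulmx0 mxE mulr0 expr0n.
have vp := px _ v0; rewrite -/(qf _ _) in vp.
have bs : bil x v u = bil x u v.
  have e : v^T *m x *m u = (u^T *m x *m v)^T.
    by rewrite !trmx_mul trmxK sx mulmxA.
  by rewrite /bil e mxE.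
(* The minimizer over t of the form at u - t v, cleared of its denominator [qf x v]. *)
have := ge0 (qf x v *: u - bil x u v *: v).
rewrite qf_comb bs => h.
have : 0 <= qf x v * (qf x u * qf x v - bil x u v ^+ 2) by move: h; nra.
by rewrite pmulr_rge0 // subr_ge0.
Qed.

(* Cauchy-Schwarz for the form [x] applied to [v = x (x^-1 v)]. *)
Lemma posdef_coercive x : posdef x ->
  exists2 d, 0 < d & forall v, d * qf 1%:M v <= qf x v.
Proof.
move=> px; have ux := posdef_unit px.
pose C := 1 + \sum_i \sum_j `|invmx x i j|.
have C0 : 0 < C.
  by rewrite ltr_wpDr // sumr_ge0 // => i _; rewrite sumr_ge0.
exists C^-1; first by rewrite invr_gt0.
move=> v; have [->|v0] := eqVneq v 0.
  by rewrite /qf !mulmx0 !mxE mulr0.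
have := posdef_cauchy (invmx x *m v) v px.
have -> : bil x (invmx x *m v) v = qf 1%:M v.
  by rewrite /bil /qf trmx_mul trmx_inv (posdef_sym px) -(mulmxA v^T (invmx x)) mulVmx.
have -> : qf x (invmx x *m v) = qf (invmx x) v.
  rewrite /qf trmx_mul trmx_inv (posdef_sym px) -(mulmxA v^T (invmx x) x) mulVmx //.
  by rewrite mulmx1 mulmxA.
have v1 := qf1_gt0 v0; have xv : 0 < qf x v by case: px => _; apply.
have := qf_continuity_bound (invmx x) v.
move=> /(le_trans (ler_norm _)) hb hc.
have {}hb : qf (invmx x) v <= C * qf 1%:M v.
  by apply: le_trans hb _; rewrite ler_pM2r // /C lerDr.
have : qf 1%:M v ^+ 2 <= (C * qf 1%:M v) * qf x v.
  by apply: le_trans hc _; rewrite ler_pM2r.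
rewrite expr2 -mulrA mulrCA ler_pM2l // => h.
by rewrite ler_pdivrMl.
Qed.

Lemma posdef_open x : posdef x -> exists2 e, 0 < e &
  forall y, y^T = y -> (forall i j, `|y i j - x i j| < e) -> posdef y.
Proof.
move=> px; have [d d0 hd] := posdef_coercive px.
(* There are r ^ 2 entries, each perturbed by less than d / N; the added 1 makes their total
   strictly less than d and keeps N positive. *)
pose N : R := (r ^ 2)%:R + 1.
have N0 : 0 < N by rewrite ltr_wpDl.
exists (d / N); first by rewrite divr_gt0.
move=> y sy hy; split=> // v v0; rewrite -/(qf _ _).
have v1 := qf1_gt0 v0.
have := qf_continuity_bound (y - x) v; rewrite qfB ler_norml => /andP[h _].
have hs : \sum_i \sum_j `|(y - x) i j| < d.
  apply: (@le_lt_trans _ _ (\sum_(i < r) \sum_(j < r) (d / N))).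
    by do 2![apply: ler_sum => ? _]; rewrite !mxE ltW.
  rewrite !sumr_const !card_ord -mulrnA mulnn -mulr_natl mulrCA gtr_pMr //.
  by rewrite ltr_pdivrMr // mul1r /N ltrDl.
have := hd v; nra.
Qed.
End PosDef.

Section PhiAlgebra.
Variables (R : realType) (r : nat).
Implicit Types (x y m p w z u v q : 'M[R]_r).

Lemma invmx_uniq x y : x *m y = 1%:M -> invmx x = y.
Proof.
move=> xy; have [ux _] := mulmx1_unit xy.
by rewrite -[RHS](mulKmx ux) xy mulmx1.
Qed.

Lemma posdef_invZ c x : 0 < c -> posdef x -> invmx (c *: x) = c^-1 *: invmx x.
Proof. by move=> c0 px; rewrite invmxZ //; exact/posdef_unit/posdefZ. Qed.

(** Because p + p z^-1 p factors both as (p + z) z^-1 p and as p z^-1 (p + z). This identity makes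
    x^-1 and v^-1 linear in p and w. *)
Lemma posdef_inv_sub p z : posdef p -> posdef z ->
  invmx p - invmx (p + z) = invmx (p + p *m invmx z *m p).
Proof.
move=> pp pz; have [up uz] := (posdef_unit pp, posdef_unit pz).
have us := posdef_unit (posdefD pp pz).
apply/esym/invmx_uniq.
have e : p + p *m invmx z *m p = (p + z) *m invmx z *m p.
  by rewrite mulmxDl (mulmxV uz) mulmxDl mul1mx addrC.
have e' : p + p *m invmx z *m p = p *m invmx z *m (p + z).
  by rewrite mulmxDr -(mulmxA p (invmx z) z) (mulVmx uz) mulmx1 addrC.
rewrite mulmxBr {1}e e' (mulmxK up) (mulmxK us) mulmxDl (mulmxV uz).
by rewrite addrAC subrr add0r.
Qed.

(** Inversion reverses the Loewner order: y^-1 < q gives q^-1 < y. It keeps track of the positivity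
    domain through each shear. *)
Lemma posdef_shear y q : posdef y -> posdef (q - invmx y) ->
  posdef q /\ posdef (y - invmx q).
Proof.
move=> py pq; have pi := posdef_inv py.
have qE : q = invmx y + (q - invmx y) by rewrite addrC subrK.
split; first by rewrite qE; exact: posdefD.
have := posdef_inv_sub pi pq; rewrite invmxK -qE => ->.
apply: posdef_inv; apply: posdefD => //.
apply: posdef_conj; [exact: posdef_sym|exact: posdef_unit|exact: posdef_inv].
Qed.

Lemma unitmx_1Dxy a x y : 0 <= a -> posdef x -> posdef y -> 1%:M + a *: (x *m y) \in unitmx.
Proof.
move=> a0 px py; have uy := posdef_unit py.
have -> : 1%:M + a *: (x *m y) = (invmx y + a *: x) *m y.
  by rewrite mulmxDl mulVmx // scalemxAl.
by rewrite unitmx_mul uy andbT; apply: posdef_unit; apply: posdefDZ => //; exact: posdef_inv.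
Qed.

Section Param.
Variables (al be : R).
Hypotheses (al0 : 0 < al) (be0 : 0 <= be).
Let k := be / al.

(** The matrix w of the overview. For fixed p it is an involution ([conjwK]), so either z or w can
    serve as the free variable. *)
Definition conjw p z := p *m invmx z *m p.

Lemma posdef_conjw p z : posdef p -> posdef z -> posdef (conjw p z).
Proof.
move=> pp pz; apply: posdef_conj => //; last exact: posdef_inv.
  exact: posdef_sym.
exact: posdef_unit.
Qed.

Lemma conjwK p w : posdef p -> posdef w -> conjw p (conjw p w) = w.
Proof.
move=> pp pw; have [up uw] := (posdef_unit pp, posdef_unit pw).
rewrite /conjw; have -> : invmx (p *m invmx w *m p) = invmx p *m w *m invmx p.
  by apply: invmx_uniq; rewrite !mulmxA (mulmxK up) (mulmxKV uw) (mulmxV up).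
by rewrite !mulmxA (mulmxV up) mul1mx (mulmxKV up).
Qed.

Lemma pz_of_xy x y : posdef x -> posdef y -> exists p z,
  [/\ posdef p, posdef z, y = p + z & x = invmx (al *: (p + conjw p z))].
Proof.
move=> px py; pose q := invmx y + al *: x.
have pax : posdef (q - invmx y) by rewrite /q addrC addKr; exact: posdefZ.
have [pq pz] := posdef_shear py pax.
have pp := posdef_inv pq.
exists (invmx q), (y - invmx q); split => //; first by rewrite addrC subrK.
rewrite posdef_invZ //; last by apply: posdefD => //; exact: posdef_conjw.
rewrite /conjw -(posdef_inv_sub pp pz) invmxK (addrC (invmx q)) subrK.
by rewrite /q (addrC (invmx y)) addrK scalerA mulVf ?gt_eqF// scale1r.
Qed.

Lemma posdef_xpz p z : posdef p -> posdef z ->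
  posdef (invmx (al *: (p + conjw p z))).
Proof.
move=> pp pz; apply/posdef_inv/posdefZ => //.
by apply: posdefD => //; exact: posdef_conjw.
Qed.

Lemma posdef_vpz p z : posdef p -> posdef z ->
  posdef (invmx (al *: (conjw p z + k *: p))).
Proof.
move=> pp pz; apply/posdef_inv/posdefZ => //; apply/posdefDZ => //.
  by rewrite divr_ge0 // ltW.
exact: posdef_conjw.
Qed.

(** In these variables 1 + al xy = p^-1 y and 1 + be xy = p^-1 u, with the transposed identities for
    yx, so the inverses in phi cancel against neighbouring factors. *)
Lemma phi_pz p z : posdef p -> posdef z ->
  phi_ab al be (invmx (al *: (p + conjw p z))) (p + z) =
  (p + k *: z, invmx (al *: (conjw p z + k *: p))).
Proof.
move=> pp pz; set x := invmx _.
(* [y] and [u] stay opaque, so that the cancellation rewrites act on single matrices instead of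
   sums. *)
have [y yE] : exists y, y = p + z by exists (p + z).
rewrite -yE; have k0 : 0 <= k by rewrite divr_ge0 // ltW.
have pw := posdef_conjw pp pz.
have py : posdef y by rewrite yE; exact: posdefD.
have [u uE] : exists u, u = p + k *: z by exists (p + k *: z).
rewrite -uE; have pu : posdef u by rewrite uE; exact: posdefDZ.
have [up uz] := (posdef_unit pp, posdef_unit pz).
have [uy uu] := (posdef_unit py, posdef_unit pu).
have upi : invmx p \in unitmx by rewrite unitmx_inv.
have axE : al *: x = invmx p - invmx y.
  rewrite yE posdef_inv_sub // -/(conjw p z) /x posdef_invZ //; last exact: posdefD.
  by rewrite scalerA mulfV ?gt_eqF // scale1r.
have bxE : be *: x = k *: (invmx p - invmx y).
  by rewrite -axE scalerA /k divfK ?gt_eqF.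
have e1 : 1%:M + al *: (x *m y) = invmx p *m y.
  by rewrite scalemxAl axE mulmxBl (mulVmx uy) addrC subrK.
have e2 : 1%:M + al *: (y *m x) = y *m invmx p.
  by rewrite scalemxAr axE mulmxBr (mulmxV uy) addrC subrK.
have e3 : p *m (1%:M + be *: (x *m y)) = u.
  rewrite scalemxAl bxE -scalemxAl mulmxBl (mulVmx uy) mulmxDr mulmx1.
  by rewrite -scalemxAr mulmxBr (mulKVmx up) mulmx1 uE yE (addrC p z) addrK.
have e4 : 1%:M + be *: (y *m x) = u *m invmx p.
  rewrite scalemxAr bxE -scalemxAr mulmxBr (mulmxV uy).
  by rewrite uE yE !mulmxDl (mulmxV up) -scalemxAl (addrC 1%:M (_ *m _)) addrK.
have invM (a b : 'M[R]_r) : a \in unitmx -> b \in unitmx -> invmx (a *m b) = invmx b *m invmx a.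
  move=> ua ub; apply: invmx_uniq.
  by rewrite mulmxA (mulmxK ub) (mulmxV ua).
rewrite /phi_ab e1 e2 e4 (invM _ _ upi uy) (invM _ _ uu upi) !invmxK.
rewrite (mulKVmx uy) e3; congr pair.
rewrite posdef_invZ //; last exact: posdefDZ.
apply: (@scalerI _ _ al); first by rewrite gt_eqF.
rewrite !scalemxAl axE scalerA mulfV ?gt_eqF // scale1r.
apply/esym/invmx_uniq.
have -> : conjw p z + k *: p = p *m invmx z *m u.
  by rewrite uE /conjw mulmxDr -scalemxAr (mulmxKV uz).
(* Since u = y + (k - 1) z, both sides equal z + (k - 1) z y^-1 z. *)
have key : u *m invmx y *m z = z *m invmx y *m u.
  have -> : u = y + (k - 1) *: z.
    by rewrite uE yE scalerBl scale1r -addrA (addrC z) subrK.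
  rewrite !mulmxDl !mulmxDr (mulmxV uy) mul1mx (mulmxKV uy).
  by rewrite -!scalemxAl -!scalemxAr.
have -> : invmx p - invmx y = invmx y *m z *m invmx p.
  have {1}-> : z = y - p by rewrite yE (addrC p) addrK.
  by rewrite mulmxBr mulmxBl (mulVmx uy) mul1mx -mulmxA (mulmxV up) mulmx1.
rewrite !mulmxA (mulmxKV up).
rewrite -(mulmxA (p *m invmx z)) -(mulmxA (p *m invmx z) _ z) key.
rewrite -!mulmxA (mulKmx uz) (mulmxA u) (mulmxV uu) mul1mx (mulmxA (invmx y)) (mulVmx uy).
by rewrite mul1mx (mulmxV up).
Qed.

Lemma posdef_phi x y : posdef x -> posdef y ->
  posdef (phi_ab al be x y).1 /\ posdef (phi_ab al be x y).2.
Proof.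
move=> px py; have [p [z [pp pz -> ->]]] := pz_of_xy px py.
rewrite phi_pz //=; split; last exact: posdef_vpz.
by apply: posdefDZ => //; rewrite divr_ge0 // ltW.
Qed.

(** One computes uv = yx and vu = xy. The factors of the second application of phi are therefore
    built from the same products and undo those of the first. *)
Lemma phi_invol x y : posdef x -> posdef y ->
  phi_ab al be (phi_ab al be x y).1 (phi_ab al be x y).2 = (x, y).
Proof.
move=> px py; have [pu pv] := posdef_phi px py.
have [sx sy] := (posdef_sym px, posdef_sym py).
have [su sv] := (posdef_sym pu, posdef_sym pv).
have unit1 a (a0 : 0 <= a) := unitmx_1Dxy a0 px py.
have unit2 a (a0 : 0 <= a) := unitmx_1Dxy a0 py px.
move: pu pv su sv; rewrite {1 2 3 4 6 7}/phi_ab /=.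
set u := y *m _ *m _; set v := x *m _ *m _ => pu pv su sv.
have al0' := ltW al0.
have uv : u *m v = y *m x.
  rewrite /u /v.
  have -> : x *m invmx (1%:M + be *: (y *m x)) = invmx (1%:M + be *: (x *m y)) *m x.
    apply: (can_inj (mulKmx (unit1 _ be0))); rewrite (mulKVmx (unit1 _ be0)).
    rewrite mulmxA; have -> : (1%:M + be *: (x *m y)) *m x = x *m (1%:M + be *: (y *m x)).
      by rewrite mulmxDl mulmxDr mul1mx mulmx1 -scalemxAl -scalemxAr mulmxA.
    by rewrite (mulmxK (unit2 _ be0)).
  rewrite !mulmxA (mulmxK (unit1 _ be0)).
  rewrite -!mulmxA; congr (_ *m _).
  have -> : x *m (1%:M + al *: (y *m x)) = (1%:M + al *: (x *m y)) *m x.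
    by rewrite mulmxDl mulmxDr mul1mx mulmx1 -scalemxAl -scalemxAr mulmxA.
  by rewrite (mulKmx (unit1 _ al0')).
have vu : v *m u = x *m y.
  by rewrite -[LHS]trmxK trmx_mul su sv uv trmx_mul sx sy.
rewrite /phi_ab uv vu; congr pair.
- by rewrite /v (mulmxK (unit2 _ al0')) (mulmxKV (unit2 _ be0)).
- by rewrite /u (mulmxK (unit1 _ be0)) (mulmxKV (unit1 _ al0')).
Qed.

End Param.
End PhiAlgebra.

(** * Calculus on matrices *)

Section Calculus.
Variable R : realType.

Lemma nbhs_neq0 (x : R) : x != 0 -> nbhs x [set y | y != 0].
Proof.
move=> x0; exists `|x| => /=; first by rewrite normr_gt0.
by move=> y /=; apply: contraTneq => ->; rewrite subr0 ltxx.
Qed.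

Lemma near_eq_differentiable (V W : normedModType R) (f g : V -> W) x :
  (\forall y \near x, f y = g y) -> differentiable f x -> differentiable g x.
Proof.
move=> fg df.
have [dfc /eqaddoP e] := (diff_locallyP _ _).1 df.
have h : g \o shift x = cst (g x) + 'd f x +o_ 0 id.
  apply/eqaddoP => _/posnumP[eps].
  have := e eps%:num ltac:(by []).
  have fgx : f x = g x by exact: nbhs_singleton fg.
  have fg0 : \forall h \near (0 : V), f (h + x) = g (h + x).
    by move: fg; rewrite (near_shift 0 x); apply: filterS => y /=; rewrite subr0.
  apply: filterS2 fg0 => y /= fgy.
  by rewrite !fctE /= fgx fgy.
apply/diff_locallyP; have -> := diff_unique dfc h.
by split.
Qed.

Section Entries.
Variables (V : normedModType R).

Lemma differentiable_bigsum (I : finType) (f : I -> V -> R) t :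
  (forall i, differentiable (f i) t) -> differentiable (fun v => \sum_i f i v) t.
Proof.
move=> h; have -> : (fun v => \sum_i f i v) = \sum_i f i.
  by apply/funext => v; rewrite fct_sumE.
by elim/big_ind : _ => // ? ? ? ?; exact: differentiableD.
Qed.

Lemma differentiable_bigprod (I : finType) (f : I -> V -> R) t :
  (forall i, differentiable (f i) t) -> differentiable (fun v => \prod_i f i v) t.
Proof.
move=> h; elim: (index_enum I) => [|i s ih].
  by under eq_fun do rewrite big_nil; exact: differentiable_cst.
by under eq_fun do rewrite big_cons; exact: differentiableM.
Qed.

Definition mxdiff m n (M : V -> 'M[R]_(m, n)) t :=
  forall i j, differentiable (fun v => M v i j) t.

Lemma mxdiff_cst m n (A : 'M[R]_(m, n)) t : mxdiff (fun=> A) t.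
Proof. by move=> i j; exact: differentiable_cst. Qed.

Lemma mxdiffD m n (M N : V -> 'M[R]_(m, n)) t : mxdiff M t -> mxdiff N t ->
  mxdiff (fun v => M v + N v) t.
Proof.
move=> dM dN i j; under eq_fun do rewrite mxE.
exact: differentiableD.
Qed.

Lemma mxdiffZ m n (c : V -> R) (M : V -> 'M[R]_(m, n)) t : differentiable c t ->
  mxdiff M t -> mxdiff (fun v => c v *: M v) t.
Proof.
move=> dc dM i j; under eq_fun do rewrite mxE.
exact: differentiableM.
Qed.

Lemma mxdiffM m n q (M : V -> 'M[R]_(m, n)) (N : V -> 'M[R]_(n, q)) t :
  mxdiff M t -> mxdiff N t -> mxdiff (fun v => M v *m N v) t.
Proof.
move=> dM dN i j; under eq_fun do rewrite mxE.
by apply: differentiable_bigsum => k; exact: differentiableM.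
Qed.

Lemma differentiable_det n (M : V -> 'M[R]_n) t : mxdiff M t ->
  differentiable (fun v => \det (M v)) t.
Proof.
move=> dM; rewrite /determinant; apply: differentiable_bigsum => s.
apply: differentiableM; first exact: differentiable_cst.
exact: differentiable_bigprod.
Qed.

Lemma mxdiff_adj n (M : V -> 'M[R]_n) t : mxdiff M t ->
  mxdiff (fun v => \adj (M v)) t.
Proof.
move=> dM i j; under eq_fun do rewrite mxE.
rewrite /cofactor; apply: differentiableM; first exact: differentiable_cst.
by apply: differentiable_det => k l; under eq_fun do rewrite !mxE.
Qed.

Lemma mxdiff_inv n (M : V -> 'M[R]_n) t : mxdiff M t -> M t \in unitmx ->
  mxdiff (fun v => invmx (M v)) t.
Proof.
move=> dM uM i j.
have d0 : \det (M t) != 0 by rewrite -unitfE -unitmxE.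
have dd := differentiable_det dM.
(* [invmx] returns its argument on singular matrices, so the adjugate formula holds only where the
   determinant is nonzero, that is, near t. *)
apply: (@near_eq_differentiable _ _ (fun v => (\det (M v))^-1 * \adj (M v) i j)).
  have H : nbhs t (fun v => \det (M v) != 0).
    exact: (differentiable_continuous dd (nbhs_neq0 d0)).
  by apply: filterS H => v /= dv; rewrite /invmx unitmxE unitfE dv [RHS]mxE.
apply: differentiableM; last exact: mxdiff_adj.
exact: differentiableV.
Qed.

Lemma mxdiffP m n (M : V -> 'M[R]_(m, n)) t : mxdiff M t -> differentiable M t.
Proof.
move=> dM; have -> : M = \sum_i \sum_j (fun v => M v i j *: delta_mx i j).
  apply/funext => v; rewrite fct_sumE {1}[M v]matrix_sum_delta.
  by apply: eq_bigr => i _; rewrite fct_sumE.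
apply: differentiable_sum => i; apply: differentiable_sum => j.
exact: differentiableZl.
Qed.

End Entries.

Lemma mxdiff_id m n (p : 'M[R]_(m, n)) : mxdiff id p.
Proof. by move=> i j; exact: differentiable_coord. Qed.

Lemma is_derive_line (V : normedModType R) (p e : V) (s : R) :
  is_derive s 1 (fun s : R => p + s *: e) e.
Proof.
apply: is_derive_eq; last exact: add0r.
apply: is_deriveD.
have : is_diff s ( *:%R^~ e : R -> V) ( *:%R^~ e) by exact: is_diff_scalel.
move=> h; apply: DeriveDef; first by apply: diff_derivable.
by rewrite deriveE // diff_val scale1r.
Qed.

Lemma is_derive_chain (V W : normedModType R) (f : V -> W) (c : R -> V) (s : R) (e : V) :
  differentiable f (c s) -> is_derive s 1 c e ->
  is_derive s 1 (f \o c) ('d f (c s) e).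
Proof.
move=> df dc.
have dc1 : differentiable c s by apply/derivable1_diffP.
have dfc : differentiable (f \o c) s by apply: differentiable_comp.
apply: DeriveDef; first exact: diff_derivable.
rewrite deriveE // diff_comp //=; congr ('d f (c s) _).
by rewrite -deriveE // derive_val.
Qed.

Lemma is_derive_along (V W : normedModType R) (f : V -> W) (p e : V) (s : R) :
  differentiable f (p + s *: e) ->
  is_derive s 1 (fun s : R => f (p + s *: e)) ('d f (p + s *: e) e).
Proof.
by move=> df; apply: is_derive_chain => //; exact: is_derive_line.
Qed.

Lemma derive0_eq (f : R -> R) : (forall s : R, 0 <= s <= 1 -> is_derive s 1 f 0) ->
  f 1 = f 0.
Proof.
move=> h; apply/eqP; rewrite -subr_eq0; apply/eqP.
have [|//|c _ ->] := @MVT R f (fun=> 0) 0 1 ltr01; last by rewrite mul0r.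
  by move=> x; rewrite in_itv /= => /andP[/ltW a /ltW b]; apply: h; rewrite a b.
apply: derivable_within_continuous => x; rewrite in_itv /= => hx.
by have [] := h _ hx.
Qed.

(** Extracts the orders 0 and 1 of an identity known only for small s > 0: the two-sided derivative
    at 0 can be evaluated along positive s. *)
Lemma right_zero_derive (f : R -> R) (l e : R) : 0 < e -> is_derive (0 : R) 1 f l ->
  (forall s : R, 0 < s < e -> f s = 0) -> f 0 = 0 /\ l = 0.
Proof.
move=> e0 df fz.
have f0 : f 0 = 0.
  have cf : {for 0, continuous f} by apply/differentiable_continuous/derivable1_diffP.
  apply/eqP/negP => /negP f0.
  have /(cf _) [/= d d0 h] : nbhs (f 0) [set x | x != 0].
    exact: nbhs_neq0.
  pose s := Num.min (d / 2) (e / 2).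
  have s0 : 0 < s by rewrite lt_min !divr_gt0.
  have := h s; rewrite /= sub0r normrN gtr0_norm //.
  rewrite fz ?eqxx.
    move=> /(_ _) /negP []//.
    by rewrite gt_min; apply/orP; left; rewrite ltr_pdivrMr // ltr_pMr // ltr1n.
  by rewrite s0 /= gt_min; apply/orP; right; rewrite ltr_pdivrMr // ltr_pMr // ltr1n.
split => //.
have [/cvg_ex[l' hl'] lE] := df.
have ll : l = l' by rewrite -lE; apply/cvg_lim.
rewrite ll; apply/eqP/negP => /negP l0.
have : nbhs l' [set x : R | x != 0].
  exact: nbhs_neq0.
move=> /hl' [/= d d0 h].
pose s := Num.min (d / 2) (e / 2).
have s0 : 0 < s by rewrite lt_min !divr_gt0.
have := h s; rewrite /= sub0r normrN gtr0_norm //.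
rewrite addr0 [_%:A]mulr1 fz.
  rewrite f0 subrr scaler0 eqxx => /(_ _ _) /negP []//.
    by rewrite gt_min; apply/orP; left; rewrite ltr_pdivrMr // ltr_pMr // ltr1n.
  by rewrite gt_eqF.
by rewrite s0 /= gt_min; apply/orP; right; rewrite ltr_pdivrMr // ltr_pMr // ltr1n.
Qed.

End Calculus.

Section MxDer.
Variable R : realType.

Definition mxder m n (M : R -> 'M[R]_(m, n)) (s : R) (D : 'M[R]_(m, n)) :=
  forall i j, is_derive s 1 (fun s => M s i j) (D i j).

Lemma is_derive_bigsum (I : finType) (f : I -> R -> R) (s : R) (d : I -> R) :
  (forall i, is_derive s 1 (f i) (d i)) ->
  is_derive s 1 (fun v => \sum_i f i v) (\sum_i d i).
Proof.
move=> h; have -> : (fun v => \sum_i f i v) = \sum_i f i.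
  by apply/funext => v; rewrite fct_sumE.
by elim/big_ind2 : _ => // [|? ? ? ? ? ?]; [exact: is_derive_cst|exact: is_deriveD].
Qed.

Lemma is_deriveM1 (f g : R -> R) (s df dg : R) :
  is_derive s 1 f df -> is_derive s 1 g dg ->
  is_derive s 1 (fun s => f s * g s) (df * g s + f s * dg).
Proof.
move=> hf hg; apply: is_derive_eq (is_deriveM hf hg) _.
by rewrite addrC /GRing.scale /= mulrC.
Qed.

Lemma mxder_cst m n (A : 'M[R]_(m, n)) s : mxder (fun=> A) s 0.
Proof. by move=> i j; rewrite mxE; exact: is_derive_cst. Qed.

Lemma mxderD m n (M N : R -> 'M[R]_(m, n)) s D E : mxder M s D -> mxder N s E ->
  mxder (fun v => M v + N v) s (D + E).
Proof.
move=> dM dN i j; rewrite mxE; under eq_fun do rewrite mxE.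
exact: is_deriveD.
Qed.

Lemma mxderZ m n (c : R -> R) (M : R -> 'M[R]_(m, n)) (s : R) (dc : R) D : is_derive s 1 c dc ->
  mxder M s D -> mxder (fun v => c v *: M v) s (dc *: M s + c s *: D).
Proof.
move=> hc dM i j; rewrite !mxE; under eq_fun do rewrite mxE.
exact: is_deriveM1.
Qed.

Lemma mxderM m n q (M : R -> 'M[R]_(m, n)) (N : R -> 'M[R]_(n, q)) s D E :
  mxder M s D -> mxder N s E ->
  mxder (fun v => M v *m N v) s (D *m N s + M s *m E).
Proof.
move=> dM dN i j; rewrite !mxE -big_split /=; under eq_fun do rewrite mxE.
by apply: is_derive_bigsum => k; exact: is_deriveM1.
Qed.

Lemma mxder_line m n (p e : 'M[R]_(m, n)) s : mxder (fun s => p + s *: e) s e.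
Proof.
move=> i j; under eq_fun do rewrite !mxE.
exact: (is_derive_line (p i j) (e i j) s).
Qed.

Lemma mxder_tr n (M : R -> 'M[R]_n) (s : R) D : mxder M s D ->
  is_derive s 1 (fun s => \tr (M s)) (\tr D).
Proof. by move=> dM; apply: is_derive_bigsum. Qed.

Lemma mxder_is_derive m n (M : R -> 'M[R]_(m, n)) (s : R) D : mxder M s D ->
  is_derive s 1 M D.
Proof.
move=> dM; have dd : derivable M s 1 by apply/derivable_mxP => i j; have [] := dM i j.
apply: DeriveDef => //; rewrite derive_mx //.
by apply/matrixP => i j; rewrite mxE; have [_ ->] := dM i j.
Qed.

Lemma is_derive_uniq (V W : normedModType R) (f : V -> W) x v a b :
  is_derive x v f a -> is_derive x v f b -> a = b.
Proof. by move=> [_ <-] [_ <-]. Qed.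

Lemma mxder_uniq m n (M : R -> 'M[R]_(m, n)) s D E : mxder M s D -> mxder M s E -> D = E.
Proof. by move=> h k; apply/matrixP => i j; exact: is_derive_uniq (h i j) (k i j). Qed.

(** Differentiability comes from the adjugate formula; the value then results from differentiating M
    M^-1 = 1, which holds near s. *)
Lemma mxder_inv n (M : R -> 'M[R]_n) s D : mxder M s D -> M s \in unitmx ->
  mxder (fun v => invmx (M v)) s (- (invmx (M s) *m D *m invmx (M s))).
Proof.
move=> dM uM.
have dM1 : mxdiff M s by move=> i j; apply/derivable1_diffP; have [] := dM i j.
have dI := mxdiff_inv dM1 uM.
pose E := \matrix_(i, j) 'D_1 (fun v => invmx (M v) i j) s.
have dE : mxder (fun v => invmx (M v)) s E.
  move=> i j; rewrite mxE; apply: derivableP; apply/derivable1_diffP; exact: dI.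
have H : nbhs s (fun v => M v \in unitmx).
  have d0 : \det (M s) != 0 by rewrite -unitfE -unitmxE.
  have H : nbhs s (fun v => \det (M v) != 0).
    exact: (differentiable_continuous (differentiable_det dM1) (nbhs_neq0 d0)).
  by apply: filterS H => v /= dv; rewrite unitmxE unitfE.
have d1 := mxderM dM dE.
have d2 : mxder (fun v => M v *m invmx (M v)) s 0.
  move=> i j; rewrite mxE.
  apply: (@near_eq_is_derive _ _ _ (cst ((1%:M : 'M[R]_n) i j : R))).
  by apply: filterS H => v uv; rewrite mulmxV.
have := mxder_uniq d1 d2 => /eqP; rewrite addr_eq0 => /eqP e.
suff -> : - (invmx (M s) *m D *m invmx (M s)) = E by [].
by rewrite -mulmxA e mulmxN opprK (mulKmx uM).
Qed.

Lemma is_derive_det n (p e : 'M[R]_n) :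
  is_derive (0 : R) 1 (fun s : R => \det (p + s *: e)) (\tr (\adj p *m e)).
Proof.
have dd q : differentiable (fun x : 'M[R]_n => \det x) q.
  by apply: differentiable_det; exact: mxdiff_id.
(* The expansion along row i is affine in the entry (i, j), because the cofactors of that row do not
   involve the row itself. *)
have del i j : 'd (fun x : 'M[R]_n => \det x) p (delta_mx i j) = cofactor p i j.
  have h1 := is_derive_along (dd (p + 0 *: delta_mx i j)).
  have h2 : is_derive (0 : R) 1 (fun s : R => \det (p + s *: delta_mx i j)) (cofactor p i j).
    have -> : (fun s : R => \det (p + s *: delta_mx i j)) =
              (fun s => \det p + s *: cofactor p i j).
      apply/funext => s; rewrite (expand_det_row _ i) [\det p](expand_det_row _ i).
      have cE k : cofactor (p + s *: delta_mx i j) i k = cofactor p i k.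
        rewrite /cofactor; congr (_ * \det _); apply/matrixP => a b.
        by rewrite !mxE (eq_sym _ i) (negPf (neq_lift _ _)) /= mulr0 addr0.
      under eq_bigr do rewrite cE !mxE eqxx /= mulrDl.
      rewrite big_split /=; congr (_ + _).
      rewrite (bigD1 j) //= eqxx mulr1 big1 ?addr0 // => k /negPf kj.
      by rewrite kj mulr0 mul0r.
    exact: is_derive_line.
  by have := is_derive_uniq h1 h2; rewrite scale0r addr0.
have := is_derive_along (dd (p + 0 *: e)); rewrite scale0r addr0.
move=> h; apply: is_derive_eq h _.
rewrite {1}[e]matrix_sum_delta linear_sum /=.
rewrite /mxtrace; under [RHS]eq_bigr do rewrite mxE.
rewrite [RHS]exchange_big /=; apply: eq_bigr => i _.
rewrite linear_sum; apply: eq_bigr => j _.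
by rewrite linearZ /= del !mxE mulrC.
Qed.

Lemma is_derive_shift_line (V W : normedModType R) (f : V -> W) (p e : V) (s : R) l :
  is_derive (0 : R) 1 (fun t : R => f (p + s *: e + t *: e)) l ->
  is_derive s 1 (fun t : R => f (p + t *: e)) l.
Proof.
have E : (fun h : R => h^-1 *: (f (p + (h *: (1 : R) + s : R) *: e) - f (p + s *: e))) =
     (fun h : R => h^-1 *: (f (p + s *: e + (h *: (1 : R) + 0 : R) *: e) - f (p + s *: e + (0 : R) *: e))).
  apply/funext => h; rewrite scale0r !addr0; congr (_ *: (f _ - _)).
  by rewrite scalerDl addrAC addrA.
move=> [h1 h2]; apply: DeriveDef.
  by move: h1; rewrite /derivable /= -E.
by move: h2; rewrite /derive /= -E.
Qed.

End MxDer.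

Section PosDefCalc.
Variables (R : realType) (r : nat).
Implicit Types (p q e a x y : 'M[R]_r).

Lemma posdef_plane p (h k : 'M[R]_r) : posdef p -> h^T = h -> k^T = k -> exists2 d : R, 0 < d &
  forall s t, `|s| < d -> `|t| < d -> posdef (p + s *: h + t *: k).
Proof.
move=> pp sh sk; have [d d0 H] := posdef_open pp.
pose M := 1 + \sum_i \sum_j (`|h i j| + `|k i j|).
have M0 : 0 < M.
  by rewrite ltr_wpDr // sumr_ge0 // => i _; rewrite sumr_ge0 // => j _; rewrite addr_ge0.
exists (d / M); first by rewrite divr_gt0.
move=> s t hs ht; apply: H.
  by rewrite !linearD /= !linearZ /= sh sk (posdef_sym pp).
move=> i j; rewrite !mxE.
have -> : p i j + s * h i j + t * k i j - p i j = s * h i j + t * k i j by ring.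
have hM : `|h i j| + `|k i j| < M.
  rewrite /M (bigD1 i) //= (bigD1 j) //=.
  have : 0 <= \sum_(l < r | l != i) \sum_j (`|h l j| + `|k l j|).
    by rewrite sumr_ge0 // => l _; rewrite sumr_ge0 // => ? _; rewrite addr_ge0.
  have : 0 <= \sum_(l < r | l != j) (`|h i l| + `|k i l|).
    by rewrite sumr_ge0 // => ? _; rewrite addr_ge0.
  lra.
apply: (@le_lt_trans _ _ (d / M * (`|h i j| + `|k i j|))).
  apply: le_trans (ler_normD _ _) _; rewrite !normrM mulrDr.
  by apply: lerD; apply: ler_wpM2r => //; exact: ltW.
by rewrite mulrAC ltr_pdivrMr // ltr_pM2l.
Qed.

Lemma posdef_line p e : posdef p -> e^T = e -> exists2 d : R, 0 < d &
  forall s, `|s| < d -> posdef (p + s *: e).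
Proof.
move=> pp se; have [d d0 h] := posdef_plane pp se se; exists d => // s hs.
by have := h s 0 hs; rewrite normr0 scale0r addr0; apply.
Qed.

Lemma posdef_near p e : posdef p -> e^T = e ->
  \forall s \near (0 : R), posdef (p + s *: e).
Proof.
move=> pp se; have [d d0 h] := posdef_line pp se.
by exists d => //= s; rewrite /= sub0r normrN; exact: h.
Qed.

(** The cone is convex: along the segment from p to q all directional derivatives vanish. *)
Lemma posdef_const (f : 'M[R]_r -> R) :
  (forall p e, posdef p -> e^T = e ->
    is_derive (0 : R) 1 (fun s : R => f (p + s *: e)) 0) ->
  forall p q, posdef p -> posdef q -> f p = f q.
Proof.
move=> h p q pp pq; have se : (q - p)^T = q - p.
  by rewrite linearB /= (posdef_sym pp) (posdef_sym pq).
have := @derive0_eq _ (fun s => f (p + s *: (q - p))).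
rewrite /= scale0r addr0 scale1r (addrC p (q - p)) subrK => H.
apply/esym/H => s hs; apply: is_derive_shift_line; apply: h => //; exact: posdef_seg.
Qed.

Lemma is_derive_lndet p e : posdef p ->
  is_derive (0 : R) 1 (fun s : R => ln (\det (p + s *: e))) (\tr (invmx p *m e)).
Proof.
move=> pp; have d0 := det_gt0 pp.
have h1 := is_derive_det p e.
have h2 : is_derive (\det (p + 0 *: e)) 1 (@ln R) (\det p)^-1.
  by rewrite scale0r addr0; exact: is_derive1_ln.
have := is_derive1_comp h2 h1; rewrite /= => h3.
apply: is_derive_eq h3 _.
rewrite /invmx posdef_unit // -scalemxAl mxtraceZ.
by rewrite /GRing.scale /= mulrC.
Qed.

Lemma mxder_inv_line p e : posdef p ->
  mxder (fun s : R => invmx (p + s *: e)) 0 (- (invmx p *m e *m invmx p)).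
Proof.
move=> pp; have := @mxder_inv _ _ (fun s : R => p + s *: e) 0 e.
rewrite scale0r addr0; apply; first exact: mxder_line.
exact: posdef_unit.
Qed.

End PosDefCalc.

(** * Symmetry of the second derivative at a point *)

Section SecondDerivative.
Variables (R : realType) (V : normedModType R).
Implicit Types (f g : V -> R) (p h k v : V).

Lemma differentiable_expansion g p : differentiable g p ->
  forall eps : R, 0 < eps -> exists2 d : R, 0 < d &
    forall v, `|v| < d -> `|g (p + v) - g p - 'd g p v| <= eps * `|v|.
Proof.
move=> /diff_locallyP[_ /eqaddoP e] eps eps0.
have /nbhs_ballP[d /= d0 h] := e eps eps0.
exists d => // v vd; have := h v; rewrite -ball_normE /= sub0r normrN => /(_ vd).
by rewrite !fctE /= (addrC v) opprD addrA.
Qed.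

Definition rectdiff f p h k (t : R) :=
  f (p + t *: h + t *: k) - f (p + t *: h) - (f (p + t *: k) - f p).

(** The mean value theorem in direction h turns the second difference into a difference of two
    values of ['D_h f], and these are expanded to first order at p. Differentiability of ['D_h f] at
    the single point p suffices, without continuity of second derivatives. *)
Lemma rectdiff_lim f p h k (e : R) : 0 < e ->
  (forall s t, `|s| < e -> `|t| < e -> differentiable f (p + s *: h + t *: k)) ->
  differentiable ('D_h f) p ->
  forall eta : R, 0 < eta -> exists2 d : R, 0 < d &
    forall t, 0 < t < d ->
      `|rectdiff f p h k t - t ^+ 2 * 'd ('D_h f) p k| <= eta * t ^+ 2.
Proof.
move=> e0 df dDf eta eta0.
(* The two expansion errors are proportional to t (|h| + |k|) and t |h|; the extra 1 makes C
   positive. *)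
pose C := 2 * `|h| + `|k| + 1.
have C0 : 0 < C by rewrite ltr_wpDl // addr_ge0 // mulr_ge0.
have [d d0 hd] := differentiable_expansion dDf (divr_gt0 eta0 C0).
exists (Num.min e (d / C)); first by rewrite lt_min e0 divr_gt0.
move=> t /andP[t0]; rewrite lt_min => /andP[te td].
pose psi s := f (p + s *: h + t *: k) - f (p + s *: h).
have te' : `|t| < e by rewrite gtr0_norm.
have z0 : `|0 : R| < e by rewrite normr0.
have dpsi s : 0 <= s <= t -> is_derive s 1 psi
   ('D_h f (p + s *: h + t *: k) - 'D_h f (p + s *: h)).
  move=> /andP[s0 st]; have se : `|s| < e by rewrite ger0_norm // (le_lt_trans st).
  have d1 : differentiable f (p + s *: h + t *: k) by exact: df.
  have d2 : differentiable f (p + s *: h) by have := df s 0 se z0; rewrite scale0r addr0.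
  rewrite !deriveE //; apply: is_deriveB; last exact: is_derive_along.
  have := @is_derive_along R V R f (p + t *: k) h s.
  rewrite (addrAC p); under eq_fun do rewrite addrAC.
  exact.
have [||xi] := @MVT R psi (fun s => 'D_h f (p + s *: h + t *: k) - 'D_h f (p + s *: h)) 0 t t0.
- by move=> x; rewrite in_itv /= => /andP[/ltW a /ltW b]; apply: dpsi; rewrite a.
- apply: derivable_within_continuous => x; rewrite in_itv /= => hx.
  by have [] := dpsi _ hx.
rewrite in_itv /= => /andP[xi0 xit]; rewrite {1 2}/psi scale0r addr0 subr0 => e1.
rewrite /rectdiff e1.
have n1 : `|xi *: h + t *: k| <= t * (`|h| + `|k|).
  apply: le_trans (ler_normD _ _) _; rewrite !normrZ (gtr0_norm t0) (gtr0_norm xi0).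
  by rewrite mulrDr lerD2r ler_wpM2r // ltW.
have n2 : `|xi *: h| <= t * `|h|.
  by rewrite normrZ (gtr0_norm xi0) ler_wpM2r // ltW.
have tC : t * C < d by rewrite -ltr_pdivlMr.
have ba : t * (`|h| + `|k|) < d.
  by apply: le_lt_trans tC; rewrite ler_pM2l // /C; have := normr_ge0 h; lra.
have bb : t * `|h| < d.
  apply: le_lt_trans tC; rewrite ler_pM2l // /C.
  by have := normr_ge0 h; have := normr_ge0 k; lra.
have h1 := hd _ (le_lt_trans n1 ba).
have h2 := hd _ (le_lt_trans n2 bb).
rewrite addrA in h1.
have LE : 'd ('D_h f) p (xi *: h + t *: k) =
    'd ('D_h f) p (xi *: h) + t * 'd ('D_h f) p k.
  by rewrite linearD; congr (_ + _); rewrite linearZ.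
rewrite LE in h1; move: h1 h2.
set A := 'D_h f (_ + _ + _); set B := 'D_h f (_ + _); set g0 := 'D_h f p.
set X := 'd _ _ (xi *: h); set Y := 'd _ _ k => h1 h2.
have E : (A - B) * t - t ^+ 2 * Y = t * ((A - g0 - (X + t * Y)) - (B - g0 - X)) by ring.
rewrite E normrM (gtr0_norm t0).
apply: (@le_trans _ _ (t * (eta / C * (t * (`|h| + `|k|)) + eta / C * (t * `|h|)))).
  rewrite ler_pM2l //; apply: le_trans (ler_normB _ _) _; apply: lerD.
    by apply: le_trans h1 _; rewrite ler_wpM2l // ltW // divr_gt0.
  by apply: le_trans h2 _; rewrite ler_wpM2l // ltW // divr_gt0.
set q := eta / C; have qC : eta = q * C by rewrite /q divfK ?gt_eqF.
have q0 : 0 < q by rewrite divr_gt0.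
have -> : t * (q * (t * (`|h| + `|k|)) + q * (t * `|h|)) =
  q * t ^+ 2 * (2 * `|h| + `|k|) by ring.
rewrite qC [leRHS]mulrAC; apply: ler_wpM2l; last by rewrite /C lerDl.
by rewrite mulr_ge0 ?sqr_ge0 // ltW.
Qed.

Lemma rectdiffC f p h k t : rectdiff f p h k t = rectdiff f p k h t.
Proof. by rewrite /rectdiff (addrAC p); ring. Qed.

Lemma quadratic_coef_uniq (D : R -> R) (a b : R) :
  (forall eta : R, 0 < eta -> exists2 d : R, 0 < d &
    forall t, 0 < t < d -> `|D t - t ^+ 2 * a| <= eta * t ^+ 2) ->
  (forall eta : R, 0 < eta -> exists2 d : R, 0 < d &
    forall t, 0 < t < d -> `|D t - t ^+ 2 * b| <= eta * t ^+ 2) ->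
  a = b.
Proof.
move=> ha hb; apply/eqP/negP => /negP ne.
pose eta := `|a - b| / 4.
have ab0 : 0 < `|a - b| by rewrite normr_gt0 subr_eq0.
have eta0 : 0 < eta by rewrite divr_gt0.
have [d1 d10 h1] := ha _ eta0.
have [d2 d20 h2] := hb _ eta0.
pose t := Num.min d1 d2 / 2.
have t0 : 0 < t by rewrite divr_gt0 // lt_min d10.
have td : t < Num.min d1 d2 by rewrite ltr_pdivrMr // ltr_pMr ?lt_min ?d10 // ltr1n.
move: td; rewrite lt_min => /andP[td1 td2].
have := h1 t; rewrite t0 td1 => /(_ isT) H1.
have := h2 t; rewrite t0 td2 => /(_ isT) H2.
have t20 : 0 < t ^+ 2 by rewrite exprn_gt0.
have : t ^+ 2 * `|a - b| <= 2 * eta * t ^+ 2.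
  rewrite -{1}(gtr0_norm t20) -normrM.
  have -> : t ^+ 2 * (a - b) = (D t - t ^+ 2 * b) - (D t - t ^+ 2 * a) by ring.
  by apply: le_trans (ler_normB _ _) _; lra.
rewrite mulrC ler_pM2r // /eta; lra.
Qed.

(** The second difference is symmetric in h and k, and each mixed derivative is its coefficient of t
    ^ 2. *)
Lemma second_derivative_sym f p h k (e : R) : 0 < e ->
  (forall s t, `|s| < e -> `|t| < e -> differentiable f (p + s *: h + t *: k)) ->
  differentiable ('D_h f) p -> differentiable ('D_k f) p ->
  'd ('D_h f) p k = 'd ('D_k f) p h.
Proof.
move=> e0 df dh dk.
apply: (quadratic_coef_uniq (rectdiff_lim e0 df dh)) => eta eta0.
have df' s t : `|s| < e -> `|t| < e -> differentiable f (p + s *: k + t *: h).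
  by move=> ? ?; rewrite addrAC; exact: df.
have [d d0 hd] := rectdiff_lim e0 df' dk eta0.
by exists d => // t ht; rewrite rectdiffC; exact: hd.
Qed.

End SecondDerivative.

(** * The functional equation *)

Section Gradient.
Variables (R : realType) (r : nat).
Implicit Types (f g : 'M[R]_r -> R) (p e m h P Q : 'M[R]_r).

Definition lform (phi : 'I_r -> 'I_r -> R) e : R := \sum_i \sum_j e i j * phi i j.

Lemma lformD phi e e' : lform phi (e + e') = lform phi e + lform phi e'.
Proof.
rewrite /lform -big_split; apply: eq_bigr => i _; rewrite -big_split.
by apply: eq_bigr => j _; rewrite mxE mulrDl.
Qed.

Lemma lformZ phi a e : lform phi (a *: e) = a * lform phi e.
Proof.
rewrite /lform mulr_sumr; apply: eq_bigr => i _; rewrite mulr_sumr.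
by apply: eq_bigr => j _; rewrite mxE mulrA.
Qed.

Lemma is_derive_lform (phi : 'I_r -> 'I_r -> R -> R) (s : R) d e :
  (forall i j, is_derive s 1 (phi i j) (d i j)) ->
  is_derive s 1 (fun s => lform (fun i j => phi i j s) e) (lform d e).
Proof. by move=> h; do 2!apply: is_derive_bigsum => ?. Qed.

Lemma lform_sym (phi : 'I_r -> 'I_r -> R) : exists l : 'M[R]_r, l^T = l /\
  forall e, e^T = e -> lform phi e = \tr (l *m e).
Proof.
exists (\matrix_(i, j) (2^-1 * (phi i j + phi j i))); split.
  by apply/matrixP => i j; rewrite !mxE addrC.
move=> e se; rewrite /lform /mxtrace.
have eC i j : e j i = e i j by rewrite -[in LHS]se mxE.
transitivity (2^-1 * ((\sum_i \sum_j e i j * phi i j) + (\sum_i \sum_j e j i * phi j i))).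
  rewrite [X in _ + X]exchange_big /=; lra.
rewrite -big_split mulr_sumr; apply: eq_bigr => i _ /=.
rewrite mxE -big_split mulr_sumr; apply: eq_bigr => j _ /=.
rewrite mxE eC; ring.
Qed.

(** The differential in terms of partial derivatives: it is linear in e by construction and, p being
    a parameter of the coefficients, can be differentiated in p entry by entry. *)
Definition dG f p e : R := lform (fun i j => 'D_(delta_mx i j) f p) e.

Lemma dGE f p e : differentiable f p -> 'd f p e = dG f p e.
Proof.
move=> df; rewrite /dG /lform {1}[e]matrix_sum_delta linear_sum.
apply: eq_bigr => i _; rewrite linear_sum; apply: eq_bigr => j _.
by rewrite linearZ deriveE.
Qed.

Lemma deriveG f p e : differentiable f p -> 'D_e f p = dG f p e.
Proof. by move=> df; rewrite deriveE // dGE. Qed.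

Lemma is_derive_path f (c : R -> 'M[R]_r) (s : R) D : differentiable f (c s) ->
  mxder c s D -> is_derive s 1 (fun s => f (c s)) (dG f (c s) D).
Proof.
move=> df dc; rewrite -dGE //; apply: is_derive_chain => //.
exact: mxder_is_derive.
Qed.

Lemma is_derive_dG f p e : differentiable f p ->
  is_derive (0 : R) 1 (fun s : R => f (p + s *: e)) (dG f p e).
Proof.
move=> df; have := @is_derive_path f (fun s : R => p + s *: e) 0 e.
by rewrite scale0r addr0; apply => //; exact: mxder_line.
Qed.

Lemma cocycle_derive f (l : 'M[R]_r -> 'M[R]_r -> R) :
  (forall p e, posdef p -> e^T = e ->
    is_derive (0 : R) 1 (fun s : R => f (p + s *: e)) (l p e)) ->
  (forall p q h, h^T = h -> posdef p -> posdef q -> posdef (p + h) -> posdef (q + h) ->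
    f (p + h) - f p = f (q + h) - f q) ->
  forall p q e, posdef p -> posdef q -> e^T = e -> l p e = l q e.
Proof.
move=> df cf p q e pp pq se.
have d2 : is_derive (0 : R) 1 (fun s : R => f (q + s *: e) + (f p - f q)) (l q e).
  by apply: is_derive_eq (is_deriveD (df q e pq se) (is_derive_cst (f p - f q) (0 : R) 1)) (addr0 _).
apply: is_derive_uniq (df p e pp se) _.
apply: near_eq_is_derive d2.
near=> s.
have ps : posdef (p + s *: e) by near: s; exact: posdef_near.
have qs : posdef (q + s *: e) by near: s; exact: posdef_near.
have := cf p q (s *: e); rewrite linearZ /= se => /(_ erefl pp pq ps qs).
by move=> /eqP; rewrite subr_eq => /eqP ->; ring.
Unshelve. all: by end_near. Qed.

(** Polarization: the rank-one matrices of e_i, e_j and e_i + e_j generate e_i e_j^T + e_j e_i^T,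
    and these span the symmetric matrices. *)
Lemma mxtrace_sym_zero f : (forall a x y, f (a *: x + y) = a * f x + f y) ->
  (forall v : 'cV[R]_r, f (v *m v^T) = 0) -> forall P, P^T = P -> f P = 0.
Proof.
move=> lf f0 P sP.
have fD x y : f (x + y) = f x + f y by rewrite -[x]scale1r lf mul1r scale1r.
have fz : f 0 = 0.
  by have := fD 0 0; rewrite addr0 => /eqP; rewrite -subr_eq0 opprD addrA subrr sub0r oppr_eq0 => /eqP.
have fZ a x : f (a *: x) = a * f x by rewrite -[a *: x]addr0 lf fz addr0.
have ps i j : f (delta_mx i j + delta_mx j i) = 0.
  have dE (k l : 'I_r) : (delta_mx k 0 : 'cV[R]_r) *m (delta_mx l 0 : 'cV[R]_r)^T = delta_mx k l.
    by rewrite trmx_delta mul_delta_mx.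
  have := f0 (delta_mx i 0 + delta_mx j 0).
  by rewrite linearD /= mulmxDl !mulmxDr !fD !f0 !dE add0r addr0.
have -> : P = 2^-1 *: \sum_i \sum_j P i j *: (delta_mx i j + delta_mx j i).
  have e1 : \sum_i \sum_j P i j *: delta_mx i j = P by rewrite -matrix_sum_delta.
  have e2 : \sum_i \sum_j P i j *: delta_mx j i = P.
    rewrite exchange_big /= -[RHS]sP [RHS]matrix_sum_delta.
    by apply: eq_bigr => i _; apply: eq_bigr => j _; rewrite mxE.
  have -> : \sum_i \sum_j P i j *: (delta_mx i j + delta_mx j i) = P + P.
    transitivity (\sum_i \sum_j P i j *: delta_mx i j + \sum_i \sum_j P i j *: delta_mx j i); last by rewrite e1 e2.
    rewrite -big_split; apply: eq_bigr => i _; rewrite -big_split.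
    by apply: eq_bigr => j _; rewrite scalerDr.
  rewrite scalerDr -scalerDl (_ : 2^-1 + 2^-1 = 1 :> R) ?scale1r //; lra.
rewrite fZ (big_morph f fD fz) big1 ?mulr0 // => i _.
by rewrite (big_morph f fD fz) big1 // => j _; rewrite fZ ps mulr0.
Qed.

Lemma dotC (v w : 'cV[R]_r) : (v^T *m w) 0 0 = (w^T *m v) 0 0.
Proof. by rewrite -[v^T *m w]trmxK trmx_mul trmxK mxE. Qed.

Lemma mulmx_rank1 (v : 'cV[R]_r) m : (v *m v^T) *m m *m (v *m v^T) = qf m v *: (v *m v^T).
Proof.
transitivity (v *m ((v^T *m m *m v) *m v^T)); first by rewrite !mulmxA.
by rewrite [v^T *m m *m v]mx11_scalar mul_scalar_mx -scalemxAr.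
Qed.

Lemma tr_rank1 (v : 'cV[R]_r) m : \tr ((v *m v^T) *m m) = qf m v.
Proof.
by rewrite -mulmxA mxtrace_mulC /mxtrace big_ord1.
Qed.

Lemma posdef_rank1 (v : 'cV[R]_r) eps : 0 < eps -> posdef (v *m v^T + eps *: 1%:M).
Proof.
move=> e0; split.
  by rewrite linearD /= linearZ /= trmx1 trmx_mul trmxK.
move=> w w0; rewrite -/(qf _ w) qfD qfZ; have := qf1_gt0 w0 => h.
rewrite ltr_wpDl ?mulr_gt0 // /qf mulmxA -[_ *m v *m v^T *m w]mulmxA mxE big_ord1.
by rewrite (dotC v) -expr2 sqr_ge0.
Qed.

(** Taking Q = v v^T + eps I and reading off the constant term in eps gives [qf m v * lam (v v^T) e
    = qf e v * lam (v v^T) m]. Hence [lam (v v^T)] is a multiple c(v) of the form e -> v^T e v. The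
    choice Q = I with m = v v^T and e = w w^T then gives c(v) = c(w) whenever v and w are not
    orthogonal. *)
Lemma bilinear_sym_scalar (lam : 'M[R]_r -> 'M[R]_r -> R) :
  (forall a x y e, lam (a *: x + y) e = a * lam x e + lam y e) ->
  (forall a x y e, lam e (a *: x + y) = a * lam e x + lam e y) ->
  (forall Q m e, posdef Q -> m^T = m -> e^T = e ->
     lam (Q *m m *m Q) e = lam (Q *m e *m Q) m) ->
  exists c, forall P e, P^T = P -> e^T = e -> lam P e = c * \tr (P *m e).
Proof.
move=> l1 l2 hs.
have l1D x y e : lam (x + y) e = lam x e + lam y e by rewrite -[x]scale1r l1 mul1r scale1r.
have l1z e : lam 0 e = 0.
  by have := l1D 0 0 e; rewrite addr0 => /eqP; rewrite -subr_eq0 opprD addrA subrr sub0r oppr_eq0 => /eqP.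
have l1Z a x e : lam (a *: x) e = a * lam x e by rewrite -[a *: x]addr0 l1 l1z addr0.
have key (v : 'cV[R]_r) m e : m^T = m -> e^T = e ->
    qf m v * lam (v *m v^T) e = qf e v * lam (v *m v^T) m.
  move=> sm se; set V := v *m v^T.
  have ex (x : 'M[R]_r) eps : (V + eps *: 1%:M) *m x *m (V + eps *: 1%:M) =
      qf x v *: V + eps *: (V *m x + x *m V) + eps ^+ 2 *: x.
    rewrite mulmxDl -scalemxAl mul1mx !mulmxDr !mulmxDl -!scalemxAl -!scalemxAr.
    rewrite !mulmx1 mulmx_rank1 scalerDr scalerA -expr2 !addrA; congr (_ + _).
    by rewrite addrAC.
  pose A := qf m v * lam V e - qf e v * lam V m.
  pose B := lam (V *m m + m *m V) e - lam (V *m e + e *m V) m.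
  pose D := lam m e - lam e m.
  have h eps : 0 < eps -> A + eps * B + eps ^+ 2 * D = 0.
    move=> e0; have := hs _ m e (posdef_rank1 v e0) sm se.
    rewrite -/V !ex !l1D !l1Z /A /B /D !l1D => /eqP; rewrite -subr_eq0 => /eqP <-; ring.
  (* A polynomial of degree at most 2 in eps that vanishes at 1, 2 and 3 has zero constant term. *)
  have := h 1 ltr01; have := h 2 (ltr0n _ 2); have := h 3 (ltr0n _ 3) => h3 h2 h1.
  by apply/eqP; rewrite -subr_eq0 -/A; apply/eqP; lra.
have s1 : (1%:M : 'M[R]_r)^T = 1%:M by rewrite trmx1.
have keyc (v : 'cV[R]_r) e : v != 0 -> e^T = e ->
    lam (v *m v^T) e = lam (v *m v^T) 1%:M / qf 1%:M v * qf e v.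
  move=> v0 se; have := key v 1%:M e s1 se; have := qf1_gt0 v0 => q0 h.
  by rewrite mulrAC -[in RHS](mulrC (qf e v)) -h mulrAC mulfV ?gt_eqF // mul1r.
pose c v := lam (v *m v^T) 1%:M / qf 1%:M v.
have sV (v : 'cV[R]_r) : (v *m v^T)^T = v *m v^T by rewrite trmx_mul trmxK.
have qV (v w : 'cV[R]_r) : qf (w *m w^T) v = ((v^T *m w) 0 0) ^+ 2.
  rewrite /qf mulmxA -[_ *m w *m w^T *m v]mulmxA mxE big_ord1.
  by rewrite (dotC w) -expr2.
have cc1 (v w : 'cV[R]_r) : v != 0 -> w != 0 -> (v^T *m w) 0 0 != 0 -> c v = c w.
  move=> v0 w0 vw.
  have := hs 1%:M (v *m v^T) (w *m w^T) (posdef1 R r) (sV v) (sV w).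
  rewrite !mul1mx !mulmx1 (keyc v) // (keyc w) // -/(c v) -/(c w) !qV.
  rewrite (dotC w v).
  by apply: mulIf; rewrite sqrf_eq0.
have qq (v : 'cV[R]_r) : (v^T *m v) 0 0 = qf 1%:M v by rewrite /qf mulmx1.
have cc (v w : 'cV[R]_r) : v != 0 -> w != 0 -> c v = c w.
  (* Orthogonal v and w are compared through v + w, which is orthogonal to neither. *)
  move=> v0 w0; have [vw|vw] := eqVneq ((v^T *m w) 0 0) 0; last exact: cc1.
  have wv : (w^T *m v) 0 0 = 0 by rewrite dotC.
  have e1 : (v^T *m (v + w)) 0 0 = qf 1%:M v by rewrite mulmxDr mxE vw addr0 qq.
  have e2 : (w^T *m (v + w)) 0 0 = qf 1%:M w by rewrite mulmxDr mxE wv add0r qq.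
  have u0 : v + w != 0.
    apply/eqP => u0; move: e1; rewrite u0 mulmx0 mxE => /esym/eqP.
    by rewrite gt_eqF // qf1_gt0.
  by rewrite (cc1 v (v + w)) ?(cc1 w (v + w)) // ?e1 ?e2 gt_eqF // qf1_gt0.
(* Without a nonzero vector the dimension is 0 and every matrix is zero. *)
have [[v0 hv0]|none] := pselect (exists v : 'cV[R]_r, v != 0); last first.
  exists 0 => P e sP se.
  have -> : P = 0.
    apply/matrixP => i j; exfalso; apply: none.
    exists (delta_mx i 0); apply/eqP => /matrixP /(_ i 0); rewrite !mxE !eqxx /=.
    by move/eqP; rewrite oner_eq0.
  by rewrite l1z mul0r.
exists (c v0) => P e sP se.
apply/eqP; rewrite -subr_eq0; apply/eqP.
apply: (@mxtrace_sym_zero (fun P => lam P e - c v0 * \tr (P *m e))) => //.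
  by move=> a x y; rewrite l1 mulmxDl -scalemxAl mxtraceD mxtraceZ; ring.
move=> v; have [->|vn0] := eqVneq v 0.
  by rewrite mul0mx mul0mx mxtrace0 mulr0 l1z subrr.
by rewrite keyc // tr_rank1 -/(c v) (cc v v0) // subrr.
Qed.

End Gradient.

(** * Integration of the first-order condition on G *)

Section GradientCocycle.
Variables (R : realType) (r : nat).
Implicit Types (p e x y h P Q : 'M[R]_r).

Definition tdiff (G : 'M[R]_r -> R) := forall p, posdef p ->
  differentiable G p /\ forall e, differentiable ('D_e G) p.

Variables (G : 'M[R]_r -> R) (m : 'M[R]_r).
Hypotheses (dG2 : tdiff G) (sm : m^T = m).

Let dG1 p : posdef p -> differentiable G p.
Proof. by move=> /dG2[]. Qed.

Let S p e x : R := lform (fun i j => dG ('D_(delta_mx i j) G) p e) x.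

(* [S p e x] is the Hessian of [G] at [p] in the directions [e], [x]. *)
Lemma hess_sym p e x : posdef p -> e^T = e -> x^T = x -> S p e x = S p x e.
Proof.
move=> pp se sx.
have SE y w : y^T = y -> S p y w = dG ('D_w G) p y.
  move=> sy.
  have h1 : is_derive (0 : R) 1 (fun s : R => 'D_w G (p + s *: y)) (dG ('D_w G) p y).
    by apply: is_derive_dG; have [_] := dG2 pp.
  have h2 : is_derive (0 : R) 1
      (fun s : R => lform (fun i j => 'D_(delta_mx i j) G (p + s *: y)) w) (S p y w).
    have h i j : is_derive (0 : R) 1 (fun s : R => 'D_(delta_mx i j) G (p + s *: y))
        (dG ('D_(delta_mx i j) G) p y).
      by apply: is_derive_dG; have [_] := dG2 pp.
    exact: (is_derive_lform (phi := fun i j s => 'D_(delta_mx i j) G (p + s *: y)) w h).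
  apply: is_derive_uniq h2 _; apply: near_eq_is_derive h1.
  have H := posdef_near pp sy.
  by apply: filterS H => s ps; rewrite deriveG //; exact: dG1.
have [_ dd] := dG2 pp.
apply: etrans (SE e x se) _; apply: etrans (esym (SE x e sx)).
apply: etrans (esym (dGE e (dd x))) _; apply: etrans (dGE x (dd e)).
have [d d0 H] := posdef_plane pp sx se.
apply: (second_derivative_sym d0) => // s t hs ht.
by apply: dG1; exact: H.
Qed.

(** With w = P^-1 / s the perturbation z = p w^-1 p equals s p P p, so p P p is the direction in
    which y leaves p. The trace is the linear correction that accounts for the difference between
    the gradients of G and H. *)
Definition cq P p : R := dG G p (p *m P *m p) + \tr (m *m (p *m P *m p)).

Let dcq P p e : R := dG G p (e *m P *m p + p *m P *m e) + S p e (p *m P *m p)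
  + \tr (m *m (e *m P *m p + p *m P *m e)).

Let mxder_sandwich P p e :
  mxder (fun s : R => (p + s *: e) *m P *m (p + s *: e)) 0 (e *m P *m p + p *m P *m e).
Proof.
have l := @mxder_line R r r p e 0.
have := mxderM (mxderM l (mxder_cst P (0:R))) l.
by rewrite scale0r addr0 mulmx0 addr0.
Qed.

Lemma is_derive_cq P p e : posdef p ->
  is_derive (0 : R) 1 (fun s : R => cq P (p + s *: e)) (dcq P p e).
Proof.
move=> pp; apply: is_deriveD; last first.
  have := mxderM (mxder_cst m (0:R)) (mxder_sandwich P p e).
  by rewrite mul0mx add0r => /mxder_tr.
rewrite /dcq /S /dG /lform -big_split; apply: is_derive_bigsum => i.
rewrite -big_split; apply: is_derive_bigsum => j /=.
have h : is_derive (0 : R) 1 (fun s : R => 'D_(delta_mx i j) G (p + s *: e))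
    (dG ('D_(delta_mx i j) G) p e).
  by apply: is_derive_dG; have [_] := dG2 pp.
have := is_deriveM1 (mxder_sandwich P p e i j) h.
by rewrite scale0r addr0.
Qed.

Hypothesis cq_cocycle : forall P p q h, posdef P -> h^T = h ->
  posdef p -> posdef q -> posdef (p + h) -> posdef (q + h) ->
  cq P (p + h) - cq P p = cq P (q + h) - cq P q.

Let tr_lin (a : R) (x y : 'M[R]_r) :
  \tr (m *m (a *: x + y)) = a * \tr (m *m x) + \tr (m *m y).
Proof. by rewrite mulmxDr -scalemxAr mxtraceD mxtraceZ. Qed.

Let dcq_linP p e a x y : dcq (a *: x + y) p e = a * dcq x p e + dcq y p e.
Proof.
have E u w : u *m (a *: x + y) *m w = a *: (u *m x *m w) + u *m y *m w.
  by rewrite mulmxDr mulmxDl -scalemxAr -scalemxAl.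
rewrite /dcq /S /dG !E.
rewrite (_ : (a *: (e *m x *m p) + e *m y *m p) + (a *: (p *m x *m e) + p *m y *m e) =
   a *: (e *m x *m p + p *m x *m e) + (e *m y *m p + p *m y *m e)); last first.
  by rewrite scalerDr addrACA.
rewrite tr_lin !(lformD _ (a *: _)) !lformZ; ring.
Qed.

Let dcq_linE P p a x y : dcq P p (a *: x + y) = a * dcq P p x + dcq P p y.
Proof.
have E : (a *: x + y) *m P *m p + p *m P *m (a *: x + y) =
   a *: (x *m P *m p + p *m P *m x) + (y *m P *m p + p *m P *m y).
  by rewrite !mulmxDl mulmxDr -!scalemxAl -!scalemxAr scalerDr addrACA.
have ES w : S p (a *: x + y) w = a * S p x w + S p y w.
  rewrite /S /lform mulr_sumr -big_split; apply: eq_bigr => i _ /=.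
  rewrite mulr_sumr -big_split; apply: eq_bigr => j _ /=.
  by rewrite /dG lformD lformZ; ring.
rewrite /dcq E ES tr_lin /dG !(lformD _ (a *: _)) !lformZ; ring.
Qed.

Let dcq_indep P p q e : P^T = P -> posdef p -> posdef q -> e^T = e ->
  dcq P p e = dcq P q e.
Proof.
have pd Q : posdef Q -> posdef p -> posdef q -> e^T = e -> dcq Q p e = dcq Q q e.
  move=> pQ; apply: (@cocycle_derive R r (cq Q) (dcq Q)).
    by move=> p' e' pp' _; exact: is_derive_cq.
  by move=> p' q' h sh *; exact: cq_cocycle.
(* The cocycle hypothesis concerns positive definite P only. A symmetric P is reached by linearity
   from I and I + s P with s small. *)
move=> sP pp pq se; have [d d0 H] := posdef_line (posdef1 R r) sP.
pose s := d / 2; have s0 : 0 < s by rewrite divr_gt0.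
have pQ : posdef (1%:M + s *: P).
  by apply: H; rewrite gtr0_norm // ltr_pdivrMr // ltr_pMr // ltr1n.
have := pd _ pQ pp pq se; rewrite addrC !dcq_linP (pd 1%:M) //; last exact: posdef1.
by move=> /addIr /(mulfI (lt0r_neq0 s0)).
Qed.

(** The derivative of [cq P] in direction e does not depend on p. Evaluated at p = Q^-1 with P = Q x
    Q, where p P p = x, it is symmetric in x and e by symmetry of the Hessian; so
    [bilinear_sym_scalar] makes it c tr(P e), and [cq P] is affine in p. *)
Lemma gradient_formula : exists c a, a^T = a /\
  forall p e, posdef p -> e^T = e ->
    dG G p e + \tr (m *m e) = c * \tr (invmx p *m e) + \tr (a *m (invmx p *m e *m invmx p)).
Proof.
pose lam P e := dcq P 1%:M e.
have p1 := posdef1 R r.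
have [|||c hc] := @bilinear_sym_scalar R r lam.
- by move=> *; exact: dcq_linP.
- by move=> *; exact: dcq_linE.
- move=> Q x e pQ sx se; rewrite /lam.
  have sQ := posdef_sym pQ; have pI := posdef_inv pQ; have uQ := posdef_unit pQ.
  have sQQ y : y^T = y -> (Q *m y *m Q)^T = Q *m y *m Q.
    by move=> sy; rewrite !trmx_mul sQ sy mulmxA.
  (* The base point moves from I to Q^-1, where the sandwich by Q is undone. *)
  rewrite !(dcq_indep _ p1 pI) ?sQQ // /dcq.
  have E y w : w *m (Q *m y *m Q) *m invmx Q + invmx Q *m (Q *m y *m Q) *m w =
      w *m Q *m y + y *m Q *m w.
    by rewrite !mulmxA (mulVmx uQ) mul1mx (mulmxK uQ).
  have E2 y : invmx Q *m (Q *m y *m Q) *m invmx Q = y.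
    by rewrite !mulmxA (mulVmx uQ) mul1mx (mulmxK uQ).
  by rewrite !E !E2 (hess_sym pI se sx) (addrC (x *m Q *m e)).
pose a0 P := cq P 1%:M - c * \tr (P *m 1%:M).
have cqE P p : P^T = P -> posdef p -> cq P p = a0 P + c * \tr (P *m p).
  move=> sP pp; rewrite /a0.
  have := @posdef_const R r (fun p => cq P p - c * \tr (P *m p)).
  move=> /(_ _ p 1%:M pp p1) h; apply/eqP; rewrite -subr_eq; apply/eqP; apply: h.
  move=> p' e pp' se.
  have h1 := @is_derive_cq P p' e pp'.
  have h2 := mxder_tr (mxderM (mxder_cst P (0 : R)) (mxder_line p' e (0:R))).
  have h3 := is_deriveB h1 (is_deriveM1 (is_derive_cst c (0 : R) 1) h2).
  apply: is_derive_eq h3 _.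
  rewrite (dcq_indep sP pp' p1 se) -/(lam P e) hc // mul0r add0r mul0mx add0r.
  by rewrite subrr.
have [l [sl lE]] := lform_sym (fun i j => 'D_(delta_mx i j) G 1%:M).
exists c, (l + m - c%:M); split; first by rewrite linearB /= linearD /= sl sm tr_scalar_mx.
move=> p e pp se; have up := posdef_unit pp.
(* Chosen so that p P p = e: [cq P p] is then the corrected gradient of G in direction e. *)
set P := invmx p *m e *m invmx p.
have sP : P^T = P.
  by rewrite /P !trmx_mul se (posdef_sym (posdef_inv pp)) mulmxA.
have eE : p *m P *m p = e by rewrite /P !mulmxA (mulmxV up) mul1mx (mulmxKV up).
have := cqE P p sP pp; rewrite /cq eE => ->.
have -> : P *m p = invmx p *m e by rewrite /P (mulmxKV up).
rewrite addrC; congr (_ + _); rewrite /a0 /cq !mulmx1 mul1mx /dG lE //.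
by rewrite mulmxBl mulmxDl mul_scalar_mx raddfB /= mxtraceD mxtraceZ.
Qed.

Lemma cocycle_solution : exists c a C0, a^T = a /\
  forall p, posdef p ->
    G p = C0 + c * ln (\det p) - \tr (a *m invmx p) - \tr (m *m p).
Proof.
have [c [a [sa H]]] := gradient_formula.
pose f p := G p - (c * ln (\det p) - \tr (a *m invmx p) - \tr (m *m p)).
exists c, a, (f 1%:M); split => // p pp.
suff h : f p = f 1%:M by rewrite -h /f; ring.
apply: (posdef_const _ pp (posdef1 R r)) => {p pp} p e pp se.
have h1 := is_derive_dG e (dG1 pp).
have h2 := is_deriveM1 (is_derive_cst c (0 : R) 1) (is_derive_lndet e pp).
have h3 := mxder_tr (mxderM (mxder_cst a (0 : R)) (mxder_inv_line e pp)).
have h4 := mxder_tr (mxderM (mxder_cst m (0 : R)) (mxder_line p e (0:R))).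
apply: is_derive_eq (is_deriveB h1 (is_deriveB (is_deriveB h2 h3) h4)) _.
have := H p e pp se; rewrite !mul0r !mul0mx !add0r mulmxN -(scaleN1r (a *m _)) mxtraceZ.
move=> /eqP; rewrite -subr_eq0 => /eqP h; apply: etrans h; rewrite /cst; ring.
Qed.

End GradientCocycle.

Section FunctionalEquation.
Variables (R : realType) (r : nat).
Implicit Types (p q e x y h c W t : 'M[R]_r).

Variables (al be : R) (F G H K : 'M[R]_r -> R).
Hypotheses (al0 : 0 < al) (be0 : 0 <= be) (albe : al != be).
Let k := be / al.
Hypotheses (dG2 : tdiff G) (dH : forall p, posdef p -> differentiable H p).
Hypothesis FE : forall p z, posdef p -> posdef z ->
  F (invmx (al *: (p + conjw p z))) + G (p + z) =
  H (p + k *: z) + K (invmx (al *: (conjw p z + k *: p))).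

Let k0 : 0 <= k. Proof. by rewrite divr_ge0 // ltW. Qed.
Let k1 : 1 - k != 0.
Proof.
rewrite subr_eq0; apply: contra albe => /eqP h.
by rewrite -[be](divfK (lt0r_neq0 al0)) -/k -h mul1r.
Qed.
Let kal : k * al = be. Proof. by rewrite /k divfK ?lt0r_neq0. Qed.

Let F1 t := F (invmx (al *: t)).
Let K1 t := K (invmx (al *: t)).

Let FE1 p w : posdef p -> posdef w ->
  F1 (p + w) + G (p + conjw p w) = H (p + k *: conjw p w) + K1 (w + k *: p).
Proof.
move=> pp pw; have := FE pp (posdef_conjw pp pw).
by rewrite conjwK.
Qed.

(** The matrix z = p w^-1 p along w = W / s - c, rewritten so that it extends differentiably to s =
    0, the point w = oo, with value 0. *)
Let zeta p c W (s : R) := s *: (p *m invmx (W + s *: (- c)) *m p).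
Let E p c W (s : R) := G (p + zeta p c W s) - H (p + k *: zeta p c W s).

Let E_shift p c W s : posdef p -> 0 < s -> posdef (W + s *: (- c)) ->
  E p c W s = K1 (s^-1 *: W - c + k *: p) - F1 (p + (s^-1 *: W - c)).
Proof.
move=> pp s0 pW; pose w := s^-1 *: W - c.
have wE : w = s^-1 *: (W + s *: (- c)).
  by rewrite scalerDr scalerA mulVf ?gt_eqF // scale1r.
have pw : posdef w by rewrite wE; apply: posdefZ => //; rewrite invr_gt0.
have zE : zeta p c W s = conjw p w.
  rewrite /zeta /conjw wE posdef_invZ ?invr_gt0 // invrK.
  by rewrite -scalemxAr -scalemxAl.
have := FE1 pp pw; rewrite -zE /E => h.
rewrite -/w; lra.
Qed.

Let E0 p c W : E p c W 0 = G p - H p.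
Proof. by rewrite /E /zeta scale0r scaler0 addr0. Qed.

Let dE p c W : posdef p -> posdef W ->
  is_derive (0 : R) 1 (E p c W)
    (dG G p (p *m invmx W *m p) - k * dG H p (p *m invmx W *m p)).
Proof.
move=> pp pW; set D := p *m _ *m p.
have dz : mxder (zeta p c W) 0 D.
  have h1 := @mxder_inv_line R r W (- c) pW.
  have h2 := mxderM (mxderM (mxder_cst p (0:R)) h1) (mxder_cst p (0:R)).
  have h3 := mxderZ (is_derive_id (0 : R) (1 : R)) h2.
  by move: h3; rewrite !scale0r !addr0 scale1r.
have z0 : zeta p c W 0 = 0 by rewrite /zeta scale0r.
apply: is_deriveB.
- have := @is_derive_path R r G (fun s => p + zeta p c W s) 0 (0 + D).
  rewrite z0 addr0 add0r; apply; first by have [] := dG2 pp.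
  by have := mxderD (mxder_cst p (0:R)) dz; rewrite add0r.
- have := @is_derive_path R r H (fun s => p + k *: zeta p c W s) 0 (k *: D).
  rewrite z0 scaler0 addr0 {1}/dG lformZ; apply; first exact: dH.
  have h := mxderZ (is_derive_cst k (0 : R) 1) dz.
  have := mxderD (mxder_cst p (0:R)) h.
  by rewrite scale0r !add0r.
Qed.

(* Put w = W / s - c with c = k p, resp. c = k p + h, so that the arguments of [F1] and
   [K1] in [E_shift] match in pairs: [phi] vanishes for s > 0, hence so do phi(0) and
   phi'(0). *)
Let FE_cocycle p q h W : posdef p -> posdef q -> posdef (p + h) -> posdef (q + h) ->
  h^T = h -> posdef W ->
  (G (p + h) - H (p + h)) - (G p - H p) = (G (q + h) - H (q + h)) - (G q - H q) /\
  (let B p := dG G p (p *m invmx W *m p) - k * dG H p (p *m invmx W *m p) in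
   B (p + h) - B p = B (q + h) - B q).
Proof.
move=> pp pq pph pqh sh pW /=.
pose phi (s : R) := (E (p + h) (k *: p + h) W s - E p (k *: p) W s) -
              (E (q + h) (k *: q + h) W s - E q (k *: q) W s).
have dphi := is_deriveB
  (is_deriveB (dE (k *: p + h) pph pW) (dE (k *: p) pp pW))
  (is_deriveB (dE (k *: q + h) pqh pW) (dE (k *: q) pq pW)).
have symN c : c^T = c -> (- c)^T = - c by move=> sc; rewrite linearN /= sc.
have sk x : posdef x -> (k *: x)^T = k *: x by move=> px; rewrite linearZ /= posdef_sym.
have skh x : posdef x -> (k *: x + h)^T = k *: x + h by move=> px; rewrite linearD /= sk // sh.
have [d1 d10 H1] := posdef_line pW (symN _ (sk _ pp)).
have [d2 d20 H2] := posdef_line pW (symN _ (skh _ pp)).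
have [d3 d30 H3] := posdef_line pW (symN _ (sk _ pq)).
have [d4 d40 H4] := posdef_line pW (symN _ (skh _ pq)).
pose d := Num.min (Num.min d1 d2) (Num.min d3 d4).
have d0 : 0 < d by rewrite !lt_min d10 d20 d30 d40.
have z s : 0 < s < d -> phi s = 0.
  move=> /andP[s0]; rewrite !lt_min => /andP[/andP[s1 s2] /andP[s3 s4]].
  have ab : `|s| = s by rewrite gtr0_norm.
  rewrite /phi !E_shift //; [|by apply: H3; rewrite ab|by apply: H4; rewrite ab
    |by apply: H1; rewrite ab|by apply: H2; rewrite ab].
  have a1 x : s^-1 *: W - (k *: x + h) + k *: (x + h) = s^-1 *: W + (k *: h - h).
    by rewrite scalerDr opprD; apply/matrixP => i j; rewrite !mxE; ring.
  have a2 x : x + h + (s^-1 *: W - (k *: x + h)) = x + (s^-1 *: W - k *: x).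
    by apply/matrixP => i j; rewrite !mxE; ring.
  have a3 x : s^-1 *: W - k *: x + k *: x = s^-1 *: W by rewrite subrK.
  by rewrite !a1 !a2 !a3; ring.
have [e1 e2] := right_zero_derive d0 dphi z.
move: e1; rewrite /= !fctE !E0 => e1.
split; first by apply/eqP; rewrite -subr_eq0; apply/eqP.
by apply/eqP; rewrite -subr_eq0; apply/eqP.
Qed.

Lemma fe_linear_part : exists l C, l^T = l /\
  (forall p e, posdef p -> e^T = e -> dG G p e - dG H p e = \tr (l *m e)) /\
  (forall p, posdef p -> H p = G p - C - \tr (l *m p)).
Proof.
have p1 := posdef1 R r.
pose lf p e := dG G p e - dG H p e.
have der p e : posdef p -> is_derive (0 : R) 1 (fun s : R => G (p + s *: e) - H (p + s *: e)) (lf p e).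
  move=> pp; apply: is_deriveB; apply: is_derive_dG; last exact: dH.
  by have [] := dG2 pp.
have ind p q e : posdef p -> posdef q -> e^T = e -> lf p e = lf q e.
  apply: (@cocycle_derive R r (fun p => G p - H p) lf).
    by move=> *; exact: der.
  by move=> p' q' h sh pp pq pph pqh; have [] := FE_cocycle pp pq pph pqh sh p1.
have [l [sl lE]] := lform_sym (fun i j => 'D_(delta_mx i j) G 1%:M - 'D_(delta_mx i j) H 1%:M).
have lfE p e : posdef p -> e^T = e -> lf p e = \tr (l *m e).
  move=> pp se; rewrite (ind p 1%:M) // -lE // /lf /dG /lform -sumrB.
  apply: eq_bigr => i _; rewrite -sumrB; apply: eq_bigr => j _; ring.
pose f p := G p - H p - \tr (l *m p).
exists l, (f 1%:M); split => //; split => // p pp.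
suff h : f p = f 1%:M by rewrite -h /f; ring.
apply: (posdef_const _ pp p1) => {p pp} p e pp se.
have h2 := mxder_tr (mxderM (mxder_cst l (0 : R)) (mxder_line p e (0:R))).
apply: is_derive_eq (is_deriveB (der p e pp) h2) _.
by rewrite lfE // mul0mx add0r subrr.
Qed.

Lemma fe_solution : exists (c : R) (a b : 'M[R]_r) (cF cG cH cK : R), a^T = a /\ b^T = b /\
  forall x, posdef x ->
  [/\ F x = cF + c * ln (\det x) - al * \tr (a *m x) - \tr (b *m invmx x),
      G x = cG + c * ln (\det x) - be * \tr (b *m x) - \tr (a *m invmx x),
      H x = cH + c * ln (\det x) - al * \tr (b *m x) - \tr (a *m invmx x) &
      K x = cK + c * ln (\det x) - be * \tr (a *m x) - \tr (b *m invmx x)].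
Proof.
have p1 := posdef1 R r.
have [l [C [sl [lE HE]]]] := fe_linear_part.
(* Since dG - k dH = (1 - k) dG + k l, dividing by 1 - k leaves dG plus this linear term. *)
pose m := (k / (1 - k)) *: l.
have coc P p q h : posdef P -> h^T = h -> posdef p -> posdef q ->
    posdef (p + h) -> posdef (q + h) ->
    cq G m P (p + h) - cq G m P p = cq G m P (q + h) - cq G m P q.
  move=> pP sh pp pq pph pqh.
  have [_ /=] := FE_cocycle pp pq pph pqh sh (posdef_inv pP).
  rewrite invmxK.
  have e x : posdef x -> dG G x (x *m P *m x) - k * dG H x (x *m P *m x) = (1 - k) * cq G m P x.
    move=> px; have sx : (x *m P *m x)^T = x *m P *m x.
      by rewrite !trmx_mul (posdef_sym px) (posdef_sym pP) mulmxA.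
    have := lE x _ px sx => h1.
    have -> : dG H x (x *m P *m x) = dG G x (x *m P *m x) - \tr (l *m (x *m P *m x)).
      by rewrite -h1; ring.
    rewrite /cq /m -scalemxAl mxtraceZ; field.
    exact: k1.
  by rewrite !e // -!mulrBr => /(mulfI k1).
have sm : m^T = m by rewrite /m linearZ /= sl.
have [c [a [CG [sa GE]]]] := cocycle_solution dG2 sm coc.
(* The scale is fixed by l = (al - be) b, so that the linear terms of G and H become - be tr(b y)
   and - al tr(b u). *)
have [b bE] : exists b, b = (al * (1 - k))^-1 *: l by exists ((al * (1 - k))^-1 *: l).
have al_n0 := lt0r_neq0 al0.
have lb : l = (al * (1 - k)) *: b by rewrite bE scalerA mulfV ?scale1r // mulf_neq0.
have mb : m = be *: b.
  by rewrite /m lb scalerA; congr (_ *: _); rewrite -kal; field.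
have GE' x : posdef x -> G x = CG + c * ln (\det x) - be * \tr (b *m x) - \tr (a *m invmx x).
  by move=> px; rewrite GE // mb -scalemxAl mxtraceZ; ring.
have HE' x : posdef x -> H x = (CG - C) + c * ln (\det x) - al * \tr (b *m x) - \tr (a *m invmx x).
  by move=> px; rewrite HE // GE' // lb -scalemxAl mxtraceZ -kal; ring.
(* [F3] and [K3] are F and K minus their expected nonconstant parts, in the variable t with x = (al
   t)^-1. *)
pose F3 t := F1 t + c * ln (\det t) + \tr (a *m invmx t) + al * \tr (b *m t).
pose K3 t := K1 t + c * ln (\det t) + k * \tr (a *m invmx t) + al * \tr (b *m t).
have FK p w : posdef p -> posdef w -> F3 (p + w) = K3 (w + k *: p) - C.
  move=> pp pw; pose z := conjw p w; have pz : posdef z := posdef_conjw pp pw.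
  have [up uw] := (posdef_unit pp, posdef_unit pw).
  have wz : conjw p z = w by exact: conjwK.
  have ppz : posdef (p + z) by exact: posdefD.
  have ppkz : posdef (p + k *: z) by exact: posdefDZ.
  have ppw : posdef (p + w) by exact: posdefD.
  have pwkp : posdef (w + k *: p) by exact: posdefDZ.
  have dpw : 0 < \det p * \det (invmx w).
    by rewrite mulr_gt0 // det_gt0 //; exact: posdef_inv.
  (* p + z = p w^-1 (p + w) and p + k z = p w^-1 (w + k p): the factor det(p w^-1) cancels in G - H,
     leaving a function of p + w and one of w + k p. *)
  have d1 : ln (\det (p + z)) = ln (\det p * \det (invmx w)) + ln (\det (p + w)).
    rewrite -lnM ?posrE ?det_gt0 // -!det_mulmx; congr (ln (\det _)).
    by rewrite mulmxDr (mulmxKV uw) addrC.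
  have d2 : ln (\det (p + k *: z)) = ln (\det p * \det (invmx w)) + ln (\det (w + k *: p)).
    rewrite -lnM ?posrE ?det_gt0 // -!det_mulmx; congr (ln (\det _)).
    by rewrite mulmxDr (mulmxKV uw) -scalemxAr.
  have i1 : invmx (p + w) = invmx p - invmx (p + z).
    by rewrite posdef_inv_sub // -/(conjw p z) wz.
  have i2 : k *: invmx (w + k *: p) = invmx p - invmx (p + k *: z).
    move: k0; rewrite le_eqVlt => /predU1P[k00|kp].
      by rewrite -k00 !scale0r addr0 subrr.
    rewrite posdef_inv_sub //; last exact: posdefZ.
    rewrite posdef_invZ // -scalemxAr -scalemxAl -/(conjw p z) wz.
    have -> : p + k^-1 *: w = k^-1 *: (w + k *: p).
      by rewrite scalerDr scalerA mulVf ?gt_eqF // scale1r addrC.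
    by rewrite posdef_invZ ?invr_gt0 // invrK.
  have := FE1 pp pw; rewrite -/z GE' // HE' // => h.
  have ak : k * \tr (a *m invmx (w + k *: p)) =
      \tr (a *m invmx p) - \tr (a *m invmx (p + k *: z)).
    by rewrite -mxtraceZ scalemxAr i2 mulmxBr raddfB.
  have a1 : \tr (a *m invmx (p + w)) = \tr (a *m invmx p) - \tr (a *m invmx (p + z)).
    by rewrite i1 mulmxBr raddfB.
  rewrite /F3 /K3 ak a1; rewrite d1 d2 in h.
  move: h; rewrite !mulmxDr -!scalemxAr !mxtraceD !mxtraceZ -kal => h.
  move/eqP: h; rewrite -subr_eq0 => /eqP h.
  by apply/eqP; rewrite -subr_eq0; apply/eqP; apply: etrans h; ring.
(* Starting from p = w = t / 2, add s e / (1 - k) to p and - k s e / (1 - k) to w: then w + k p is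
   unchanged while p + w moves by s e. *)
have F3c t q : posdef t -> posdef q -> F3 t = F3 q.
  move=> pt pq; apply: (posdef_const _ pt pq) => {t q pt pq} t e pt se.
  have ph : posdef (2^-1 *: t) by apply: posdefZ => //; rewrite invr_gt0.
  have se1 : ((1 - k)^-1 *: e)^T = (1 - k)^-1 *: e by rewrite linearZ /= se.
  have se2 : ((- k / (1 - k)) *: e)^T = (- k / (1 - k)) *: e by rewrite linearZ /= se.
  have c0 := is_derive_cst (K3 (((1 + k) / 2) *: t) - C) (0 : R) 1.
  apply: near_eq_is_derive c0.
  near=> s.
  have h1 : posdef (2^-1 *: t + s *: ((1 - k)^-1 *: e)) by near: s; exact: posdef_near.
  have h2 : posdef (2^-1 *: t + s *: ((- k / (1 - k)) *: e)) by near: s; exact: posdef_near.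
  have := FK _ _ h1 h2.
  have -> : 2^-1 *: t + s *: ((1 - k)^-1 *: e) + (2^-1 *: t + s *: ((- k / (1 - k)) *: e)) = t + s *: e.
    by apply/matrixP => i j; rewrite !mxE; field; exact: k1.
  have -> : 2^-1 *: t + s *: ((- k / (1 - k)) *: e) + k *: (2^-1 *: t + s *: ((1 - k)^-1 *: e)) = ((1 + k) / 2) *: t.
    by apply/matrixP => i j; rewrite !mxE; field; exact: k1.
  by move=> ->.
have K3c t : posdef t -> K3 t = F3 1%:M + C.
  move=> pt; have k10 : 0 < 1 + k by rewrite ltr_pwDl.
  have pp : posdef ((1 + k)^-1 *: t) by apply: posdefZ => //; rewrite invr_gt0.
  have := FK _ _ pp pp.
  have -> : (1 + k)^-1 *: t + k *: ((1 + k)^-1 *: t) = t.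
    by apply/matrixP => i j; rewrite !mxE; field; exact: lt0r_neq0.
  rewrite (F3c _ 1%:M) //; last exact: posdefD.
  by move=> ->; rewrite subrK.
(* The contribution of the scalar in t = al^-1 x^-1 to c ln det t. *)
pose L := c * (r%:R * ln al).
exists c, a, b, (F3 1%:M + L), CG, (CG - C), (F3 1%:M + C + L).
split=> //; split; first by rewrite bE linearZ /= sl.
move=> x px; have px' := posdef_inv px.
have ali : 0 < al^-1 by rewrite invr_gt0.
pose t := al^-1 *: invmx x.
have pt : posdef t by exact: posdefZ.
have xE : invmx (al *: t) = x by rewrite /t scalerA mulfV // scale1r invmxK.
have tI : invmx t = al *: x by rewrite /t posdef_invZ // invrK invmxK.
have tr : al * \tr (b *m t) = \tr (b *m invmx x).
  by rewrite /t -scalemxAr mxtraceZ mulrA mulfV // mul1r.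
have dt : c * ln (\det t) = - (c * ln (\det x)) - L.
  rewrite /t detZ det_inv lnM ?posrE ?exprn_gt0 ?invr_gt0 ?det_gt0 //.
  rewrite lnXn // lnV ?posrE // lnV ?posrE ?det_gt0 // /L.
  rewrite -mulr_natl; ring.
split; [|exact: GE'|exact: HE'|].
- have := F3c t 1%:M pt p1; rewrite /F3 {1}/F1 xE tI tr dt -scalemxAr mxtraceZ -/(F3 1%:M) => <-; ring.
- have := K3c t pt; rewrite {1}/K3 {1}/K1 xE tI tr dt -scalemxAr mxtraceZ -kal => <-; ring.
Unshelve. all: by end_near. Qed.

End FunctionalEquation.

(** * Lebesgue measure on tuples *)

Section Pushforward.
Context d1 d2 (T1 : measurableType d1) (T2 : measurableType d2) (R : realType).
Variables (mu : {sigma_finite_measure set T1 -> \bar R}) (f : T1 -> T2) (g : T2 -> T1).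
Hypotheses (mf : measurable_fun setT f) (mg : measurable_fun setT g) (fK : cancel f g).

Definition push : {measure set T2 -> \bar R} :=
  measure_function_pushforward__canonical__measure_function_Measure mu mf.

Lemma push_sigma_finite : sigma_finite setT push.
Proof.
have [F FT Foo] := sigma_finiteT mu.
exists (fun n => g @^-1` F n).
  by rewrite -preimage_bigcup -FT.
move=> n; have [mF Fo] := Foo n; split; first by rewrite -[X in measurable X]setTI; exact: mg.
rewrite /push /= /pushforward /= -comp_preimage.
by rewrite (_ : g \o f = id) //; apply/funext => x /=; rewrite fK.
Qed.

Definition push_sf : {sigma_finite_measure set T2 -> \bar R} :=
  HB.pack (push : set T2 -> \bar R) (Measure.class push)
   (@Measure_isSigmaFinite.Build _ _ _ (push : set T2 -> \bar R) push_sigma_finite).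

End Pushforward.

Section ProdSigmaFinite.
Context d1 d2 (T1 : measurableType d1) (T2 : measurableType d2) (R : realType).
Variables (m1 : {sigma_finite_measure set T1 -> \bar R}).
Variables (m2 : {sigma_finite_measure set T2 -> \bar R}).

Definition prod_measure : {measure set (T1 * T2)%type -> \bar R} := (m1 \x m2)%E.

Lemma prod_measure_sigma_finite : sigma_finite setT prod_measure.
Proof.
have /sigma_finiteP[F [TF ndF Foo]] := sigma_finiteT m1.
have /sigma_finiteP[G [TG ndG Goo]] := sigma_finiteT m2.
exists (fun n => F n `*` G n).
  apply/esym; rewrite -subTset => -[x y] _.
  have [n _ Fnx] : (\bigcup_n F n) x by rewrite -TF.
  have [k _ Gky] : (\bigcup_n G n) y by rewrite -TG.
  exists (maxn n k) => //; split.
  - by move: x Fnx; exact/subsetPset/ndF/leq_maxl.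
  - by move: y Gky; exact/subsetPset/ndG/leq_maxr.
move=> k; have [mF Fo] := Foo k; have [mG Go] := Goo k.
split; first exact: measurableX.
by rewrite /= product_measure1E// lte_mul_pinfty// ge0_fin_numE.
Qed.

Definition prod_sf : {sigma_finite_measure set (T1 * T2)%type -> \bar R} :=
  HB.pack (prod_measure : set (T1 * T2)%type -> \bar R) (Measure.class prod_measure)
   (@Measure_isSigmaFinite.Build _ _ _ (prod_measure : set _ -> \bar R) prod_measure_sigma_finite).

End ProdSigmaFinite.

Section Leb.
Variable R : realType.

Definition consp n (z : measurableTypeR R * n.-tuple R) : n.+1.-tuple R :=
  cons_tuple (z.1 : R) z.2.
Definition unconsp n (t : n.+1.-tuple R) : measurableTypeR R * n.-tuple R :=
  (thead t, [tuple of behead t]).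

Lemma conspK n : cancel (@consp n) (@unconsp n).
Proof.
by case=> x t; rewrite /consp /unconsp /=; congr pair; apply/val_inj.
Qed.

Lemma measurable_consp n : measurable_fun setT (@consp n).
Proof.
have h1 : measurable_fun setT (fun z : measurableTypeR R * n.-tuple R => z.1 : R).
  by have := @measurable_fst _ _ (measurableTypeR R) (n.-tuple R).
have h2 : measurable_fun setT (fun z : measurableTypeR R * n.-tuple R => z.2).
  exact: measurable_snd.
have := measurable_cons h1 h2.
by congr measurable_fun; apply/funext => z; apply/val_inj.
Qed.

Lemma measurable_unconsp n : measurable_fun setT (@unconsp n).
Proof.
apply: measurable_fun_pair; last exact: measurable_behead.
have := @measurable_tnth _ R n.+1 ord0.
by [].
Qed.

(** The recursion adds coordinates in the order in which [iint] integrates them, so that Tonelli's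
    theorem identifies the two. *)
Fixpoint leb n : {sigma_finite_measure set (n.-tuple R) -> \bar R} :=
  match n return {sigma_finite_measure set (n.-tuple R) -> \bar R} with
  | 0 => \d_([tuple] : 0.-tuple R)
  | n'.+1 => push_sf (prod_sf (@lebesgue_measure R) (leb n'))
       (@measurable_consp n') (@measurable_unconsp n') (@conspK n')
  end.

Lemma integral_lebS n (f : n.+1.-tuple R -> \bar R) :
  measurable_fun setT f -> (forall t, (0 <= f t)%E) ->
  (\int[leb n.+1]_t f t = \int[lebesgue_measure]_x \int[leb n]_t f (cons_tuple x t))%E.
Proof.
move=> mf f0.
have -> : (\int[leb n.+1]_t f t =
  \int[prod_sf (@lebesgue_measure R) (leb n)]_z f (consp z))%E.
  rewrite /leb /push_sf /=.
  have := @ge0_integral_pushforward _ _ _ _ _ (@consp n) (@measurable_consp n)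
    (prod_sf (@lebesgue_measure R) (leb n)) setT f measurableT mf.
  by rewrite preimage_setT; apply.
rewrite fubini_tonelli1 //.
by apply: measurableT_comp => //; exact: measurable_consp.
Qed.

Lemma iint_leb n (f : n.-tuple R -> \bar R) :
  measurable_fun setT f -> (forall t, (0 <= f t)%E) ->
  iint f = (\int[leb n]_t f t)%E.
Proof.
elim: n f => [|n ih] f mf f0 /=.
  by rewrite integral_dirac // diracT mul1e.
rewrite integral_lebS //; apply: eq_integral => x _; apply: ih => //.
apply: (measurableT_comp mf).
have h : measurable_fun setT (fun t : n.-tuple R => (x : measurableTypeR R, t)).
  exact: measurable_pair1.
exact: (measurableT_comp (@measurable_consp n) h).
Qed.

End Leb.

Section Translation.
Variable R : realType.
Implicit Types n : nat.

Definition tadd n (s t : n.-tuple R) : n.-tuple R :=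
  [tuple tnth s i + tnth t i | i < n].
Definition topp n (s : n.-tuple R) : n.-tuple R := [tuple - tnth s i | i < n].
Definition tzero n : n.-tuple R := [tuple 0 | i < n].
Arguments tzero {n}.

Lemma taddC n : commutative (@tadd n).
Proof. by move=> s t; apply: eq_from_tnth => i; rewrite !tnth_mktuple addrC. Qed.

Lemma taddA n : associative (@tadd n).
Proof. by move=> s t u; apply: eq_from_tnth => i; rewrite !tnth_mktuple addrA. Qed.

Lemma tadd0 n (s : n.-tuple R) : tadd s tzero = s.
Proof. by apply: eq_from_tnth => i; rewrite !tnth_mktuple addr0. Qed.

Lemma taddN n (s : n.-tuple R) : tadd s (topp s) = tzero.
Proof. by apply: eq_from_tnth => i; rewrite !tnth_mktuple subrr. Qed.

Lemma toppK n : involutive (@topp n).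
Proof. by move=> s; apply: eq_from_tnth => i; rewrite !tnth_mktuple opprK. Qed.

Lemma measurable_tupleP d (T : measurableType d) n (f : T -> n.-tuple R) :
  (forall i, measurable_fun setT (fun x => tnth (f x) i)) -> measurable_fun setT f.
Proof. by move=> h; apply/measurable_fun_tnthP => i; exact: h. Qed.

Lemma measurable_tnthT d (T : measurableType d) n (f : T -> n.-tuple R) i :
  measurable_fun setT f -> measurable_fun setT (fun x => tnth (f x) i).
Proof. by move=> mf; exact: (measurableT_comp (measurable_tnth i) mf). Qed.

Lemma measurable_tadd d (T : measurableType d) n (f g : T -> n.-tuple R) :
  measurable_fun setT f -> measurable_fun setT g ->
  measurable_fun setT (fun x => tadd (f x) (g x)).
Proof.
move=> mf mg; apply: measurable_tupleP => i; under eq_fun do rewrite tnth_mktuple.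
by apply: measurable_funD; exact: measurable_tnthT.
Qed.

Lemma measurable_topp d (T : measurableType d) n (f : T -> n.-tuple R) :
  measurable_fun setT f -> measurable_fun setT (fun x => topp (f x)).
Proof.
move=> mf; apply: measurable_tupleP => i; under eq_fun do rewrite tnth_mktuple.
by apply: measurableT_comp => //; exact: measurable_tnthT.
Qed.

Lemma lebesgue_translate (c : R) (f : R -> \bar R) :
  measurable_fun setT f -> (forall x, (0 <= f x)%E) ->
  (\int[lebesgue_measure]_x f (c + x)%R = \int[lebesgue_measure]_x f x)%E.
Proof.
move=> mf f0.
have mc : measurable_fun setT ((fun x => c + x) : measurableTypeR R -> measurableTypeR R).
  by have := @measurable_funD _ _ R setT (cst c) id (measurable_cst _) (@measurable_id _ _ _).
pose nu := push (@lebesgue_measure R) mc.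
have e A : measurable A -> lebesgue_measure A = nu A.
  apply: lebesgue_measure_unique => _ [[a b] _ <-].
  rewrite /nu /push /= /pushforward /=.
  have -> : (fun x => c + x) @^-1` `]a, b] = `](a - c), (b - c)]%classic.
    by apply/seteqP; split => x /=; rewrite !in_itv /= ltrBlDl lerBrDl.
  by rewrite !lebesgue_measure_itv /= !lte_fin ltrD2r -!EFinD; congr (if _ then _%:E else _); ring.
have -> : (\int[lebesgue_measure]_x f x = \int[nu]_x f x)%E.
  by apply: eq_measure_integral => A mA _; exact: e.
by rewrite ge0_integral_pushforward.
Qed.

Lemma tadd_cons n (s : n.+1.-tuple R) x t :
  tadd s (cons_tuple x t) = cons_tuple (thead s + x) (tadd [tuple of behead s] t).
Proof.
apply: eq_from_tnth => i; rewrite tnth_mktuple.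
case: (unliftP ord0 i) => [j ->|->]; last by rewrite !tnth0.
by rewrite !tnthS tnth_mktuple tnth_behead; congr (tnth _ _ + _); apply/val_inj; rewrite /= inordK // ltnS.
Qed.

Lemma measurable_cons_tuple n (x : R) :
  measurable_fun setT (fun t : n.-tuple R => cons_tuple x t).
Proof.
have h : measurable_fun setT (fun t : n.-tuple R => (x : measurableTypeR R, t)).
  exact: measurable_pair1.
exact: (measurableT_comp (@measurable_consp R n) h).
Qed.

Lemma leb_translate n (s : n.-tuple R) (f : n.-tuple R -> \bar R) :
  measurable_fun setT f -> (forall x, (0 <= f x)%E) ->
  (\int[leb R n]_t f (tadd s t) = \int[leb R n]_t f t)%E.
Proof.
elim: n s f => [|n ih] s f mf f0.
  by apply: eq_integral => t _; congr f; rewrite [RHS]tuple0 [LHS]tuple0.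
have mfs : measurable_fun setT (fun t => f (tadd s t)).
  by apply: (measurableT_comp mf); apply: measurable_tadd.
apply: (etrans (integral_lebS mfs (fun t => f0 _))).
apply: (etrans _ (esym (integral_lebS mf f0))).
under eq_integral => x _.
  under eq_integral do rewrite tadd_cons.
  rewrite (ih _ (fun t => f (cons_tuple (thead s + x) t))) //; last first.
    by apply: (measurableT_comp mf); exact: measurable_cons_tuple.
  over.
apply: (lebesgue_translate (thead s) (f := fun x => \int[leb R n]_t f (cons_tuple x t))%E).
  have h := @measurable_fun_fubini_tonelli_F _ _ _ _ _ (leb R n) (f \o @consp R n).
  apply: h => [|z]; last exact: f0.
  by apply: measurableT_comp => //; exact: measurable_consp.
by move=> x; apply: integral_ge0.
Qed.

Definition box n (c : n.-tuple R) (e : R) : set (n.-tuple R) :=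
  [set t | forall i, `|tnth t i - tnth c i| < e].

Lemma measurable_box n (c : n.-tuple R) e : measurable (box c e).
Proof.
have -> : box c e = \bigcap_(i in [set: 'I_n]) [set t | `|tnth t i - tnth c i| < e].
  by apply/seteqP; split => t /= h i; [move=> _; exact: h|exact: h].
apply: fin_bigcap_measurable => // i _.
have -> : [set t : n.-tuple R | `|tnth t i - tnth c i| < e] =
   (fun t : n.-tuple R => `|tnth t i - tnth c i|) @^-1` `]-oo, e[.
  by apply/seteqP; split => t /=; rewrite in_itv.
rewrite -[X in measurable X]setTI; apply: (_ : measurable_fun _ _) => //.
apply: measurableT_comp => //; apply: measurable_funB => //.
exact: measurable_tnth.
Qed.

Lemma leb_box n (c : n.-tuple R) e : 0 < e -> (0 < leb R n (box c e) < +oo)%E.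
Proof.
move=> e0; elim: n c => [|n ih] c.
  have -> : box c e = setT by rewrite -subTset => t _ [].
  by rewrite /= diracT lte_fin ltr01 ltry.
rewrite /= /push /= /pushforward /=.
have -> : @consp R n @^-1` box c e =
    (ball_ Num.norm (thead c) e : set (measurableTypeR R)) `*` box [tuple of behead c] e.
  apply/seteqP; split => [[x t]|[x t]] /=.
    move=> h; split.
      by have := h ord0; rewrite /consp tnth0 /= distrC.
    move=> i; have := h (lift ord0 i); rewrite /consp tnthS /=.
    rewrite tnth_behead; congr (`|_ - tnth _ _| < e).
    by apply/val_inj; rewrite /= inordK // ltnS.
  move=> [h1 h2] i; rewrite /consp; case: (unliftP ord0 i) => [j ->|->].
    rewrite tnthS; have := h2 j; rewrite tnth_behead; congr (`|_ - tnth _ _| < e).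
    by apply/val_inj; rewrite /= inordK // ltnS.
  by rewrite tnth0 distrC.
have hb : lebesgue_measure (ball_ Num.norm (thead c) e : set (measurableTypeR R)) = (2 * e)%:E.
  by rewrite mulr_natl -(lebesgue_measure_ball (thead c) (ltW e0)).
rewrite product_measure1E //=; last 2 first.
- have := measurable_ball (thead c) e. by [].
- exact: measurable_box.
rewrite hb; have /andP[h1 h2] := ih [tuple of behead c].
rewrite mule_gt0 ?lte_fin ?mulr_gt0 //=.
by rewrite lte_mul_pinfty // lee_fin mulr_ge0 // ltW.
Qed.

End Translation.

(** * Uniqueness of translation-invariant measures *)

Section Haar.
Variables (R : realType) (n : nat).
Local Notation Tn := (n.-tuple R).
Local Notation mu := (leb R n).
Implicit Types (A B : set Tn) (nu : {sigma_finite_measure set Tn -> \bar R}).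

Definition translation_invariant nu :=
  forall (s : Tn) A, measurable A -> nu ((tadd s) @^-1` A) = nu A.

Lemma measurable_preimageT d d' (T : measurableType d) (T' : measurableType d')
    (f : T -> T') : measurable_fun setT f ->
  forall B : set T', measurable B -> measurable (f @^-1` B).
Proof. by move=> mf B mB; rewrite -[X in measurable X]setTI; exact: mf. Qed.

Lemma leb_translation_invariant : translation_invariant mu.
Proof.
move=> s A mA.
have mt : measurable (tadd s @^-1` A).
  apply: measurable_preimageT => //; exact: measurable_tadd.
transitivity (\int[mu]_t (\1_A (tadd s t))%:E)%E.
  by rewrite (eq_integral (fun t => (\1_(tadd s @^-1` A) t)%:E)) // integral_indic // setIT.
rewrite (leb_translate s (f := fun t => (\1_A t)%:E)); first by rewrite integral_indic // setIT.
  by apply/measurable_EFinP; exact: measurable_indic.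
by move=> x; rewrite lee_fin.
Qed.

(* Both sides are the double integral of [1_A(x) 1_B(x + y)]. *)
Lemma haar_swap nu A B : translation_invariant nu -> measurable A -> measurable B ->
  (mu A * nu B = nu (@topp R n @^-1` A) * mu B)%E.
Proof.
move=> hnu mA mB.
pose h (z : Tn * Tn) : \bar R := (\1_A z.1 * \1_B (tadd z.1 z.2))%:E.
have mi C : measurable C -> measurable_fun setT (\1_C : Tn -> R).
  by move=> mC; exact: measurable_indic.
have mh : measurable_fun setT h.
  apply/measurable_EFinP; apply: measurable_funM.
    by apply: (measurableT_comp (mi _ mA)).
  by apply: (measurableT_comp (mi _ mB)); apply: measurable_tadd.
have h0 z : (0 <= h z)%E by rewrite lee_fin mulr_ge0.
pose h' (z : Tn * Tn) : \bar R := (\1_A (tadd (topp z.2) z.1) * \1_B z.1)%:E.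
have mh' : measurable_fun setT h'.
  apply/measurable_EFinP; apply: measurable_funM; last exact: (measurableT_comp (mi _ mB)).
  by apply: (measurableT_comp (mi _ mA)); apply: measurable_tadd => //; exact: measurable_topp.
have h'0 z : (0 <= h' z)%E by rewrite lee_fin mulr_ge0.
have ind (m : {measure set Tn -> \bar R}) C : measurable C -> (\int[m]_t (\1_C t)%:E = m C)%E.
  by move=> mC; rewrite integral_indic // setIT.
have mB1 x : measurable (tadd x @^-1` B).
  by apply: measurable_preimageT => //; apply: measurable_tadd.
have mNA : measurable (@topp R n @^-1` A).
  by apply: measurable_preimageT => //; apply: measurable_topp.
transitivity (\int[mu]_x \int[nu]_y h (x, y))%E.
  transitivity (\int[mu]_x ((\1_A x)%:E * nu B))%E.
    by rewrite ge0_integralZr ?ind //; apply/measurable_EFinP; exact: mi.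
  apply: eq_integral => x _; rewrite /h /=.
  under eq_integral do rewrite EFinM.
  rewrite ge0_integralZl //; last first.
    by apply/measurable_EFinP; apply: (measurableT_comp (mi _ mB)); apply: measurable_tadd.
  congr (_ * _)%E; rewrite -(hnu x) // -ind //.
rewrite fubini_tonelli //.
transitivity (\int[nu]_y \int[mu]_x h' (x, y))%E.
  apply: eq_integral => y _.
  rewrite -(leb_translate (topp y) (f := fun x => h (x, y))) //; last first.
    by apply: (measurableT_comp mh); exact: measurable_pair2.
  apply: eq_integral => x _; rewrite /h /h' /=; congr (_ * \1_B _)%:E.
  by rewrite (taddC (topp y)) -taddA (taddC (topp y)) taddN tadd0.
rewrite -fubini_tonelli //.
transitivity (\int[mu]_x (nu (@topp R n @^-1` A) * (\1_B x)%:E))%E; last first.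
  by rewrite ge0_integralZl ?ind //; apply/measurable_EFinP; exact: mi.
apply: eq_integral => x _; rewrite /h' /=.
under eq_integral do rewrite EFinM.
rewrite ge0_integralZr //; last first.
  apply/measurable_EFinP; apply: (measurableT_comp (mi _ mA)); apply: measurable_tadd => //.
  exact: measurable_topp.
congr (_ * _)%E; rewrite -(hnu (topp x)) // -ind; last first.
  by apply: measurable_preimageT => //; apply: measurable_tadd.
apply: eq_integral => y _; congr (_%:E); rewrite !indicE.
have pre (f : Tn -> Tn) C z : (z \in f @^-1` C) = (f z \in C) by [].
rewrite !pre; congr ((_ \in A)%:R).
by apply: eq_from_tnth => i; rewrite !tnth_mktuple; ring.
Qed.

Lemma measurable_toppT : measurable_fun setT (@topp R n).
Proof. by have := @measurable_topp R _ _ n id (@measurable_id _ _ _). Qed.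

(** Sigma-finiteness provides a set of positive Lebesgue measure whose reflection has finite
    [nu]-measure; [haar_swap] transfers this finiteness to B. *)
Lemma haar_finite nu B : translation_invariant nu -> measurable B ->
  (mu B < +oo)%E -> (nu B < +oo)%E.
Proof.
move=> hnu mB Bfin; have [F FT Foo] := sigma_finiteT nu.
pose A k := @topp R n @^-1` F k.
have mA k : measurable (A k).
  by apply: measurable_preimageT; [exact: measurable_toppT|case: (Foo k)].
have [k Ak] : exists k, (0 < mu (A k))%E.
  apply: contrapT => hn.
  have A0 k : mu (A k) = 0%E.
    apply/eqP; rewrite eq_le measure_ge0 andbT leNgt; apply/negP => h.
    by apply: hn; exists k.
  have /andP[T0 _] := leb_box (tzero R n) (@ltr01 R).
  have : (mu (box (tzero R n) 1) <= \sum_(0 <= i <oo) mu (A i))%E.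
    apply: measure_sigma_subadditive => //; first exact: measurable_box.
    move=> t _; have [k _ Fk] : (\bigcup_n F n) (topp t) by rewrite -FT.
    by exists k.
  rewrite eseries0; last by move=> i _ _; exact: A0.
  by move=> /(lt_le_trans T0); rewrite ltxx.
have := haar_swap hnu (mA k) mB.
have -> : @topp R n @^-1` A k = F k.
  by apply/seteqP; split => t; rewrite /A /= toppK.
have [_ Fk] := Foo k => e.
have fin : (mu (A k) * nu B < +oo)%E.
  by rewrite e lte_mul_pinfty // ge0_fin_numE.
rewrite ltey; apply/eqP => Boo.
by move: fin; rewrite Boo gt0_muley // ltxx.
Qed.

(** With B the unit box, [haar_swap] expresses nu(-A) as a multiple of mu(A). Applied to mu itself,
    it shows that mu is invariant under reflection, which removes the sign. *)
Lemma haar_unique nu : translation_invariant nu -> exists2 c : R, 0 <= c &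
  forall A, measurable A -> (nu A = c%:E * mu A)%E.
Proof.
move=> hnu; set B := box (tzero R n) 1.
have mB : measurable B := measurable_box _ _.
have /andP[B0 Boo] := leb_box (tzero R n) (@ltr01 R).
have Bfin : mu B \is a fin_num by rewrite ge0_fin_numE.
have nBfin : nu B \is a fin_num by rewrite ge0_fin_numE //; exact: haar_finite.
have [b b0 bE] : exists2 b : R, 0 < b & mu B = b%:E.
  exists (fine (mu B)); last by rewrite fineK.
  by rewrite -lte_fin fineK.
have mN A : measurable A -> measurable (@topp R n @^-1` A).
  by apply: measurable_preimageT; exact: measurable_toppT.
have key m A : translation_invariant m -> measurable A ->
    m (@topp R n @^-1` A) = ((fine (m B) / b)%:E * mu A)%E.
  move=> hm mA; have := haar_swap hm mA mB; rewrite -/B bE => h.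
  have mfin : m B \is a fin_num by rewrite ge0_fin_numE //; exact: haar_finite.
  rewrite EFinM fineK // muleAC (muleC (m B)) h -muleA -EFinM mulfV ?gt_eqF //.
  by rewrite mule1.
have NN A : @topp R n @^-1` (@topp R n @^-1` A) = A.
  by apply/seteqP; split => t /=; rewrite toppK.
exists (fine (nu B) / b); first by rewrite divr_ge0 ?fine_ge0 ?(ltW b0).
move=> A mA; rewrite -[in LHS](NN A) key //; last exact: mN.
rewrite (key mu A leb_translation_invariant mA) bE /= mulfV ?gt_eqF //.
by rewrite mul1e.
Qed.

(** The image of Lebesgue measure under an additive bijection is again translation invariant, hence
    a multiple of it; no determinant of L is needed. The multiple is positive because the preimage
    of a box under [L'] has the mass of the box. *)
Lemma leb_linear (L L' : Tn -> Tn) : measurable_fun setT L -> measurable_fun setT L' ->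
  cancel L L' -> cancel L' L -> {morph L : s t / tadd s t} ->
  exists2 c : R, 0 < c & forall f : Tn -> \bar R, measurable_fun setT f ->
    (forall t, (0 <= f t)%E) -> (\int[mu]_t f (L t) = c%:E * \int[mu]_t f t)%E.
Proof.
move=> mL mL' LK LK' Ladd.
pose nu := push_sf mu mL mL' LK.
have hnu : translation_invariant nu.
  move=> s A mA; rewrite /nu /= /push /= /pushforward /=.
  rewrite -[RHS](leb_translation_invariant (L' s)); last exact: measurable_preimageT.
  by congr (mu _); apply/seteqP; split => t /=; rewrite Ladd LK'.
have [c c0 cE] := haar_unique hnu.
have int f : measurable_fun setT f -> (forall t, (0 <= f t)%E) ->
    (\int[mu]_t f (L t) = c%:E * \int[mu]_t f t)%E.
  move=> mf f0.
  transitivity (\int[nu]_t f t)%E.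
    by rewrite /nu /= ge0_integral_pushforward.
  have cnn : 0 <= c by [].
  rewrite (eq_measure_integral (mscale (NngNum cnn) mu)); last first.
    by move=> A mA _; exact: (cE A mA).
  by rewrite ge0_integral_mscale.
exists c => //.
rewrite lt_neqAle c0 andbT; apply/eqP => cz.
have /andP[B0 _] := leb_box (tzero R n) (@ltr01 R).
have := cE (L' @^-1` box (tzero R n) 1).
rewrite -cz mul0e /nu /= /push /= /pushforward /= -comp_preimage.
have -> : L' \o L = id by apply/funext => t /=; rewrite LK.
rewrite preimage_id => h; move: B0; rewrite h ?ltxx //.
by apply: measurable_preimageT => //; exact: measurable_box.
Qed.

End Haar.

(** * Invariance of Lebesgue measure under phi *)

Section Coords.
Variables (R : realType) (r : nat).
Local Notation n := (sym_dim r).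
Local Notation Tn := (n.-tuple R).
Implicit Types (s t : Tn) (x y : 'M[R]_r).

Local Notation Mx := (@smx_of_tuple R r).

Lemma sym_pairP (i j : 'I_r) : sym_pair i j \in sym_pairs r.
Proof.
rewrite mem_filter; apply/andP; split.
  by rewrite /sym_pair; case: (leqP i j) => /= [|/ltnW].
by apply/allpairsP; exists (sym_pair i j); rewrite !mem_enum -surjective_pairing.
Qed.

Lemma sym_pairC (i j : 'I_r) : sym_pair i j = sym_pair j i.
Proof.
rewrite /sym_pair; case: (ltngtP i j) => // h.
by congr pair; apply/val_inj.
Qed.

Lemma sym_pairs_uniq : uniq (sym_pairs r).
Proof.
apply: filter_uniq; apply: allpairs_uniq; rewrite ?enum_uniq //.
by move=> [a b] [c d] _ _ [-> ->].
Qed.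

Definition sidx (i j : 'I_r) : 'I_n :=
  Ordinal (etrans (index_mem (sym_pair i j) (sym_pairs r)) (sym_pairP i j)).

Definition spair (k : 'I_n) : 'I_r * 'I_r := tnth (in_tuple (sym_pairs r)) k.

Lemma spair_le k : ((spair k).1 <= (spair k).2)%N.
Proof.
have : spair k \in sym_pairs r by exact: mem_tnth.
by rewrite mem_filter => /andP[].
Qed.

Lemma sidxK k : sidx (spair k).1 (spair k).2 = k.
Proof.
apply/val_inj => /=; rewrite /sym_pair spair_le -surjective_pairing.
by rewrite /spair (tnth_nth (spair k)) index_uniq // sym_pairs_uniq.
Qed.

Lemma spair_sidx i j : spair (sidx i j) = sym_pair i j.
Proof. by rewrite /spair (tnth_nth (i, j)) /= nth_index // sym_pairP. Qed.

Lemma smx_tupleE t i j : Mx t i j = tnth t (sidx i j).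
Proof. by rewrite /smx_of_tuple /smx_of_seq mxE (tnth_nth 0). Qed.

Lemma tnth_sym_coords x k : tnth (sym_coords x) k = x (spair k).1 (spair k).2.
Proof. by rewrite tnth_map. Qed.

Lemma smx_tupleK t : sym_coords (Mx t) = t.
Proof. by apply: eq_from_tnth => k; rewrite tnth_sym_coords smx_tupleE sidxK. Qed.

Lemma sym_coordsK x : x^T = x -> Mx (sym_coords x) = x.
Proof.
move=> sx; apply/matrixP => i j; rewrite smx_tupleE tnth_sym_coords spair_sidx.
by rewrite /sym_pair; case: leqP => //= _; rewrite -[in LHS]sx mxE.
Qed.

Lemma smx_tuple_sym t : (Mx t)^T = Mx t.
Proof.
apply/matrixP => i j; rewrite [LHS]mxE !smx_tupleE; congr (tnth t _).
by apply/val_inj; rewrite /= sym_pairC.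
Qed.

Definition tscale (a : R) t : Tn := [tuple a * tnth t i | i < n].

Lemma smx_tadd s t : Mx (tadd s t) = Mx s + Mx t.
Proof. by apply/matrixP => i j; rewrite [RHS]mxE !smx_tupleE tnth_mktuple. Qed.

Lemma smx_tscale a t : Mx (tscale a t) = a *: Mx t.
Proof. by apply/matrixP => i j; rewrite [RHS]mxE !smx_tupleE tnth_mktuple. Qed.

(** Such a set is the union of the boxes that it contains with rational centre and radius 1 / (k +
    1), which are enumerated by [unpickle]. *)
Lemma box_open_measurable m (O : set (m.-tuple R)) :
  (forall t : m.-tuple R, O t -> exists2 e : R, 0 < e & box t e `<=` O) -> measurable O.
Proof.
move=> hO.
pose q2t (q : {ffun 'I_m -> rat}) : m.-tuple R := [tuple ratr (q i) | i < m].
pose B (k : nat) : set (m.-tuple R) :=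
  match @unpickle ({ffun 'I_m -> rat} * nat)%type k with
  | Some z => if `[< box (q2t z.1) (z.2.+1%:R^-1) `<=` O >]
              then box (q2t z.1) (z.2.+1%:R^-1) else set0
  | None => set0
  end.
have -> : O = \bigcup_k B k.
  apply/seteqP; split => [t Ot|t [k _]]; last first.
    by rewrite /B; case: unpickle => // z; case: ifPn => // /asboolP h /h.
  have [e e0 he] := hO t Ot.
  (* With a radius below e / 2, a box whose rational centre is that close to t contains t and lies
     within distance e of t. *)
  have [N hN] : exists N : nat, N.+1%:R^-1 < e / 2.
    have h : 0 < e / 2 by rewrite divr_gt0.
    exists (Num.bound (e / 2)^-1); rewrite invf_plt ?posrE //.
    apply: lt_trans (archi_boundP _) _; last by rewrite ltr_nat.
    by rewrite invr_ge0 ltW.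
  have [a aE] : exists a : R, a = N.+1%:R^-1 by exists (N.+1%:R^-1).
  have a0 : 0 < a by rewrite aE invr_gt0.
  rewrite -aE in hN.
  have hq i : {q : rat | `|tnth t i - ratr q| < a}.
    apply: cid; have : tnth t i - a < tnth t i + a by lra.
    move=> /rat_in_itvoo [q]; rewrite in_itv /= => /andP[h1 h2].
    by exists q; rewrite ltr_norml; apply/andP; split; lra.
  pose q := [ffun i => projT1 (hq i)].
  exists (pickle (q, N)) => //.
  have qt i : tnth (q2t q) i = ratr (projT1 (hq i)) by rewrite tnth_mktuple ffunE.
  rewrite /B pickleK /=; case: ifPn => /asboolP hn; last first.
    exfalso; apply: hn => u hu; apply: he => i.
    have := hu i; have := projT2 (hq i); rewrite qt -aE.
    move: (projT1 (hq i)) => qi h1 h2.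
    have -> : tnth u i - tnth t i = (tnth u i - ratr qi) - (tnth t i - ratr qi) by ring.
    by apply: le_lt_trans (ler_normB _ _) _; lra.
  by move=> i; rewrite qt -aE; exact: (projT2 (hq i)).
apply: bigcupT_measurable => k; rewrite /B; case: unpickle => // z.
by case: ifPn => // _; exact: measurable_box.
Qed.

Definition DP : set Tn := [set t | posdef (Mx t)].

Lemma DP_open t : DP t -> exists2 e : R, 0 < e & box t e `<=` DP.
Proof.
move=> pt; have [e e0 h] := posdef_open pt; exists e => // u hu.
by apply: h => [|i j]; [exact: smx_tuple_sym|rewrite !smx_tupleE; exact: hu].
Qed.

Lemma measurable_DP : measurable DP.
Proof. by apply: box_open_measurable => t; exact: DP_open. Qed.

Section MxMeas.
Context d (T : measurableType d).

Definition mxmeas p q (M : T -> 'M[R]_(p, q)) := forall i j, measurable_fun setT (fun z => M z i j).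

Lemma mxmeas_cst p q (A : 'M[R]_(p, q)) : mxmeas (fun=> A).
Proof. by move=> i j; exact: measurable_cst. Qed.

Lemma mxmeasD p q (M N : T -> 'M[R]_(p, q)) : mxmeas M -> mxmeas N -> mxmeas (fun z => M z + N z).
Proof. by move=> hM hN i j; under eq_fun do rewrite mxE; exact: measurable_funD. Qed.

Lemma mxmeasZ p q a (M : T -> 'M[R]_(p, q)) : mxmeas M -> mxmeas (fun z => a *: M z).
Proof. by move=> hM i j; under eq_fun do rewrite mxE; exact: measurable_funM. Qed.

Lemma mxmeasM p q m (M : T -> 'M[R]_(p, q)) (N : T -> 'M[R]_(q, m)) :
  mxmeas M -> mxmeas N -> mxmeas (fun z => M z *m N z).
Proof.
move=> hM hN i j; under eq_fun do rewrite mxE.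
by apply: measurable_sum => k; exact: measurable_funM.
Qed.

Lemma measurable_det m (M : T -> 'M[R]_m) : mxmeas M -> measurable_fun setT (fun z => \det (M z)).
Proof.
move=> hM; rewrite /determinant; apply: measurable_sum => s.
by apply: measurable_funM => //; apply: measurable_prod => i _.
Qed.

Lemma mxmeas_inv m (M : T -> 'M[R]_m) : mxmeas M -> mxmeas (fun z => invmx (M z)).
Proof.
move=> hM i j.
have hd := measurable_det hM.
have -> : (fun z => invmx (M z) i j) = (fun z => if \det (M z) == 0 then M z i j
    else (\det (M z))^-1 * \adj (M z) i j).
  apply/funext => z; rewrite /invmx unitmxE unitfE; case: eqP => //= _.
  by rewrite [LHS]mxE.
apply: measurable_fun_ifT => //.
  by apply: measurable_fun_eqr.
apply: measurable_funM.
  (* Reduces inversion to a real power of a nonnegative number, which is measurable; at determinant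
     0 both sides are 0. *)
  have -> : (fun z => (\det (M z))^-1) = (fun z => \det (M z) * ((\det (M z)) ^+ 2) `^ (-1)).
    apply/funext => z; rewrite powR_inv1 ?sqr_ge0 //.
    have [->|d0] := eqVneq (\det (M z)) 0; first by rewrite mul0r invr0.
    by rewrite expr2 invfM mulrA mulfV // mul1r.
  apply: measurable_funM => //.
  by apply: (measurableT_comp (measurable_powR _)); exact: measurable_funX.
under eq_fun do rewrite mxE.
apply: measurable_funM => //; apply: measurable_det => k l.
by under eq_fun do rewrite !mxE; exact: hM.
Qed.

End MxMeas.

End Coords.

Section Shears.
Variables (R : realType) (r : nat).
Local Notation n := (sym_dim r).
Local Notation Tn := (n.-tuple R).
Local Notation mu := (leb R n).
Local Notation mu2 := (prod_sf (leb R n) (leb R n)).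
Local Notation Mx := (@smx_of_tuple R r).
Local Notation Cx := (@sym_coords R r).
Implicit Types (s t u : Tn).

Lemma measurable_sym_coords d (T : measurableType d) (M : T -> 'M[R]_r) :
  mxmeas M -> measurable_fun setT (fun z => Cx (M z)).
Proof.
move=> hM; apply: measurable_tupleP => i; under eq_fun do rewrite tnth_sym_coords.
exact: hM.
Qed.

Lemma mxmeas_smx d (T : measurableType d) (f : T -> Tn) :
  measurable_fun setT f -> mxmeas (fun z => Mx (f z)).
Proof.
by move=> mf i j; under eq_fun do rewrite smx_tupleE; exact: measurable_tnthT.
Qed.

Lemma measurable_tscale d (T : measurableType d) (a : R) (f : T -> Tn) :
  measurable_fun setT f -> measurable_fun setT (fun z => tscale a (f z)).
Proof.
move=> mf; apply: measurable_tupleP => i; under eq_fun do rewrite tnth_mktuple.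
by apply: measurable_funM => //; exact: measurable_tnthT.
Qed.

(** c is the Jacobian of the dilation by a, characterized by its effect on integrals: its
    multiplicativity suffices ([scaling_prod1]). *)
Definition scaling (a c : R) := 0 < c /\ forall f : Tn -> \bar R, measurable_fun setT f ->
  (forall t, (0 <= f t)%E) -> (\int[mu]_t f t = c%:E * \int[mu]_t f (tscale a t))%E.

Lemma scaling_exists a : a != 0 -> exists c, scaling a c.
Proof.
move=> a0.
have ms b : measurable_fun setT (@tscale R r b : Tn -> Tn).
  by have := @measurable_tscale _ _ b id (@measurable_id _ _ _).
have K b c : b * c = 1 -> cancel (@tscale R r c) (@tscale R r b).
  move=> h t; apply: eq_from_tnth => i; rewrite !tnth_mktuple mulrA h mul1r //.
have A : {morph (@tscale R r a) : s t / tadd s t}.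
  by move=> s t; apply: eq_from_tnth => i; rewrite !tnth_mktuple mulrDr.
have [c c0 cE] := leb_linear (ms a) (ms a^-1) (K _ _ (mulVf a0)) (K _ _ (mulfV a0)) A.
exists c^-1; split; first by rewrite invr_gt0.
move=> f mf f0; rewrite cE // muleA -EFinM mulVf ?gt_eqF // mul1e //.
Qed.

Lemma scaling_prod1 a b c ca cb cc : scaling a ca -> scaling b cb -> scaling c cc ->
  a * b * c = 1 -> ca * cb * cc = 1.
Proof.
move=> [ca0 ha] [cb0 hb] [cc0 hc] abc.
pose f : Tn -> \bar R := fun t => (\1_(box (tzero R n) 1) t)%:E.
have mf : measurable_fun setT f.
  by apply/measurable_EFinP; apply: measurable_indic; exact: measurable_box.
have f0 t : (0 <= f t)%E by rewrite lee_fin.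
have ms x : measurable_fun setT (@tscale R r x : Tn -> Tn).
  by have := @measurable_tscale _ _ x id (@measurable_id _ _ _).
have mfs x : measurable_fun setT (fun t => f (tscale x t)) by apply: (measurableT_comp mf).
have := ha _ mf f0; rewrite (hb (fun t => f (tscale a t))) //.
rewrite (hc (fun t => f (tscale a (tscale b t)))) //; last first.
  by apply: (measurableT_comp (mfs a)).
have -> : (fun t => f (tscale a (tscale b (tscale c t)))) = f.
  apply/funext => t; congr f; apply: eq_from_tnth => i; rewrite !tnth_mktuple.
  by rewrite !mulrA abc mul1r.
have /andP[h1 h2] := leb_box (tzero R n) (@ltr01 R).
have -> : (\int[mu]_t f t = mu (box (tzero R n) 1))%E.
  by rewrite integral_indic ?setIT //; exact: measurable_box.
rewrite !muleA -!EFinM.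
have -> : mu (box (tzero R n) 1) = (fine (mu (box (tzero R n) 1)))%:E.
  by rewrite fineK // ge0_fin_numE.
have m0 : 0 < fine (mu (box (tzero R n) 1)) by rewrite fine_gt0 // h1.
rewrite -EFinM => -[] /eqP; rewrite -subr_eq0 => /eqP e.
apply: (mulIf (lt0r_neq0 m0)); rewrite mul1r; apply/eqP; rewrite -subr_eq0 -oppr_eq0 opprB.
exact/eqP.
Qed.

Lemma integral_swap (F : Tn * Tn -> \bar R) : measurable_fun setT F ->
  (forall z, (0 <= F z)%E) ->
  (\int[mu2]_z F z = \int[mu2]_z F (z.2, z.1))%E.
Proof.
move=> mF F0; rewrite fubini_tonelli1 // [RHS]fubini_tonelli2 //.
by apply: (measurableT_comp mF); apply: measurable_fun_pair.
Qed.

(** For each fixed second variable this is a dilation followed by a translation, so the only factor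
    is that of the dilation, however irregular the measurable function b may be. *)
Lemma shear1 a c (b : Tn -> Tn) (F : Tn * Tn -> \bar R) : scaling a c ->
  measurable_fun setT b -> measurable_fun setT F -> (forall z, (0 <= F z)%E) ->
  (\int[mu2]_z F z = c%:E * \int[mu2]_z F (tadd (tscale a z.1) (b z.2), z.2))%E.
Proof.
move=> [c0 ac] mb mF F0.
have mS : measurable_fun setT (fun z : Tn * Tn => (tadd (tscale a z.1) (b z.2), z.2)).
  apply: measurable_fun_pair => //; apply: measurable_tadd.
    by apply: measurable_tscale.
  by apply: (measurableT_comp mb).
have mFS : measurable_fun setT (fun z : Tn * Tn => F (tadd (tscale a z.1) (b z.2), z.2)).
  exact: (measurableT_comp mF mS).
rewrite fubini_tonelli2 // [in RHS]fubini_tonelli2 //.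
rewrite -ge0_integralZl //; last 3 first.
- exact: measurable_fun_fubini_tonelli_G.
- by move=> t _; exact: integral_ge0.
- by rewrite lee_fin ltW.
apply: eq_integral => t _; rewrite /fubini_G.
have m1 : measurable_fun setT (fun s => F (s, t)).
  by apply: (measurableT_comp mF); exact: measurable_pair2.
have m2 : measurable_fun setT (fun s => F (tadd (b t) s, t)).
  by apply: (measurableT_comp m1); apply: measurable_tadd.
rewrite -(leb_translate (b t) (f := fun s => F (s, t))) // ac //.
by congr (_ * _)%E; apply: eq_integral => s _; rewrite taddC.
Qed.

Lemma shear2 a c (b : Tn -> Tn) (F : Tn * Tn -> \bar R) : scaling a c ->
  measurable_fun setT b -> measurable_fun setT F -> (forall z, (0 <= F z)%E) ->
  (\int[mu2]_z F z = c%:E * \int[mu2]_z F (z.1, tadd (tscale a z.2) (b z.1)))%E.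
Proof.
move=> ac mb mF F0.
have msw : measurable_fun setT (fun z : Tn * Tn => (z.2, z.1)) by apply: measurable_fun_pair.
rewrite integral_swap // (shear1 (b := b) ac) //; last exact: (measurableT_comp mF msw).
congr (_ * _)%E; rewrite [RHS]integral_swap //.
apply: (measurableT_comp mF); apply: measurable_fun_pair => //; apply: measurable_tadd.
  by apply: measurable_tscale.
by apply: (measurableT_comp mb).
Qed.

Definition DD : set (Tn * Tn) := @DP R r `*` @DP R r.

Lemma measurable_DD : measurable DD.
Proof. by apply: measurableX; exact: measurable_DP. Qed.

Definition Phi (al be : R) (z : Tn * Tn) : Tn * Tn :=
  (Cx (phi_ab al be (Mx z.1) (Mx z.2)).1, Cx (phi_ab al be (Mx z.1) (Mx z.2)).2).

Lemma measurable_Phi al be : measurable_fun setT (Phi al be).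
Proof.
have m1 : mxmeas (fun z : Tn * Tn => Mx z.1) by exact: mxmeas_smx.
have m2 : mxmeas (fun z : Tn * Tn => Mx z.2) by exact: mxmeas_smx.
apply: measurable_fun_pair; apply: measurable_sym_coords; rewrite /phi_ab /=;
  (apply: mxmeasM; [apply: mxmeasM => //; apply: mxmeas_inv|]);
  by apply: mxmeasD; [exact: mxmeas_cst|apply: mxmeasZ; exact: mxmeasM].
Qed.

Section Cov.
Variables (al be : R).
Hypotheses (al0 : 0 < al) (be0 : 0 < be).
Let k := be / al.
Let k0 : 0 < k. Proof. by rewrite divr_gt0. Qed.

(* Along (v, u) -> (q, u) -> (q, y) -> (x, y), where q = al x + y^-1 = be v + u^-1,
   each step rescales one variable and translates it by a function of the other. *)
Lemma shear_chain (u v : 'M[R]_r) :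
  let q := be *: v + invmx u in
  let y := k^-1 *: u + (1 - k^-1) *: invmx q in
  let x := al^-1 *: q + (- al^-1) *: invmx y in
  (posdef x /\ posdef y <-> posdef u /\ posdef v) /\
  (posdef u -> posdef v -> phi_ab al be x y = (u, v)).
Proof.
move=> q y x.
have kV : 0 < k^-1 by rewrite invr_gt0.
have axE : q - invmx y = al *: x.
  by rewrite /x scalerDr !scalerA mulrN mulfV ?gt_eqF // scale1r scaleN1r.
have bvE : q - invmx u = be *: v by rewrite /q addrK.
have yE : y - invmx q = k^-1 *: (u - invmx q).
  by rewrite /y; move: (invmx q) => Q; apply/matrixP => i j; rewrite !mxE; ring.
have dir1 : posdef u -> posdef v -> [/\ posdef q, posdef (u - invmx q), posdef y & posdef x].
  move=> pu pv; have pqu : posdef (q - invmx u) by rewrite bvE; exact: posdefZ.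
  have [pq puq] := posdef_shear pu pqu.
  have pyq : posdef (y - invmx q) by rewrite yE; exact: posdefZ.
  have [py pqy] := posdef_shear pq pyq.
  split=> //; apply: (posdefZV al0); rewrite -axE //.
split.
  split=> [[px py]|[pu pv]]; last by have [] := dir1 pu pv.
  have pqy : posdef (q - invmx y) by rewrite axE; exact: posdefZ.
  have [pq pyq] := posdef_shear py pqy.
  have puq : posdef (u - invmx q) by apply: (posdefZV kV); rewrite -yE.
  have [pu pqu] := posdef_shear pq puq.
  by split => //; apply: (posdefZV be0); rewrite -bvE.
move=> pu pv; have [pq puq py px] := dir1 pu pv.
pose p := invmx q; have pp : posdef p by exact: posdef_inv.
pose z := k^-1 *: (u - p); have pz : posdef z by exact: posdefZ.
have ypz : y = p + z by rewrite /z -yE addrC subrK.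
have ukz : u = p + k *: z.
  by rewrite /z scalerA mulfV ?gt_eqF // scale1r addrC subrK.
have pw := posdef_conjw pp pz.
have xE : x = invmx (al *: (p + conjw p z)).
  rewrite posdef_invZ //; last exact: posdefD.
  rewrite -posdef_inv_sub // -ypz /p invmxK axE scalerA mulVf ?gt_eqF // scale1r //.
have vE : v = invmx (al *: (conjw p z + k *: p)).
  rewrite posdef_invZ //; last by apply: posdefDZ => //; exact: ltW.
  have := posdef_inv_sub pp (posdefZ k0 pz); rewrite -ukz {1}/p invmxK bvE.
  rewrite posdef_invZ // -scalemxAr -scalemxAl -/(conjw p z).
  have -> : p + k^-1 *: conjw p z = k^-1 *: (conjw p z + k *: p).
    by rewrite scalerDr scalerA mulVf ?gt_eqF // scale1r addrC.
  rewrite posdef_invZ ?invr_gt0 //; last by apply: posdefDZ => //; exact: ltW.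
  rewrite invrK => h; apply: (@scalerI _ _ be); first by rewrite gt_eqF.
  by rewrite h scalerA.
by rewrite {1}xE ypz phi_pz // ?(ltW be0) // -/k -ukz -vE.
Qed.

Lemma cov_pos (H : Tn * Tn -> \bar R) : measurable_fun setT H -> (forall z, (0 <= H z)%E) ->
  (\int[mu2]_z ((\1_DD z)%:E * H (Phi al be z)) = \int[mu2]_z ((\1_DD z)%:E * H z))%E.
Proof.
move=> mH H0.
have al_n0 := lt0r_neq0 al0; have be_n0 := lt0r_neq0 be0; have k_n0 := lt0r_neq0 k0.
have [c1 s1] := scaling_exists (invr_neq0 al_n0).
have [c2 s2] := scaling_exists (invr_neq0 k_n0).
have [c3 s3] := scaling_exists be_n0.
(* The three dilations are by 1 / al, al / be and be. *)
have c123 : c1 * c2 * c3 = 1.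
  by apply: (scaling_prod1 s1 s2 s3); rewrite /k; field; rewrite al_n0 be_n0.
pose b1 t : Tn := Cx ((- al^-1) *: invmx (Mx t)).
pose b2 t : Tn := Cx ((1 - k^-1) *: invmx (Mx t)).
pose b3 t : Tn := Cx (invmx (Mx t)).
have mid : measurable_fun setT (fun t : Tn => t) by exact: measurable_id.
have mb1 : measurable_fun setT b1.
  by apply: measurable_sym_coords; apply: mxmeasZ; apply: mxmeas_inv; exact: mxmeas_smx.
have mb2 : measurable_fun setT b2.
  by apply: measurable_sym_coords; apply: mxmeasZ; apply: mxmeas_inv; exact: mxmeas_smx.
have mb3 : measurable_fun setT b3.
  by apply: measurable_sym_coords; apply: mxmeas_inv; exact: mxmeas_smx.
have mDD : measurable_fun setT (fun z => (\1_DD z)%:E : \bar R).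
  by apply/measurable_EFinP; apply: measurable_indic; exact: measurable_DD.
pose F0 z := ((\1_DD z)%:E * H (Phi al be z))%E.
have mF0 : measurable_fun setT F0.
  apply: emeasurable_funM => //; apply: (measurableT_comp mH); exact: measurable_Phi.
have F00 z : (0 <= F0 z)%E by rewrite mule_ge0 // lee_fin.
have mS a b : measurable_fun setT b ->
    measurable_fun setT (fun z : Tn * Tn => (tadd (tscale a z.1) (b z.2), z.2)).
  move=> mb; apply: measurable_fun_pair => //; apply: measurable_tadd.
    by apply: measurable_tscale.
  by apply: (measurableT_comp mb).
have mS' a b : measurable_fun setT b ->
    measurable_fun setT (fun z : Tn * Tn => (z.1, tadd (tscale a z.2) (b z.1))).
  move=> mb; apply: measurable_fun_pair => //; apply: measurable_tadd.
    by apply: measurable_tscale.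
  by apply: (measurableT_comp mb).
rewrite -/(F0) (shear1 s1 mb1 mF0 F00).
pose F1 z := F0 (tadd (tscale al^-1 z.1) (b1 z.2), z.2).
have mF1 : measurable_fun setT F1 by exact: (measurableT_comp mF0 (mS _ _ mb1)).
have F10 z : (0 <= F1 z)%E by exact: F00.
rewrite -/F1 (shear2 s2 mb2 mF1 F10).
pose F2 z := F1 (z.1, tadd (tscale k^-1 z.2) (b2 z.1)).
have mF2 : measurable_fun setT F2 by exact: (measurableT_comp mF1 (mS' _ _ mb2)).
have F20 z : (0 <= F2 z)%E by exact: F10.
rewrite -/F2 (shear1 s3 mb3 mF2 F20) !muleA -!EFinM c123 mul1e.
(* The chain starts from (v, u), whereas [Phi] returns (u, v). *)
rewrite [RHS]integral_swap; last 2 first.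
- by apply: emeasurable_funM.
- by move=> z; rewrite mule_ge0 // lee_fin.
apply: eq_integral => -[v u] _; rewrite /F2 /F1 /F0 /=.
set q := tadd (tscale be v) (b3 u).
set y := tadd (tscale k^-1 u) (b2 q).
set x := tadd (tscale al^-1 q) (b1 y).
have symI t : (invmx (Mx t))^T = invmx (Mx t) by rewrite trmx_inv smx_tuple_sym.
have symZI a t : (a *: invmx (Mx t))^T = a *: invmx (Mx t) by rewrite linearZ /= symI.
have qE : Mx q = be *: Mx v + invmx (Mx u) by rewrite smx_tadd smx_tscale sym_coordsK.
have yE : Mx y = k^-1 *: Mx u + (1 - k^-1) *: invmx (Mx q).
  by rewrite smx_tadd smx_tscale sym_coordsK.
have xE : Mx x = al^-1 *: Mx q + (- al^-1) *: invmx (Mx y).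
  by rewrite smx_tadd smx_tscale sym_coordsK.
have := shear_chain (Mx u) (Mx v); rewrite /= -qE -yE -xE => -[iff ph].
have e : ((x, y) \in DD) = ((u, v) \in DD).
  by apply/idP/idP => /set_mem /= h; apply/mem_set => /=; apply/iff.
rewrite !indicE e; have [h|h] := boolP ((u, v) \in DD); last by rewrite !mul0e.
have [pu pv] := set_mem h; rewrite !mul1e; congr H.
rewrite /Phi (_ : phi_ab al be (Mx (x, y).1) (Mx (x, y).2) = (Mx u, Mx v)); last exact: ph.
by rewrite /= !smx_tupleK.
Qed.

End Cov.
End Shears.

Section DensityMeasure.
Context d (T : measurableType d) (R : realType).
Variables (mu : {measure set T -> \bar R}) (K : T -> \bar R).
Hypotheses (mK : measurable_fun setT K) (K0 : forall z, (0 <= K z)%E).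

Definition dens (A : set T) : \bar R := (\int[mu]_(z in A) K z)%E.

Let dens0 : dens set0 = 0%E. Proof. by rewrite /dens integral_set0. Qed.
Let dens_ge0 A : (0 <= dens A)%E. Proof. by apply: integral_ge0. Qed.
Let dens_sigma : semi_sigma_additive dens.
Proof.
move=> F mF tF mUF; rewrite /dens ge0_integral_bigcup //; last exact: measurable_funTS.
by apply: is_cvg_ereal_nneg_natsum_cond => n _ _; exact: integral_ge0.
Qed.

HB.instance Definition _ := isMeasure.Build _ _ _ dens dens0 dens_ge0 dens_sigma.

Definition dens_measure : {measure set T -> \bar R} := dens.

Lemma dens_measureE A : dens_measure A = (\int[mu]_z ((\1_A z)%:E * K z))%E.
Proof.
rewrite /= /dens integral_mkcond epatch_indic.
by apply: eq_integral => z _; rewrite muleC.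
Qed.

End DensityMeasure.

(** * Comparison of probability measures on open sets *)

Section OpenUnique.
Variables (R : realType) (n : nat).
Local Notation Tn := (n.-tuple R).

Definition box2 (z : Tn * Tn) (e : R) : set (Tn * Tn) := box z.1 e `*` box z.2 e.

Definition open2 (O : set (Tn * Tn)) := forall z, O z -> exists2 e : R, 0 < e & box2 z e `<=` O.

Lemma box_le (c : Tn) e e' : e <= e' -> box c e `<=` box c e'.
Proof. by move=> ee t h i; exact: lt_le_trans (h i) ee. Qed.

Lemma box2_le z e e' : e <= e' -> box2 z e `<=` box2 z e'.
Proof. by move=> ee w [h1 h2]; split; apply: box_le; eassumption. Qed.

Lemma box2_refl z e : 0 < e -> box2 z e z.
Proof. by move=> e0; split=> i; rewrite subrr normr0. Qed.

Lemma open2_setI : setI_closed open2.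
Proof.
move=> A B hA hB z [/hA[e e0 he] /hB[e' e0' he']].
exists (Num.min e e'); first by rewrite lt_min e0.
by move=> w hw; split; [apply: he|apply: he']; apply: box2_le hw; rewrite ge_min lexx ?orbT.
Qed.

(* Transport to tuples of length [n + n], whose boxes are the [box2]. *)
Lemma open2_measurable O : open2 O -> measurable O.
Proof.
move=> hO.
pose c (z : Tn * Tn) : (n + n).-tuple R := cat_tuple z.1 z.2.
pose s (t : (n + n).-tuple R) : Tn * Tn :=
  ([tuple tnth t (lshift n i) | i < n], [tuple tnth t (rshift n i) | i < n]).
have cl z i : tnth (c z) (lshift n i) = tnth z.1 i.
  by rewrite !(tnth_nth 0) /= nth_cat size_tuple ltn_ord.
have cr z i : tnth (c z) (rshift n i) = tnth z.2 i.
  by rewrite !(tnth_nth 0) /= nth_cat size_tuple ltnNge leq_addr /= addKn.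
have scK z : s (c z) = z.
  case: z => a b; rewrite /s; congr pair; apply: eq_from_tnth => i; rewrite tnth_mktuple.
    exact: cl.
  exact: cr.
have mc : measurable_fun setT c.
  apply: measurable_tupleP => i; case: (split_ordP i) => j ->.
    by under eq_fun do rewrite cl; apply: measurable_tnthT.
  by under eq_fun do rewrite cr; apply: measurable_tnthT.
have -> : O = c @^-1` (s @^-1` O) by apply/seteqP; split => z /=; rewrite scK.
apply: measurable_preimageT => //; apply: box_open_measurable => t /= /hO[e e0 he].
exists e => // u hu; apply: he; split => i /=; rewrite !tnth_mktuple; exact: hu.
Qed.

(** The identity is measurable from the sigma-algebra generated by the open sets, because the
    preimage of a half-line under a coordinate is open. *)
Lemma open2_generate : @measurable _ (Tn * Tn)%type `<=` <<s open2 >>.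
Proof.
move=> A mA.
have mi : measurable_fun setT
    (fun z : g_sigma_algebraType open2 => ((z : Tn * Tn).1, (z : Tn * Tn).2)).
  apply: measurable_fun_pair; apply: measurable_tupleP => i;
    apply: (measurability _ (RGenInftyO.measurableE R)) => _ [_ [x ->] <-];
    rewrite setTI; apply: sub_sigma_algebra => z /=; rewrite in_itv /= => h.
  - exists (x - tnth z.1 i); first by rewrite subr_gt0.
    by move=> w [h1 _] /=; rewrite in_itv /=; have := h1 i; rewrite ltr_norml => /andP[]; lra.
  - exists (x - tnth z.2 i); first by rewrite subr_gt0.
    by move=> w [_ h1] /=; rewrite in_itv /=; have := h1 i; rewrite ltr_norml => /andP[]; lra.
have := mi measurableT _ mA; rewrite setTI.
by congr (<<s _ >> _); apply/seteqP; split => -[].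
Qed.

(* An open set is an increasing union of closed sets, so [m1 <= m2] on open
   sets and equal finite mass give [m2 <= m1] on closed, hence on open sets. *)
Lemma open2_measure_unique (m1 m2 : {measure set (Tn * Tn)%type -> \bar R}) :
  (forall O, open2 O -> (m1 O <= m2 O)%E) -> m1 setT = 1%E -> m2 setT = 1%E ->
  forall E, measurable E -> m1 E = m2 E.
Proof.
move=> le12 m1T m2T.
have oT : open2 setT by move=> z _; exists 1.
have eqO O : open2 O -> m1 O = m2 O.
  move=> oO; apply/eqP; rewrite eq_le le12 //=.
  pose C k := [set z | box2 z k.+1%:R^-1 `<=` O].
  have oC k : open2 (~` C k).
    move=> z /= hz; have [w [hw nw]] : exists w, box2 z k.+1%:R^-1 w /\ ~ O w.
      apply: contrapT => hn; apply: hz => w hw; apply: contrapT => nw; apply: hn.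
      by exists w.
    have ob : open2 [set z | box2 z k.+1%:R^-1 w].
      move=> z0 [h1 h2].
      (* The centre may move by the margin between e and the largest coordinate of t - c. This
         maximum requires an index, so n = 0 is separated. *)
      have key (c t : Tn) e : box c e t -> exists2 e', 0 < e' & forall c', box c e' c' -> box c' e t.
        move=> h; case: (posnP n) => [n0|n_gt0].
          by exists 1 => // c' _ i; have := ltn_ord i; rewrite {2}n0.
        pose i0 : 'I_n := Ordinal n_gt0.
        pose m := [arg max_(i > i0) `|tnth t i - tnth c i|]%O.
        exists (e - `|tnth t m - tnth c m|); first by rewrite subr_gt0.
        move=> c' hc' i; have -> : tnth t i - tnth c' i = (tnth t i - tnth c i) - (tnth c' i - tnth c i) by ring.
        apply: le_lt_trans (ler_normB _ _) _.
        have := hc' i; have : `|tnth t i - tnth c i| <= `|tnth t m - tnth c m|.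
          by rewrite /m; case: arg_maxP => // j _; apply.
        lra.
      have [e1 e10 he1] := key _ _ _ h1; have [e2 e20 he2] := key _ _ _ h2.
      exists (Num.min e1 e2); first by rewrite lt_min e10.
      move=> z1 [g1 g2]; split; [apply: he1|apply: he2]; apply: box_le; try eassumption;
        by rewrite ge_min lexx ?orbT.
    have [e e0 he] := ob z hw; exists e => // z1 hz1 hC; apply: nw; apply: hC; exact: he.
  have mC k : measurable (C k) by rewrite -[C k]setCK; apply: measurableC; exact: open2_measurable.
  have UC : \bigcup_k C k = O.
    apply/seteqP; split => [z [k _] h|z Oz]; first by apply: h; apply: box2_refl; rewrite invr_gt0.
    have [e e0 he] := oO z Oz.
    exists (Num.bound e^-1) => // w hw; apply: he; apply: box2_le hw.
    rewrite invf_ple ?posrE //; apply: ltW; apply: lt_trans (archi_boundP _) _.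
      by rewrite invr_ge0 ltW.
    by rewrite ltr_nat.
  have ndC : nondecreasing_seq C.
    move=> i j ij; apply/subsetPset => z h; apply: subset_trans h; apply: box2_le.
    by rewrite lef_pV2 ?posrE // ler_nat ltnS.
  have mU : measurable (\bigcup_k C k) by exact: bigcupT_measurable.
  have := @nondecreasing_cvg_mu _ _ _ m2 C mC mU ndC; rewrite UC => cv.
  rewrite -(cvg_lim _ cv) //; apply: lime_le; first by apply/cvg_ex; exists (m2 O).
  apply: nearW => k /=.
  have compl (m : {measure set (Tn * Tn)%type -> \bar R}) : m setT = 1%E ->
      (m (~` C k) = 1 - m (C k))%E.
    move=> mT; rewrite -setTD measureD //; first by rewrite setTI; congr (_ - _)%E.
    by apply: (@le_lt_trans _ _ 1%E); [rewrite -mT|exact: ltry].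
  have := le12 _ (oC k); rewrite !compl //.
  have fin (m : {measure set (Tn * Tn)%type -> \bar R}) : m setT = 1%E -> m (C k) \is a fin_num.
    move=> mT; rewrite ge0_fin_numE //; apply: (@le_lt_trans _ _ 1%E); last exact: ltry.
    by rewrite -mT; apply: le_measure => //; rewrite inE.
  rewrite -(fineK (fin _ m1T)) -(fineK (fin _ m2T)) !lee_fin => h.
  apply: (@le_trans _ _ (m1 (C k))); last first.
    apply: le_measure; rewrite ?inE //; first exact: open2_measurable.
    by move=> z h'; apply: h'; apply: box2_refl; rewrite invr_gt0.
  by rewrite -(fineK (fin _ m1T)) -(fineK (fin _ m2T)) lee_fin; lra.
move=> E /open2_generate sE.
apply: (@g_sigma_algebra_measure_unique _ _ _ open2 _ (fun=> setT)) => //.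
- exact: open2_measurable.
- by rewrite bigcup_const //; exists 0%N.
- exact: open2_setI.
- by move=> _; apply: (@le_lt_trans _ _ 1%E); [rewrite -m1T|exact: ltry].
Qed.

End OpenUnique.

Section PhiContinuous.
Variables (R : realType) (r : nat).
Local Notation n := (sym_dim r).
Local Notation Tn := (n.-tuple R).
Local Notation Mx := (@smx_of_tuple R r).
Local Notation Cx := (@sym_coords R r).
Local Notation V := (R * ('M[R]_r * 'M[R]_r))%type.

Lemma differentiable_fstsnd (U W : normedModType R) (v : U * W) :
  differentiable (fst : U * W -> U) v /\ differentiable (snd : U * W -> W) v.
Proof.
split; apply: linear_differentiable => x; [exact: cvg_fst|exact: cvg_snd].
Qed.

Lemma mxdiff_phi (W : normedModType R) (al : R) (b : W -> R) (X Y : W -> 'M[R]_r) w :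
  0 <= al -> 0 <= b w -> posdef (X w) -> posdef (Y w) ->
  differentiable b w -> mxdiff X w -> mxdiff Y w ->
  mxdiff (fun v => (phi_ab al (b v) (X v) (Y v)).1) w /\
  mxdiff (fun v => (phi_ab al (b v) (X v) (Y v)).2) w.
Proof.
move=> al0 be0 px py db dx dy.
have da : differentiable (fun _ : W => al) w by exact: differentiable_cst.
have d1 : mxdiff (fun _ : W => (1%:M : 'M[R]_r)) w by exact: mxdiff_cst.
by split; rewrite /phi_ab /=;
  (apply: mxdiffM; [apply: mxdiffM => //; apply: mxdiff_inv; [|exact: unitmx_1Dxy]|]);
  apply: mxdiffD => //; apply: mxdiffZ => //; exact: mxdiffM.
Qed.

Lemma mxdiff_proj (v : V) : [/\ differentiable (fun v : V => v.1) v,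
  mxdiff (fun v : V => v.2.1) v & mxdiff (fun v : V => v.2.2) v].
Proof.
have ds : differentiable (fun v : V => v.2) v by exact: (differentiable_fstsnd _).2.
split; first exact: (differentiable_fstsnd _).1.
- move=> i j.
  apply: (differentiable_comp (f := fun v : V => v.2.1) (g := fun x : 'M[R]_r => x i j)).
    by apply: (differentiable_comp ds); exact: (differentiable_fstsnd _).1.
  exact: differentiable_coord.
- move=> i j.
  apply: (differentiable_comp (f := fun v : V => v.2.2) (g := fun x : 'M[R]_r => x i j)).
    by apply: (differentiable_comp ds); exact: (differentiable_fstsnd _).2.
  exact: differentiable_coord.
Qed.

(** Continuity is joint in beta and z: the limit beta -> 0 moves the parameter, while lower
    semicontinuity of image densities moves the point. *)
Lemma Phi_near (al be : R) (z : Tn * Tn) (e : R) : 0 <= al -> 0 <= be -> @DD R r z -> 0 < e ->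
  exists2 de : R, 0 < de & forall be' w, `|be' - be| < de -> box2 z de w ->
    box2 (Phi al be z) e (Phi al be' w).
Proof.
move=> al0 be0 [px py] e0.
pose v0 : V := (be, (Mx z.1, Mx z.2)).
have [db dx dy] := mxdiff_proj v0.
have [m1 m2] := @mxdiff_phi _ al _ _ _ v0 al0 be0 px py db dx dy.
have key (M : V -> 'M[R]_r) : mxdiff M v0 ->
    exists2 de : R, 0 < de & forall be' (w : Tn * Tn), `|be' - be| < de -> box2 z de w ->
    forall i j, `|M (be', (Mx w.1, Mx w.2)) i j - M v0 i j| < e.
  move=> /mxdiffP/differentiable_continuous cM.
  have : nbhs v0 (M @^-1` ball (M v0) e) by apply: cM; exact: nbhsx_ballx.
  move=> /nbhs_ballP[de /= de0 hde]; exists de => // be' w hb [h1 h2] i j.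
  have hv : ball v0 de (be', (Mx w.1, Mx w.2)).
    split=> /=; first by rewrite /ball /= distrC.
    split; split=> [//|k l]; rewrite /ball /= !smx_tupleE distrC.
      exact: h1.
    exact: h2.
  have [_] := hde _ hv => /(_ i j).
  by rewrite /ball /= distrC.
have [d1 d10 h1] := key _ m1; have [d2 d20 h2] := key _ m2.
exists (Num.min d1 d2); first by rewrite lt_min d10.
move=> be' w; rewrite lt_min => /andP[hb1 hb2] hw.
have [m1le m2le] : Num.min d1 d2 <= d1 /\ Num.min d1 d2 <= d2 by rewrite !ge_min !lexx ?orbT.
split=> k; rewrite !tnth_sym_coords.
  by apply: (h1 be' w) => //; exact: box2_le hw.
by apply: (h2 be' w) => //; exact: box2_le hw.
Qed.

End PhiContinuous.

(** * The image of a density under phi *)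

Section LawChange.
Variables (R : realType) (r : nat).
Local Notation n := (sym_dim r).
Local Notation Tn := (n.-tuple R).
Local Notation mu2 := (prod_sf (leb R n) (leb R n)).
Local Notation Mx := (@smx_of_tuple R r).
Local Notation Cx := (@sym_coords R r).
Local Notation DD := (@DD R r).
Local Notation Phi := (@Phi R r).
Implicit Types (K : Tn * Tn -> R) (E : set (Tn * Tn)).

(** Lower semicontinuity. The class contains densities that are continuous on the open domain and
    zero outside, whatever their boundary behaviour, and it is stable under multiplication of a
    nonnegative function by the indicator of an open set. *)
Definition lsc2 K := forall c, open2 [set z | c < K z].

Lemma lsc2_measurable K : lsc2 K -> measurable_fun setT K.
Proof.
move=> hK; apply: (measurability _ (RGenOInfty.measurableE R)) => _ [_ [x ->] <-].
rewrite setTI (_ : _ @^-1` _ = [set z | x < K z]).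
  by apply: open2_measurable; exact: hK.
by apply/seteqP; split => z /=; rewrite in_itv /= andbT.
Qed.

Lemma DD_open2 : open2 DD.
Proof.
move=> z [/DP_open[e e0 he] /DP_open[e' e0' he']].
exists (Num.min e e'); first by rewrite lt_min e0.
by move=> w [h1 h2]; split; [apply: he; apply: box_le h1|apply: he'; apply: box_le h2];
  rewrite ge_min lexx ?orbT.
Qed.

Lemma limn_einf_ge (u : (\bar R)^nat) (l : \bar R) :
  (forall c : R, (c%:E < l)%E -> exists N : nat, forall j : nat, (N <= j)%N -> (c%:E <= u j)%E) ->
  (l <= limn_einf u)%E.
Proof.
move=> h; rewrite limn_einf_lim.
have key (c : R) : (c%:E < l)%E -> (c%:E <= limn (einfs u))%E.
  move=> /h[N hN]; apply: lime_ge; first exact: is_cvg_einfs.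
  exists N => // m /= Nm; apply: le_ereal_inf_tmp => _ [p /= mp <-].
  by apply: hN; exact: leq_trans mp.
case: l h key => [l||] h key; last by rewrite leNye.
- apply/lee_addgt0Pr => e e0; rewrite -leeBlDr // -EFinB; apply: key.
  by rewrite lte_fin ltrBlDr ltrDl.
- rewrite leye_eq; apply/eqP/eqyP => A A0; apply: key; exact: ltry.
Qed.

Lemma Phi_DD al be z : 0 < al -> 0 <= be -> DD z -> DD (Phi al be z).
Proof.
move=> al0 be0 [px py]; have [pu pv] := posdef_phi al0 be0 px py.
by split; rewrite /DP /= sym_coordsK //; case: (pu) => // ; case: (pv).
Qed.

Lemma Phi_invol al be z : 0 < al -> 0 <= be -> DD z -> Phi al be (Phi al be z) = z.
Proof.
move=> al0 be0 [px py]; have [pu pv] := posdef_phi al0 be0 px py.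
have pi := phi_invol al0 be0 px py.
have e1 : Mx (Phi al be z).1 = (phi_ab al be (Mx z.1) (Mx z.2)).1 by rewrite sym_coordsK //; case: pu.
have e2 : Mx (Phi al be z).2 = (phi_ab al be (Mx z.1) (Mx z.2)).2 by rewrite sym_coordsK //; case: pv.
transitivity (Cx (phi_ab al be (Mx (Phi al be z).1) (Mx (Phi al be z).2)).1,
  Cx (phi_ab al be (Mx (Phi al be z).1) (Mx (Phi al be z).2)).2) => //.
by rewrite e1 e2 pi /= !smx_tupleK -surjective_pairing.
Qed.

(** For beta = 1 / (j + 1) the integral does not depend on j, by [cov_pos]. Lower semicontinuity
    bounds the integrand at beta = 0 by the lower limit of those integrands. *)
Lemma phi_fatou (al : R) K : 0 < al -> lsc2 K -> (forall z, 0 <= K z) ->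
  (\int[mu2]_z ((\1_DD z)%:E * (K (Phi al 0 z))%:E) <= \int[mu2]_z ((\1_DD z)%:E * (K z)%:E))%E.
Proof.
move=> al0 lK K0; have mK := lsc2_measurable lK.
have mDD : measurable_fun setT (fun z => (\1_DD z)%:E : \bar R).
  by apply/measurable_EFinP; apply: measurable_indic; exact: measurable_DD.
pose F (j : nat) z := ((\1_DD z)%:E * (K (Phi al j.+1%:R^-1 z))%:E)%E.
have mF j : measurable_fun setT (F j).
  apply: emeasurable_funM => //; apply/measurable_EFinP.
  by apply: (measurableT_comp mK); exact: measurable_Phi.
have F0 j z : setT z -> (0 <= F j z)%E by move=> _; rewrite mule_ge0 // lee_fin.
have := fatou mu2 measurableT mF F0.
have FE j : (\int[mu2]_z F j z = \int[mu2]_z ((\1_DD z)%:E * (K z)%:E))%E.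
  have j0 : 0 < j.+1%:R^-1 :> R by rewrite invr_gt0.
  by apply: (cov_pos al0 j0 (H := fun z => (K z)%:E)) => //; exact/measurable_EFinP.
under [X in (_ <= limn_einf X)%E]eq_fun do rewrite FE.
rewrite (cvg_limn_einf_sup (cvg_cst _)).1; apply: le_trans.
have mK0 : measurable_fun setT (fun z => ((\1_DD z)%:E * (K (Phi al 0 z))%:E)%E).
  apply: emeasurable_funM => //; apply/measurable_EFinP.
  by apply: (measurableT_comp mK); exact: measurable_Phi.
apply: ge0_le_integral => //.
- by move=> z _; rewrite mule_ge0 // lee_fin.
- have -> : (fun z => limn_einf (F^~ z)) = (fun z => - limn_esup (fun j => - F j z))%E.
    by apply/funext => z; rewrite -[LHS]oppeK -limn_esupN.
  have mm : measurable_fun setT (fun z => limn_esup (fun j => - F j z)%E).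
    apply: measurable_fun_limn_esup => j.
    exact: (measurableT_comp (@oppe_measurable R setT) (mF j)).
  exact: (measurableT_comp (@oppe_measurable R setT) mm).
- move=> z _; apply: limn_einf_ge => c; rewrite /F indicE.
  have [/set_mem Dz|_] := boolP (z \in DD); last first.
    by rewrite !mul0e => h; exists 0%N => j _; rewrite mul0e ltW.
  rewrite mul1e lte_fin => /lK[e e0 he].
  have [de de0 hde] := Phi_near (ltW al0) (lexx 0) Dz e0.
  exists (Num.bound de^-1) => j hj; rewrite mul1e lee_fin ltW //; apply: he; apply: hde.
    rewrite subr0 ger0_norm ?invr_ge0 // invf_plt ?posrE //.
    apply: lt_le_trans (archi_boundP _) _; first by rewrite invr_ge0 ltW.
    by rewrite ler_nat; exact: leq_trans hj (leqnSn _).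
  exact: box2_refl.
Qed.

(* For be > 0 this is [cov_pos]. At be = 0, Fatou along be = 1/(j+1) only gives
   inequalities on open sets; they are equalities because the total masses agree. *)
Lemma law_change (al be : R) K : 0 < al -> 0 <= be -> lsc2 K -> (forall z, 0 <= K z) ->
  (forall z, ~ DD z -> K z = 0) -> (\int[mu2]_z (K z)%:E = 1)%E ->
  forall E, measurable E ->
  (\int[mu2]_z ((\1_E (Phi al be z))%:E * (K z)%:E) =
   \int[mu2]_z ((\1_E z)%:E * ((\1_DD z)%:E * (K (Phi al be z))%:E)))%E.
Proof.
move=> al0 be0 lK K0 Kout K1 E mE; have mK := lsc2_measurable lK.
(* The candidate for the image density. Since phi is an involution, K is obtained from [K'] in the
   same way, so each estimate can be used in both directions. *)
pose K' z := \1_DD z * K (Phi al be z).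
have DDK z : K z = \1_DD z * K z.
  rewrite indicE; have [_|/negP h] := boolP (z \in DD); first by rewrite mul1r.
  by rewrite mul0r Kout // => h'; apply: h; rewrite inE.
have K'Phi z : \1_DD z * K' (Phi al be z) = K z.
  rewrite indicE; have [/set_mem h|/negP h] := boolP (z \in DD); last first.
    by rewrite mul0r Kout // => h'; apply: h; rewrite inE.
  by rewrite mul1r /K' Phi_invol // indicE mem_set ?mul1r //; exact: Phi_DD.
have K'0 z : 0 <= K' z by rewrite mulr_ge0.
have mK' : measurable_fun setT K'.
  apply: measurable_funM; first by apply: measurable_indic; exact: measurable_DD.
  by apply: (measurableT_comp mK); exact: measurable_Phi.
have m1E : measurable_fun setT (\1_E : Tn * Tn -> R) by exact: measurable_indic.
have -> : (\int[mu2]_z ((\1_E (Phi al be z))%:E * (K z)%:E) =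
    \int[mu2]_z ((\1_DD z)%:E * ((\1_E (Phi al be z))%:E * (K' (Phi al be z))%:E)))%E.
  by apply: eq_integral => z _; rewrite -!EFinM -(K'Phi z) mulrCA.
under [RHS]eq_integral do rewrite -EFinM -/(K' _).
have DDK' z : \1_DD z * K' z = K' z.
  by rewrite /K' mulrA indicE; case: (_ \in _); rewrite ?mul1r ?mul0r.
move: be0; rewrite le_eqVlt => /predU1P[be0|be0]; last first.
  rewrite (cov_pos al0 be0 (H := fun z => ((\1_E z)%:E * (K' z)%:E)%E)).
  - by apply: eq_integral => z _; rewrite -!EFinM [in LHS]mulrCA DDK'.
  - by apply: emeasurable_funM; apply/measurable_EFinP.
  - by move=> z; rewrite mule_ge0 // lee_fin.
have lK' : lsc2 K'.
  move=> c z /= hc; have [c0|c0] := ltP c 0.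
    by exists 1 => // w _; apply: lt_le_trans c0 _.
  have Dz : DD z.
    apply: contrapT => nz; move: hc; rewrite /K' indicE memNset // mul0r ltNge c0 //.
  have : [set z | c < K z] (Phi al be z).
    by move: hc => /=; rewrite /K' indicE mem_set // mul1r.
  move=> /lK[e e0 he].
  have [de de0 hde] := @Phi_near _ _ al be z e (ltW al0) (eq_ind _ (fun x => 0 <= x) (lexx 0) _ be0) Dz e0.
  have [d2 d20 hd2] := DD_open2 Dz.
  exists (Num.min de d2); first by rewrite lt_min de0.
  move=> w hw /=; rewrite /K' indicE mem_set ?mul1r; last first.
    by apply: hd2; apply: box2_le hw; rewrite ge_min lexx orbT.
  apply: he; apply: hde; first by rewrite subrr normr0.
  by apply: box2_le hw; rewrite ge_min lexx.
(* [phi_fatou] for K bounds the mass of [K'] by that of K, and for [K'] it gives the reverse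
   bound. *)
have K'1 : (\int[mu2]_z (K' z)%:E = 1)%E.
  apply/eqP; rewrite eq_le; apply/andP; split.
    rewrite -K1; have := phi_fatou al0 lK K0; rewrite be0.
    under eq_integral do rewrite -EFinM -/(K' _).
    by under [X in (_ <= X)%E -> _]eq_integral do rewrite -EFinM -DDK.
  rewrite -K1; have := phi_fatou al0 lK' K'0; rewrite be0.
  under eq_integral do rewrite -EFinM K'Phi.
  by under [X in (_ <= X)%E -> _]eq_integral do rewrite -EFinM DDK'.
have eK' : measurable_fun setT (fun z => (K' z)%:E) by exact/measurable_EFinP.
have eK : measurable_fun setT (fun z => (K z)%:E) by exact/measurable_EFinP.
have eK0 z : (0 <= (K z)%:E)%E by rewrite lee_fin.
have eK'0 z : (0 <= (K' z)%:E)%E by rewrite lee_fin.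
pose m2 := dens_measure mu2 eK' eK'0.
pose m1 : {measure set (Tn * Tn)%type -> \bar R} :=
  measure_function_pushforward__canonical__measure_function_Measure
    (dens_measure mu2 eK eK0) (@measurable_Phi R r al be).
have m1E' A : m1 A = (\int[mu2]_z ((\1_DD z)%:E * (\1_A (Phi al be z) * K' (Phi al be z))%:E))%E.
  rewrite /m1 /= /pushforward /=.
  have := dens_measureE mu2 eK eK0 (Phi al be @^-1` A); rewrite /= => ->.
  by apply: eq_integral => z _; rewrite -!EFinM mulrCA K'Phi.
have m2E' A : m2 A = (\int[mu2]_z ((\1_DD z)%:E * (\1_A z * K' z)%:E))%E.
  rewrite /m2 dens_measureE.
  by apply: eq_integral => z _; rewrite -!EFinM [in RHS]mulrCA DDK'.
have main : m1 E = m2 E.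
  apply: (@open2_measure_unique R n m1 m2) => //.
  (* For open O the product of the indicator of O with [K'] is lower semicontinuous, so [phi_fatou]
     gives m1 O <= m2 O. *)
  - move=> O oO; rewrite m1E' m2E' -be0; apply: (@phi_fatou al (fun z => \1_O z * K' z)) => //.
      move=> c z /= hc; have [c0|c0] := ltP c 0.
        by exists 1 => // w _ /=; apply: lt_le_trans c0 _; rewrite mulr_ge0.
      have Oz : O z.
        by apply: contrapT => nz; move: hc; rewrite indicE memNset // mul0r ltNge c0.
      have [e e0 he] := oO z Oz.
      have : [set z | c < K' z] z by move: hc => /=; rewrite indicE mem_set // mul1r.
      move=> /lK'[e' e0' he'].
      exists (Num.min e e'); first by rewrite lt_min e0.
      move=> w hw /=; rewrite indicE mem_set ?mul1r; last first.
        by apply: he; apply: box2_le hw; rewrite ge_min lexx.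
      by apply: he'; apply: box2_le hw; rewrite ge_min lexx orbT.
    by move=> z; rewrite mulr_ge0.
rewrite m1E' m2E' in main.
transitivity (\int[mu2]_z ((\1_DD z)%:E * (\1_E (Phi al be z) * K' (Phi al be z))%:E))%E.
  by apply: eq_integral => z _; rewrite EFinM.
by rewrite main; apply: eq_integral => z _; rewrite -!EFinM [in LHS]mulrCA DDK'.
Qed.

End LawChange.

(** * Positive definiteness from integrability *)

Section Blowup.
Variables (R : realType) (n : nat).
Local Notation Tn := (n.-tuple R).
Local Notation mu := (leb R n).

(* The sets L^j K are disjoint and each has [h]-mass at least [kap * mu K]. *)
Lemma blowup (L L' : Tn -> Tn) (chi sig kap : R) (h : Tn -> R) (K : set Tn) (psi : Tn -> R) :
  measurable_fun setT L -> measurable_fun setT L' -> cancel L L' -> cancel L' L ->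
  0 < chi -> 0 < sig -> 0 < kap ->
  (forall f : Tn -> \bar R, measurable_fun setT f -> (forall t, (0 <= f t)%E) ->
     (\int[mu]_t f t = chi%:E * \int[mu]_t f (L t))%E) ->
  measurable K -> (0 < mu K)%E ->
  (forall s j, K s -> psi (iter j L s) = 4 ^+ j * psi s) ->
  (forall s, K s -> 1 < psi s < 2) ->
  measurable_fun setT h -> (forall t, 0 <= h t) ->
  (forall s j, K s -> kap * sig ^+ j <= h (iter j L s)) ->
  1 <= chi * sig -> (\int[mu]_t (h t)%:E = +oo)%E.
Proof.
move=> mL mL' LK L'K chi0 sig0 kap0 hchi mK K0 psiL psiK mh h0 hK cs1.
have eh0 t : (0 <= (h t)%:E)%E by rewrite lee_fin.
have meh : measurable_fun setT (fun t => (h t)%:E) by exact/measurable_EFinP.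
have miter (M : Tn -> Tn) j : measurable_fun setT M -> measurable_fun setT (iter j M).
  move=> mM; elim: j => [|j ih]; first exact: measurable_id.
  exact: (measurableT_comp mM ih).
have iterK j : cancel (iter j L) (iter j L').
  by elim: j => // j ih t; rewrite iterSr /= LK ih.
have hchij j (f : Tn -> \bar R) : measurable_fun setT f -> (forall t, (0 <= f t)%E) ->
    (\int[mu]_t f t = (chi ^+ j)%:E * \int[mu]_t f (iter j L t))%E.
  elim: j f => [|j ih] f mf f0; first by rewrite mul1e.
  rewrite hchi // (ih (fun t => f (L t))) //; last exact: (measurableT_comp mf).
  by rewrite muleA -EFinM -exprS.
pose S j := iter j L' @^-1` K.
have mS j : measurable (S j) by apply: measurable_preimageT => //; exact: miter.
have iterK' j : cancel (iter j L') (iter j L).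
  by elim: j => // j ih t; rewrite iterSr /= L'K ih.
(* On the j-th set psi takes values between 4 ^ j and 2 * 4 ^ j, and these intervals are
   disjoint. *)
have tS : trivIset setT S.
  apply/trivIsetP => i j _ _ ij; apply/seteqP; split => // t [Si Sj]; exfalso.
  have ei : psi t = 4 ^+ i * psi (iter i L' t) by rewrite -psiL // iterK'.
  have ej : psi t = 4 ^+ j * psi (iter j L' t) by rewrite -psiL // iterK'.
  have /andP[a1 a2] := psiK _ Si; have /andP[b1 b2] := psiK _ Sj.
  wlog lij : i j ij ei ej Si Sj a1 a2 b1 b2 / (i < j)%N.
    by move=> W; case: (ltngtP i j) ij => // h' _; [apply: (W i j)|apply: (W j i)] => //;
      rewrite ?ltn_eqF ?gtn_eqF.
  move: ei ej => -> /eqP; rewrite -{1}(subnKC lij) exprD exprS.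
  have p4 m : 1 <= (4 : R) ^+ m by apply: exprn_ege1; rewrite ler1n.
  have := p4 i; have := p4 (j - i.+1)%N; move: (4 ^+ i) (4 ^+ (j - i.+1)) => x y y1 x1.
  set p := psi _ in a1 a2 *; set q := psi _ in b1 b2 *.
  apply/negP; rewrite lt_eqF //.
  have : x * p < x * 2 by rewrite ltr_pM2l //; lra.
  have yq : 1 <= y * q by rewrite -[1]mulr1 ler_pM // ltW.
  have : x * 2 <= 4 * x * y * q by rewrite -mulrA; nra.
  by lra.
apply/eqP; rewrite -leye_eq leNgt; apply/negP => fin.
pose m := dens_measure mu meh eh0.
have [k [k0 kE]] : exists k : R, 0 < k /\ forall j, (k%:E <= m (S j))%E.
  have [l [l0 lK]] : exists l : R, 0 < l /\ (l%:E <= mu K)%E.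
    case: (mu K) K0 => [l||//] l0; first by exists l; split; rewrite -?lte_fin.
    by exists 1; rewrite ltr01 leey.
  exists (kap * l); split=> [|j]; first exact: mulr_gt0.
  rewrite /m dens_measureE (hchij j); last 2 first.
  - by apply: emeasurable_funM => //; apply/measurable_EFinP; apply: measurable_indic.
  - by move=> t; rewrite mule_ge0 // lee_fin.
  have mK1 : measurable_fun setT (fun t => (\1_K t)%:E : \bar R).
    by apply/measurable_EFinP; apply: measurable_indic.
  have le1 : ((kap * sig ^+ j)%:E * mu K <= \int[mu]_t ((\1_(S j) (iter j L t))%:E * (h (iter j L t))%:E))%E.
    have -> : mu K = (\int[mu]_t (\1_K t)%:E)%E by rewrite integral_indic // setIT.
    rewrite -ge0_integralZl //; last first.
      by rewrite lee_fin mulr_ge0 ?exprn_ge0 // ltW.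
    apply: ge0_le_integral => //.
    - by move=> t _; rewrite mule_ge0 // lee_fin // mulr_ge0 ?exprn_ge0 // ltW.
    - by apply: emeasurable_funM.
    - apply: emeasurable_funM; apply/measurable_EFinP.
        apply: (measurableT_comp (measurable_indic _)) => //; exact: miter.
      by apply: (measurableT_comp mh); exact: miter.
    - move=> t _; have -> : \1_(S j) (iter j L t) = \1_K t :> R.
        have e : S j (iter j L t) = K t by rewrite /S /preimage /= iterK.
        by rewrite !indicE; congr (_%:R); congr nat_of_bool; apply/idP/idP => /set_mem h';
          apply: mem_set; move: h'; rewrite e.
      rewrite indicE; have [/set_mem Kt|_] := boolP (t \in K); last by rewrite mule0 mul0e.
      by rewrite mule1 mul1e lee_fin; exact: hK.
  have cj0 : (0 <= (chi ^+ j)%:E)%E by rewrite lee_fin exprn_ge0 // ltW.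
  apply: (le_trans _ (lee_wpmul2l cj0 le1)).
  rewrite muleA -EFinM; apply: (@le_trans _ _ (kap%:E * mu K)%E).
    by rewrite EFinM lee_wpmul2l // lee_fin ltW.
  apply: lee_wpmul2r => //; rewrite lee_fin mulrCA -exprMn; apply: ler_peMr; first exact: ltW.
  exact: exprn_ege1.
have fin1 : m setT \is a fin_num.
  by rewrite ge0_fin_numE //; exact: fin.
have bound N : ((N%:R * k)%:E <= m setT)%E.
  apply: (@le_trans _ _ (m (\big[setU/set0]_(i < N) S i))).
    rewrite measure_bigsetU //.
    apply: (@le_trans _ _ (\sum_(i < N) k%:E)%E); last first.
      apply: lee_sum => i _; exact: kE.
    by rewrite sumEFin lee_fin sumr_const card_ord mulr_natl.
  by apply: le_measure; rewrite ?inE //; exact: bigsetU_measurable.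
move: bound; rewrite -(fineK fin1) => bound.
have := bound (Num.bound (fine (m setT) / k)); rewrite lee_fin leNgt => /negP; apply.
rewrite -ltr_pdivrMr //; apply: archi_boundP; apply: divr_ge0; last exact: ltW.
exact: fine_ge0.
Qed.

End Blowup.

Section KernelTuple.
Variables (R : realType) (r : nat).
Local Notation n := (sym_dim r).
Local Notation Tn := (n.-tuple R).
Local Notation Mx := (@smx_of_tuple R r).
Local Notation DP := (@DP R r).

(** The MGIG kernel on the cone with c = lambda - (r + 1) / 2, as a single exponential to be
    compared with the logarithms of the densities. *)
Definition kexp (c : R) (A B x : 'M[R]_r) : R :=
  expR (c * ln (\det x) - \tr (A *m x) - \tr (B *m invmx x)).

Definition kfun (c : R) (A B : 'M[R]_r) (t : Tn) : R := \1_DP t * kexp c A B (Mx t).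

Lemma kfun_ge0 c A B t : 0 <= kfun c A B t.
Proof. by rewrite mulr_ge0 // expR_ge0. Qed.

Lemma measurable_mxtrace d (T : measurableType d) (M : T -> 'M[R]_r) : mxmeas M ->
  measurable_fun setT (fun z => \tr (M z)).
Proof. by move=> mM; rewrite /mxtrace; apply: measurable_sum => i. Qed.

Lemma measurable_kfun c A B : measurable_fun setT (kfun c A B).
Proof.
apply: measurable_funM; first by apply: measurable_indic; exact: measurable_DP.
have mM : mxmeas (fun t : Tn => Mx t) by apply: mxmeas_smx; exact: measurable_id.
apply: (measurableT_comp (@measurable_expR R)); apply: measurable_funB.
  apply: measurable_funB.
    apply: measurable_funM => //.
    by apply: (measurableT_comp (@measurable_ln R)); exact: measurable_det.
  by apply: measurable_mxtrace; apply: mxmeasM => //; exact: mxmeas_cst.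
apply: measurable_mxtrace; apply: mxmeasM; first exact: mxmeas_cst.
exact: mxmeas_inv.
Qed.

Lemma mgig_kernelE lam A B t :
  mgig_kernel lam A B (Mx t) = kfun (lam - (r%:R + 1) / 2) A B t.
Proof.
rewrite /mgig_kernel /kfun indicE; case: asboolP => [pt|npt]; last first.
  by rewrite memNset // mul0r.
rewrite mem_set // mul1r /kexp /powR gt_eqF ?det_gt0 // -expRD; congr expR.
by rewrite -!addrA.
Qed.

End KernelTuple.

Section Dilation.
Variables (R : realType) (r : nat) (v : 'cV[R]_r).
Hypothesis v1 : v^T *m v = 1%:M.
Local Notation W := (v *m v^T).
Implicit Types (y z A B : 'M[R]_r) (l m : R).

(** For the unit vector v, multiplication by l along v and the identity on its orthogonal
    complement. *)
Definition dil l : 'M[R]_r := 1%:M + (l - 1) *: W.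

Lemma dil_sym l : (dil l)^T = dil l.
Proof. by rewrite /dil linearD /= linearZ /= trmx1 trmx_mul trmxK. Qed.

Lemma dilM l m : dil l *m dil m = dil (l * m).
Proof.
have WW : W *m W = W by rewrite mulmxA -(mulmxA v) v1 mulmx1.
rewrite /dil mulmxDl !mulmxDr !mul1mx mulmx1 -scalemxAl -scalemxAr WW.
by apply/matrixP => i j; rewrite !mxE; ring.
Qed.

Lemma dil1 : dil 1 = 1%:M.
Proof. by rewrite /dil subrr scale0r addr0. Qed.

Lemma dilV l : l != 0 -> dil l *m dil l^-1 = 1%:M.
Proof. by move=> l0; rewrite dilM mulfV // dil1. Qed.

Lemma dil_unit l : l != 0 -> dil l \in unitmx.
Proof. by move=> /dilV/mulmx1_unit[]. Qed.

Definition dact l y := dil l *m y *m dil l.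

Lemma dactM l m y : dact l (dact m y) = dact (l * m) y.
Proof. by rewrite /dact !mulmxA dilM -mulmxA dilM (mulrC m). Qed.

Lemma dact1 y : dact 1 y = y.
Proof. by rewrite /dact dil1 mul1mx mulmx1. Qed.

Lemma posdef_dact l y : l != 0 -> posdef y -> posdef (dact l y).
Proof. by move=> l0 py; apply: posdef_conj => //; [exact: dil_sym|exact: dil_unit]. Qed.

Lemma dact_inv l y : l != 0 -> y \in unitmx -> invmx (dact l y) = dact l^-1 (invmx y).
Proof.
move=> l0 uy; apply: invmx_uniq.
rewrite /dact !mulmxA -(mulmxA _ (dil l)) dilV // mulmx1 -(mulmxA _ y) mulmxV // mulmx1.
exact: dilV.
Qed.

Lemma qf_dact l y : qf (dact l y) v = l ^+ 2 * qf y v.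
Proof.
have dv : dil l *m v = l *: v.
  rewrite /dil mulmxDl mul1mx -scalemxAl -mulmxA v1 mulmx1.
  by rewrite -{1}[v]scale1r -scalerDl addrC subrK.
rewrite -[X in dact X]/l /dact -{2}(dil_sym l) qf_congr dil_sym dv.
have -> : qf y (l *: v) = l ^+ 2 * qf y v.
  rewrite /qf [(l *: v)^T]linearZ /= -scalemxAr -!scalemxAl mxE [X in _ * X]mxE.
  by rewrite mulrA -expr2.
by [].
Qed.

Lemma tr_dact A l y : \tr (A *m dact l y) =
  \tr (A *m y) + (l - 1) * (qf (y *m A) v + qf (A *m y) v) + (l - 1) ^+ 2 * (qf y v * qf A v).
Proof.
have -> : dact l y = y + (l - 1) *: (W *m y + y *m W) + (l - 1) ^+ 2 *: (W *m y *m W).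
  rewrite /dact /dil mulmxDl mul1mx -scalemxAl mulmxDr mulmx1 -scalemxAr mulmxDl -scalemxAl.
  move: (W *m y *m W) (W *m y) (y *m W) => X Y Z.
  by apply/matrixP => i j; rewrite !mxE; ring.
rewrite !mulmxDr !mxtraceD -!scalemxAr !mxtraceZ mulmxDr mxtraceD.
congr (_ + _ * (_ + _) + _ * _).
- by rewrite mxtrace_mulC -(mulmxA W) tr_rank1.
- by rewrite (mulmxA A) mxtrace_mulC tr_rank1.
- by rewrite mulmx_rank1 -scalemxAr mxtraceZ mxtrace_mulC tr_rank1.
Qed.

(** A bound uniform in 0 < l <= 1: the terms of [tr_dact] are estimated by (l - 1) p <= p ^ 2 + 1
    and (l - 1) ^ 2 t <= t ^ 2 + 1, which explains the squares and the 2. *)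
Definition dbound B z : R :=
  \tr (B *m z) + (qf (z *m B) v + qf (B *m z) v) ^+ 2 + (qf z v * qf B v) ^+ 2 + 2.

Lemma tr_dact_contract B l z : 0 < l <= 1 -> \tr (B *m dact l z) <= dbound B z.
Proof.
move=> /andP[l0 l1]; rewrite tr_dact /dbound; set p := _ + qf _ _; set t := qf _ _ * _.
have : (l - 1) * p <= p ^+ 2 + 1.
  have l2 : (l - 1) ^+ 2 <= 1 by rewrite expr2; nra.
  have := sqr_ge0 (p - (l - 1) / 2); rewrite -subr_ge0.
  have -> : (p - (l - 1) / 2) ^+ 2 = p ^+ 2 - (l - 1) * p + (l - 1) ^+ 2 / 4 by field.
  lra.
have : (l - 1) ^+ 2 * t <= t ^+ 2 + 1.
  have : (l - 1) ^+ 2 <= 1 by rewrite expr2; nra.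
  have : 0 <= (l - 1) ^+ 2 by exact: sqr_ge0.
  move: ((l - 1) ^+ 2) => s s0 s1; have := sqr_ge0 (t - s / 2); have -> : (t - s / 2) ^+ 2 = t ^+ 2 - s * t + s * s / 4 by field.
  nra.
lra.
Qed.

(** The coefficient of (l - 1) ^ 2 has the sign of v^T A v. The condition on [bil] says v^T y A v <=
    (v^T A v)(v^T y v), so the coefficient of l - 1 is nonpositive as well. *)
Lemma tr_dact_expand A l y : A^T = A -> y^T = y -> 1 <= l -> 0 <= qf y v -> qf A v <= 0 ->
  bil y v (A *m v - qf A v *: v) <= 0 -> \tr (A *m dact l y) <= \tr (A *m y).
Proof.
move=> sA sy l1 y0 A0; rewrite /bil mulmxBr -scalemxAr mxE [X in _ + X]mxE [X in _ - X]mxE.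
rewrite -!/(qf _ _) => h.
have e1 : (v^T *m y *m (A *m v)) 0 0 = qf (y *m A) v by rewrite /qf !mulmxA.
have e2 : qf (A *m y) v = qf (y *m A) v.
  rewrite /qf; transitivity ((v^T *m (A *m y) *m v)^T 0 0); first by rewrite [RHS]mxE.
  by rewrite !trmx_mul trmxK sA sy !mulmxA.
rewrite e1 in h; rewrite tr_dact e2.
have Ay : qf A v * qf y v <= 0 by exact: mulr_le0_ge0.
have : (l - 1) * (qf (y *m A) v + qf (y *m A) v) <= 0.
  apply: mulr_ge0_le0; first by rewrite subr_ge0.
  lra.
have : (l - 1) ^+ 2 * (qf y v * qf A v) <= 0.
  by apply: mulr_ge0_le0; [exact: sqr_ge0|rewrite mulrC].
lra.
Qed.

End Dilation.

Section NearMx.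
Variables (R : realType) (r : nat).
Implicit Types (x y z A B : 'M[R]_r).

Definition mxnear (y0 : 'M[R]_r) (Q : 'M[R]_r -> Prop) := exists2 e : R, 0 < e &
  forall y, (forall i j, `|y i j - y0 i j| < e) -> Q y.

Lemma mxnear_nbhs y0 (Q : 'M[R]_r -> Prop) : nbhs y0 Q -> mxnear y0 Q.
Proof.
move=> /nbhs_ballP[e /= e0 h]; exists e => // y hy; apply: h; split => // i j.
by rewrite /ball /= distrC.
Qed.

Lemma mxnear_posdef y0 : posdef y0 -> mxnear y0 (fun y => y^T = y -> posdef y).
Proof.
by move=> /posdef_open[e e0 h]; exists e => // y hy sy; exact: h.
Qed.

Lemma mxnear_and y0 (P Q : 'M[R]_r -> Prop) : mxnear y0 P -> mxnear y0 Q ->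
  mxnear y0 (fun y => P y /\ Q y).
Proof.
move=> [e e0 h] [e' e0' h']; exists (Num.min e e'); first by rewrite lt_min e0.
by move=> y hy; split; [apply: h|apply: h'] => i j; have := hy i j; rewrite lt_min => /andP[].
Qed.

Lemma mxnear_box y0 (Q : 'M[R]_r -> Prop) : mxnear y0 Q -> exists2 e : R, 0 < e &
  forall t, box (sym_coords y0) e t -> y0^T = y0 -> Q (smx_of_tuple t).
Proof.
move=> [e e0 h]; exists e => // t ht sy0; apply: h => i j.
by have := ht (sidx i j); rewrite -!smx_tupleE sym_coordsK.
Qed.

Lemma near_lt (phi : 'M[R]_r -> R) y0 C : differentiable phi y0 -> phi y0 < C ->
  \forall y \near y0, phi y < C.
Proof.
move=> /differentiable_continuous cphi h.
by apply: (cphi [set u | u < C]); exact: lt_nbhsl.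
Qed.

End NearMx.

Section PosDefCoef.
Variables (R : realType) (r : nat).
Local Notation n := (sym_dim r).
Local Notation Tn := (n.-tuple R).
Local Notation Mx := (@smx_of_tuple R r).
Local Notation Cx := (@sym_coords R r).
Implicit Types (x y z A B : 'M[R]_r) (v : 'cV[R]_r).

Lemma differentiable_qf v (M : 'M[R]_r -> 'M[R]_r) y0 : mxdiff M y0 ->
  differentiable (fun y => qf (M y) v) y0.
Proof.
move=> dM; have : mxdiff (fun y => v^T *m M y *m v) y0.
  by apply: mxdiffM; [apply: mxdiffM => //|]; exact: mxdiff_cst.
exact.
Qed.

Lemma differentiable_mxtrace (M : 'M[R]_r -> 'M[R]_r) y0 : mxdiff M y0 ->
  differentiable (fun y => \tr (M y)) y0.
Proof. by move=> dM; apply: differentiable_bigsum => i; exact: dM. Qed.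

(** Collects what the dilation estimates need uniformly over a neighbourhood; the window from 1 to 2
    is the one required by [blowup]. *)
Definition expand_ok v (a b : 'M[R]_r) (c Ca Cb Cd : R) y :=
  [/\ 1 < qf y v < 2, bil y v (a *m v - qf a v *: v) <= 0, \tr (a *m y) <= Ca,
      dbound v b (invmx y) <= Cb & `|c * ln (\det y)| <= Cd].

(* If [qf a v <= 0], then \tr (a *m x) stays bounded along the dilates in direction [v] of
   these points; the condition on [bil] controls the cross term. *)
Lemma expand_near v (a b : 'M[R]_r) c : v^T *m v = 1%:M -> a^T = a ->
  exists y0 Ca Cb Cd, posdef y0 /\ (\forall y \near y0, expand_ok v a b c Ca Cb Cd y).
Proof.
move=> v1 sa.
(* The component of a v orthogonal to v. *)
have [q qE] : exists q, q = a *m v - qf a v *: v by eexists.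
have vq : v^T *m q = 0.
  rewrite qE mulmxBr -scalemxAr v1 mulmxA [v^T *m a *m v]mx11_scalar -/(qf a v).
  by rewrite scalemx1 subrr.
have qv : q^T *m v = 0 by rewrite -[LHS]trmxK trmx_mul trmxK vq trmx0.
have [N NE] : exists N, N = v *m q^T + q *m v^T by eexists.
have sN : N^T = N by rewrite NE linearD /= !trmx_mul !trmxK addrC.
have [e e0 he] := posdef_open (posdef1 R r).
pose M := 1 + \sum_i \sum_j `|N i j|.
have M1 : 1 <= M by rewrite lerDl; do 2![apply: sumr_ge0 => ? _].
(* Subtracting a small multiple of N gives v^T y1 q = - (e / 2 / M) |q|^2 and leaves v^T y1 v = 1;
   the factor keeps the entries of the perturbation below e. *)
pose y1 := 1%:M - (e / 2 / M) *: N.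
have py1 : posdef y1.
  apply: he; first by rewrite /y1 linearB /= linearZ /= trmx1 sN.
  have M0 : 0 < M by exact: lt_le_trans M1.
  move=> i j; have -> : y1 i j - 1%:M i j = - (e / 2 / M * N i j).
    have E (k : R) A B : (A - k *: B) i j - A i j = - (k * B i j) by rewrite !mxE; ring.
    exact: E.
  rewrite normrN normrM ger0_norm; last by rewrite !divr_ge0 // ltW.
  have : `|N i j| <= M.
    apply: (@le_trans _ _ (\sum_k \sum_l `|N k l|)); last by rewrite /M lerDr.
    rewrite (bigD1 i) //= (bigD1 j) //= -addrA lerDl addr_ge0 //; first exact: sumr_ge0.
    by do 2![apply: sumr_ge0 => ? _].
  move=> h; rewrite mulrAC ltr_pdivrMr; last exact: lt_le_trans M1.
  by nra.
(* The factor 3 / 2 puts v^T y0 v in the middle of the window from 1 to 2. *)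
have [y0 y0E] : exists y, y = (3 / 2) *: y1 by eexists.
have py0 : posdef y0 by rewrite y0E; apply: posdefZ => //; lra.
have uy0 := posdef_unit py0.
have q0 : qf y0 v = 3 / 2.
  have Nv : qf N v = 0.
    rewrite /qf NE mulmxDr mulmxDl !mulmxA vq !mul0mx addr0 -[_ *m _ *m v]mulmxA qv.
    by rewrite mulmx0 mxE.
  by rewrite y0E qfZ qfB qfZ Nv mulr0 subr0 /qf mulmx1 v1 mxE eqxx mulr1.
have did : mxdiff (id : 'M[R]_r -> 'M[R]_r) y0 by exact: mxdiff_id.
have dinv : mxdiff (fun y : 'M[R]_r => invmx y) y0 by apply: mxdiff_inv.
have dcst (A : 'M[R]_r) : mxdiff (fun _ : 'M[R]_r => A) y0 by exact: mxdiff_cst.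
exists y0, (\tr (a *m y0) + 1), (dbound v b (invmx y0) + 1), (`|c * ln (\det y0)| + 1).
split=> //.
have n1 : \forall y \near y0, qf y v < 2.
  by apply: near_lt; [exact: differentiable_qf|rewrite q0; lra].
have n2 : \forall y \near y0, - qf y v < - 1.
  apply: near_lt; last by rewrite q0; lra.
  by apply: differentiableN; exact: differentiable_qf.
have n3 : \forall y \near y0, bil y v q <= 0.
  (* For q = 0 the form vanishes identically; otherwise it is strictly negative at y0 and remains so
     nearby. *)
  have [qz|qn0] := eqVneq q 0.
    apply: (@filterS _ (nbhs y0) _ setT) => [y _|]; last exact: filterT.
    by rewrite /bil qz mulmx0 mxE.
  have : \forall y \near y0, bil y v q < 0.
    apply: near_lt.
      have : mxdiff (fun y : 'M[R]_r => v^T *m y *m q) y0.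
        by apply: mxdiffM; [apply: mxdiffM => //|]; exact: mxdiff_cst.
      exact.
    have := qf1_gt0 qn0; rewrite /qf mulmx1 => qq.
    rewrite /bil y0E /y1 -scalemxAr -scalemxAl mulmxBr mulmx1 mulmxBl vq sub0r.
    rewrite -scalemxAr -scalemxAl NE mulmxDr mulmxDl !mulmxA v1 mul1mx.
    rewrite vq mul0mx mul0mx addr0 !mxE.
    rewrite mxE in qq.
    have : 0 < e / 2 / M by rewrite !divr_gt0 //; apply: lt_le_trans M1.
    by move: qq; move: (\sum_j _) (e / 2 / M) => s u; nra.
  by apply: filterS => y; exact: ltW.
have n4 : \forall y \near y0, \tr (a *m y) < \tr (a *m y0) + 1.
  apply: near_lt; last by rewrite ltrDl.
  by apply: differentiable_mxtrace; exact: mxdiffM.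
have n5 : \forall y \near y0, dbound v b (invmx y) < dbound v b (invmx y0) + 1.
  apply: near_lt; last by rewrite ltrDl.
  have dsq (f : 'M[R]_r -> R) : differentiable f y0 -> differentiable (fun y => f y ^+ 2) y0.
    by move=> df; under eq_fun do rewrite expr2; exact: differentiableM.
  rewrite /dbound; apply: differentiableD; last exact: differentiable_cst.
  apply: differentiableD; first apply: differentiableD.
  - by apply: differentiable_mxtrace; exact: mxdiffM.
  - by apply: dsq; apply: differentiableD; apply: differentiable_qf; exact: mxdiffM.
  - apply: dsq; apply: differentiableM; last exact: differentiable_cst.
    exact: differentiable_qf.
have n6 : \forall y \near y0, `|c * ln (\det y)| < `|c * ln (\det y0)| + 1.
  have cc : {for y0, continuous (fun y : 'M[R]_r => c * ln (\det y))}.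
    apply: differentiable_continuous; apply: differentiableM; first exact: differentiable_cst.
    apply: (differentiable_comp (differentiable_det did)).
    by apply/derivable1_diffP; apply: ex_derive; exact: is_derive1_ln (det_gt0 py0).
  have cn := continuous_comp cc (@norm_continuous _ _ _).
  apply: (cn [set u | u < `|c * ln (\det y0)| + 1]); apply: lt_nbhsl.
  by rewrite /= ltrDl.
near=> y; split.
- by apply/andP; split; [rewrite -ltrN2; near: y|near: y].
- by rewrite -qE; near: y.
- by apply: ltW; near: y.
- by apply: ltW; near: y.
- by apply: ltW; near: y.
Unshelve. all: by end_near.
Qed.

End PosDefCoef.

Section PosDefCoefTheorem.
Variables (R : realType) (r : nat).
Local Notation n := (sym_dim r).
Local Notation Tn := (n.-tuple R).
Local Notation Mx := (@smx_of_tuple R r).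
Local Notation Cx := (@sym_coords R r).
Local Notation mu := (leb R n).
Implicit Types (x y z A B : 'M[R]_r) (v : 'cV[R]_r).

Section Direction.
Variable v : 'cV[R]_r.
Hypothesis v1 : v^T *m v = 1%:M.

Definition tdact l (t : Tn) : Tn := Cx (dact v l (Mx t)).

Lemma smx_tdact l t : Mx (tdact l t) = dact v l (Mx t).
Proof. by rewrite sym_coordsK // /dact !trmx_mul dil_sym smx_tuple_sym mulmxA. Qed.

Lemma measurable_tdact l : measurable_fun setT (tdact l).
Proof.
apply: measurable_sym_coords; apply: mxmeasM; last exact: mxmeas_cst.
apply: mxmeasM; first exact: mxmeas_cst.
by apply: mxmeas_smx; exact: measurable_id.
Qed.

Lemma tdactK l : l != 0 -> cancel (tdact l) (tdact l^-1).
Proof.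
by move=> l0 t; rewrite /tdact smx_tdact dactM // mulVf // dact1 smx_tupleK.
Qed.

Lemma tdactD l : {morph tdact l : s t / tadd s t}.
Proof.
move=> s t; rewrite -[RHS]smx_tupleK smx_tadd !smx_tdact {1}/tdact smx_tadd.
by rewrite /dact (mulmxDr (dil v l)) mulmxDl.
Qed.

Lemma smx_iter_tdact l j t : Mx (iter j (tdact l) t) = dact v (l ^+ j) (Mx t).
Proof.
elim: j => [|j ih]; first by rewrite dact1.
by rewrite /= smx_tdact ih dactM // -exprS.
Qed.

Lemma det_dact l y : \det (dact v l y) = \det (dil v l) ^+ 2 * \det y.
Proof. by rewrite /dact !det_mulmx; ring. Qed.

Lemma det_dilX l j : \det (dil v (l ^+ j)) = \det (dil v l) ^+ j.
Proof.
elim: j => [|j ih]; first by rewrite dil1 det1.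
by rewrite !exprS -dilM // det_mulmx ih.
Qed.

Lemma ln_det_iter l j y : l != 0 -> posdef y ->
  ln (\det (dact v (l ^+ j) y)) = j%:R * ln (\det (dil v l) ^+ 2) + ln (\det y).
Proof.
move=> l0 py; have d0 : \det (dil v l) != 0 by rewrite -unitfE -unitmxE; exact: dil_unit.
have d2 : 0 < \det (dil v l) ^+ 2 by rewrite lt_neqAle sqr_ge0 eq_sym sqrf_eq0 d0.
have dj := exprn_gt0 j d2; have dy := det_gt0 py.
by rewrite det_dact det_dilX exprAC lnM // lnXn // mulr_natl.
Qed.

End Direction.

(** Dilating by 2 along v multiplies Lebesgue measure times det ^ c by the constant [ch^-1 * sig].
    If this is at least 1, the dilates have infinite total mass for the kernel in which a multiplies
    x. Otherwise the inverse dilations do, for the kernel in which a multiplies x^-1. *)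
Lemma not_posdef_blowup v al (a b : 'M[R]_r) c : v^T *m v = 1%:M -> 0 < al ->
  a^T = a -> b^T = b -> qf a v <= 0 ->
  (\int[mu]_t (kfun c (al *: a) b t)%:E = +oo)%E \/
  (\int[mu]_t (kfun c (al *: b) a t)%:E = +oo)%E.
Proof.
move=> v1 al0 sa sb av0.
have [y0 [Ca [Cb [Cd [py0 nQ]]]]] := expand_near b c v1 sa.
have pw0 := posdef_inv py0.
pose Q1 y := (y^T = y -> posdef y) /\ expand_ok v a b c Ca Cb Cd y.
have [e1 e10 box1] : exists2 e : R, 0 < e & forall t, box (Cx y0) e t -> y0^T = y0 -> Q1 (Mx t).
  by apply: mxnear_box; apply: mxnear_and; [exact: mxnear_posdef|exact: mxnear_nbhs].
pose Q2 w := (w^T = w -> posdef w) /\ expand_ok v a b c Ca Cb Cd (invmx w).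
have [e2 e20 box2] : exists2 e : R, 0 < e &
    forall t, box (Cx (invmx y0)) e t -> (invmx y0)^T = invmx y0 -> Q2 (Mx t).
  apply: mxnear_box; apply: mxnear_and; first exact: mxnear_posdef.
  apply: mxnear_nbhs.
  have ci : {for invmx y0, continuous (fun w : 'M[R]_r => invmx w)}.
    apply: differentiable_continuous; apply: mxdiffP; apply: mxdiff_inv.
      exact: mxdiff_id.
    exact: posdef_unit.
  by apply: (ci (expand_ok v a b c Ca Cb Cd)); rewrite invmxK.
have {}box1 t : box (Cx y0) e1 t -> posdef (Mx t) /\ expand_ok v a b c Ca Cb Cd (Mx t).
  move=> /box1/(_ (posdef_sym py0))[h1 h2]; split=> //.
  by apply: h1; exact: smx_tuple_sym.
have {}box2 t : box (Cx (invmx y0)) e2 t ->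
    posdef (Mx t) /\ expand_ok v a b c Ca Cb Cd (invmx (Mx t)).
  move=> /box2/(_ (posdef_sym pw0))[h1 h2]; split=> //.
  by apply: h1; exact: smx_tuple_sym.
have two0 : (2 : R) != 0 by rewrite pnatr_eq0.
have half0 : (2^-1 : R) != 0 by rewrite invr_eq0.
have halfK : cancel (tdact v 2^-1) (tdact v 2) by have := tdactK v1 half0; rewrite invrK.
have [ch ch0 chE] := leb_linear (measurable_tdact v 2) (measurable_tdact v 2^-1)
  (tdactK v1 two0) halfK (tdactD v 2).
pose d2 := \det (dil v 2) ^+ 2.
have d20 : 0 < d2.
  rewrite lt_neqAle sqr_ge0 eq_sym sqrf_eq0 andbT -unitfE -unitmxE; exact: dil_unit.
have d2V : \det (dil v 2^-1) ^+ 2 = d2^-1.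
  rewrite -exprVn; congr (_ ^+ 2); apply: (@mulfI _ (\det (dil v 2))).
    by rewrite -unitfE -unitmxE; exact: dil_unit.
  rewrite -det_mulmx dilV // det1 mulfV //.
  by rewrite -unitfE -unitmxE; exact: dil_unit.
(* The factor by which det ^ c grows under one dilation by 2. *)
pose sig := expR (c * ln d2).
have sig0 : 0 < sig := expR_gt0 _.
have mkf A B := @measurable_kfun R r c A B.
have pow2 j : 1 <= (2 : R) ^+ j by apply: exprn_ege1; rewrite ler1n.
have half01 j : 0 < (2^-1 : R) ^+ j <= 1.
  by rewrite exprn_gt0 ?invr_gt0 //= exprVn invf_le1 ?pow2 // exprn_gt0.
have psiE j x : qf (dact v (2 ^+ j) x) v = 4 ^+ j * qf x v.
  by rewrite qf_dact // -exprM mulnC exprM (_ : 2 ^+ 2 = 4) //; ring.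
have [cs|cs] := leP 1 (ch^-1 * sig).
  (* The lower constant combines the uniform bounds on c ln det, on al tr(a x) while x expands along
     v, and on tr(b x^-1) while x^-1 contracts. *)
  left; apply: (@blowup R n (tdact v 2) (tdact v 2^-1) ch^-1 sig (expR (- Cd - al * Ca - Cb))
    _ (box (Cx y0) e1) (fun t => qf (Mx t) v)) => //.
  - exact: measurable_tdact.
  - exact: measurable_tdact.
  - exact: tdactK.
  - by rewrite invr_gt0.
  - exact: expR_gt0.
  - by move=> f mf f0; rewrite chE // muleA -EFinM mulVf ?gt_eqF // mul1e.
  - exact: measurable_box.
  - by have /andP[] := leb_box (Cx y0) e10.
  - by move=> s j Ks; rewrite smx_iter_tdact // psiE.
  - by move=> s /box1[_ []].
  - exact: kfun_ge0.
  - move=> s j /box1[py [q12 hb hCa hCb hCd]].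
    have ly := posdef_dact v1 (l := 2 ^+ j) (expf_neq0 _ two0) py.
    rewrite /kfun smx_iter_tdact // indicE mem_set ?mul1r; last first.
      by rewrite /DP /= smx_iter_tdact.
    rewrite /kexp ln_det_iter // dact_inv ?expf_neq0 //; last exact: posdef_unit.
    rewrite -expRM_natl -expRD ler_expR -exprVn.
    have hA : \tr (al *: a *m dact v (2 ^+ j) (Mx s)) <= al * Ca.
      rewrite -scalemxAl mxtraceZ ler_pM2l //; apply: le_trans hCa.
      apply: tr_dact_expand => //; first exact: posdef_sym.
      by apply: ltW; apply: lt_trans (proj1 (andP q12)); exact: ltr01.
    have hB : \tr (b *m dact v (2^-1 ^+ j) (invmx (Mx s))) <= Cb.
      by apply: le_trans hCb; exact: tr_dact_contract.
    move: hCd; rewrite ler_norml => /andP[hCd _].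
    rewrite mulrDr -/d2; move: hCd hA hB; rewrite (mulrCA c j%:R); lra.
(* The neighbourhood is that of y0^-1. Contracting w along v expands w^-1, so the same bounds apply
   with the two traces exchanged. *)
right; apply: (@blowup R n (tdact v 2^-1) (tdact v 2) ch sig^-1 (expR (- Cd - al * Cb - Ca))
    _ (box (Cx (invmx y0)) e2) (fun t => qf (invmx (Mx t)) v)) => //.
- exact: measurable_tdact.
- exact: measurable_tdact.
- exact: tdactK.
- by rewrite invr_gt0.
- exact: expR_gt0.
- move=> f mf f0; rewrite -chE //; last by apply: (measurableT_comp mf); exact: measurable_tdact.
  by apply: eq_integral => t _; rewrite tdactK.
- exact: measurable_box.
- by have /andP[] := leb_box (Cx (invmx y0)) e20.
- move=> s j /box2[pw _]; rewrite smx_iter_tdact // dact_inv ?expf_neq0 //; last exact: posdef_unit.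
  by rewrite -exprVn invrK psiE.
- by move=> s /box2[_ []].
- exact: kfun_ge0.
- move=> s j /box2[pw [q12 hb hCa hCb hCd]].
  have py := posdef_inv pw.
  have lw := posdef_dact v1 (l := 2^-1 ^+ j) (expf_neq0 _ half0) pw.
  rewrite /kfun smx_iter_tdact // indicE mem_set ?mul1r; last first.
    by rewrite /DP /= smx_iter_tdact.
  rewrite /kexp ln_det_iter // dact_inv ?expf_neq0 //; last exact: posdef_unit.
  rewrite -exprVn invrK d2V lnV //.
  rewrite /sig -expRN -expRM_natl -expRD ler_expR.
  have hA : \tr (a *m dact v (2 ^+ j) (invmx (Mx s))) <= Ca.
    apply: le_trans hCa.
    apply: tr_dact_expand => //; first exact: posdef_sym.
    by apply: ltW; apply: lt_trans (proj1 (andP q12)); exact: ltr01.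
  have hB : \tr (al *: b *m dact v (2^-1 ^+ j) (Mx s)) <= al * Cb.
    rewrite -scalemxAl mxtraceZ ler_pM2l //.
    by rewrite invmxK in hCb; apply: le_trans hCb; exact: tr_dact_contract.
  move: hCd; rewrite det_inv lnV ?posrE ?det_gt0 // ler_norml => /andP[_ hCd].
  move: hCd hA hB; rewrite mulrDr (mulrCA c j%:R); lra.
- rewrite -(ler_pM2l (_ : 0 < ch^-1 * sig)) ?mulr_gt0 ?invr_gt0 // mulr1.
  rewrite mulrACA mulVf ?gt_eqF // mulfV ?gt_eqF // mulr1; exact: ltW.
Qed.

Lemma coef_posdef al (a b : 'M[R]_r) c : 0 < al -> a^T = a -> b^T = b ->
  (\int[mu]_t (kfun c (al *: a) b t)%:E < +oo)%E ->
  (\int[mu]_t (kfun c (al *: b) a t)%:E < +oo)%E -> posdef a.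
Proof.
move=> al0 sa sb fin1 fin2; split=> // v v0; rewrite ltNge; apply/negP => av.
have q0 := qf1_gt0 v0; have s0 : 0 < Num.sqrt (qf 1%:M v) by rewrite sqrtr_gt0.
have [k kE] : exists k, k = (Num.sqrt (qf 1%:M v))^-1 by eexists.
have kT : (k *: v)^T = k *: v^T by rewrite linearZ.
have u1 : (k *: v)^T *m (k *: v) = 1%:M.
  rewrite [LHS]mx11_scalar kT -scalemxAl -scalemxAr scalerA mxE.
  have -> : (v^T *m v) 0 0 = qf 1%:M v by rewrite /qf mulmx1.
  by rewrite kE -invfM -expr2 sqr_sqrtr ?mulVf ?gt_eqF // ltW.
have au : qf a (k *: v) <= 0.
  rewrite /qf kT -!scalemxAl -scalemxAr scalerA mxE.
  by apply: mulr_ge0_le0 => //; rewrite -expr2 sqr_ge0.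
by case: (not_posdef_blowup c u1 al0 sa sb au) => h; [move: fin1|move: fin2]; rewrite h ltxx.
Qed.

End PosDefCoefTheorem.

(** * Densities and independence *)

Section Laws.
Variables (R : realType) (r : nat).
Local Notation n := (sym_dim r).
Local Notation Tn := (n.-tuple R).
Local Notation mu := (leb R n).
Local Notation mu2 := (prod_sf (leb R n) (leb R n)).
Local Notation Mx := (@smx_of_tuple R r).
Local Notation Cx := (@sym_coords R r).
Local Notation DP := (@DP R r).
Local Notation DD := (@DD R r).
Local Notation Phi := (@Phi R r).
Implicit Types (f g : 'M[R]_r -> R).

Lemma rect_measure_unique (m1 m2 : {measure set (Tn * Tn)%type -> \bar R}) :
  (forall A B, measurable A -> measurable B -> m1 (A `*` B) = m2 (A `*` B)) ->
  (m1 setT < +oo)%E -> forall E, measurable E -> m1 E = m2 E.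
Proof.
move=> m12 fin E mE.
pose C : set (set (Tn * Tn)) :=
  [set C | exists A, measurable A /\ exists B, measurable B /\ C = A `*` B].
apply: (measure_unique C (fun=> setT)) => //.
- rewrite measurable_prod_measurableType //; congr (<<s _ >>).
  rewrite predeqE; split => [[A mA [B mB <-]]|[A [mA [B [mB ->]]]]].
    by exists A; split => //; exists B.
  by exists A => //; exists B.
- move=> _ _ [X1 [mX1 [X2 [mX2 ->]]]] [Y1 [mY1 [Y2 [mY2 ->]]]].
  rewrite -setXI; exists (X1 `&` Y1); split; first exact: measurableI.
  by exists (X2 `&` Y2); split => //; exact: measurableI.
- move=> _; exists setT; split; first exact: measurableT.
  by exists setT; split; [exact: measurableT|rewrite setXTT].
- by rewrite bigcup_const //; exists 0%N.
- by move=> A [A1 [mA1 [A2 [mA2 ->]]]]; exact: m12.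
Qed.

Definition pcont (k : Tn -> R) := forall t, DP t -> forall e : R, 0 < e ->
  exists2 d : R, 0 < d & forall s, box t d s -> `|k s - k t| < e.

Definition row_of_tuple (t : Tn) : 'rV[R]_n := \row_k tnth t k.

Lemma smx_of_row t : smx_of_rv (row_of_tuple t) = Mx t.
Proof.
rewrite /smx_of_rv /smx_of_tuple; congr smx_of_seq.
rewrite -[RHS](map_tnth_enum t); apply: eq_map => k; by rewrite mxE.
Qed.

Lemma twice_differentiable_pcont f :
  twice_differentiable_on [set v | posdef (smx_of_rv v)] (fun v => f (smx_of_rv v)) ->
  pcont (fun t => f (Mx t)).
Proof.
move=> df t pt e e0.
have [|/differentiable_continuous c _] := df (row_of_tuple t).
  by rewrite /= smx_of_row.
have : nbhs (row_of_tuple t) ((fun v => f (smx_of_rv v)) @^-1` ball (f (Mx t)) e).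
  by apply: c; rewrite smx_of_row; exact: nbhsx_ballx.
move=> /nbhs_ballP[d /= d0 h]; exists d => // s hs.
have := h (row_of_tuple s); rewrite /= smx_of_row /ball /= distrC; apply.
by split=> // i j; rewrite /ball /= !mxE distrC; exact: hs.
Qed.

Definition tdens f (t : Tn) : R := \1_DP t * f (Mx t).

Section PosDensity.
Variable f : 'M[R]_r -> R.
Hypotheses (f0 : forall x, posdef x -> 0 < f x) (cf : pcont (fun t => f (Mx t))).

Lemma tdens_in t : DP t -> tdens f t = f (Mx t).
Proof. by move=> pt; rewrite /tdens indicE mem_set // mul1r. Qed.

Lemma tdens_out t : ~ DP t -> tdens f t = 0.
Proof. by move=> pt; rewrite /tdens indicE memNset // mul0r. Qed.

Lemma tdens_ge0 t : 0 <= tdens f t.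
Proof.
have [pt|pt] := pselect (DP t); last by rewrite tdens_out.
by rewrite tdens_in // ltW // f0.
Qed.

Lemma tdens_near t e : DP t -> 0 < e ->
  exists2 d : R, 0 < d & forall s, box t d s -> DP s /\ `|tdens f s - tdens f t| < e.
Proof.
move=> pt e0; have [d d0 hd] := cf pt e0; have [d' d0' hd'] := DP_open pt.
exists (Num.min d d'); first by rewrite lt_min d0.
move=> s hs; have ps : DP s by apply: hd'; apply: box_le hs; rewrite ge_min lexx orbT.
split=> //; rewrite !tdens_in //; apply: hd; apply: box_le hs.
by rewrite ge_min lexx.
Qed.

Lemma measurable_tdens : measurable_fun setT (tdens f).
Proof.
apply: (measurability _ (RGenOInfty.measurableE R)) => _ [_ [x ->] <-].
rewrite setTI (_ : _ @^-1` _ = [set t | x < tdens f t]); last first.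
  by apply/seteqP; split => z /=; rewrite in_itv /= andbT.
apply: box_open_measurable => t /= ht; have [x0|x0] := ltP x 0.
  by exists 1 => // s _ /=; apply: lt_le_trans x0 (tdens_ge0 s).
have pt : DP t by apply: contrapT => npt; move: ht; rewrite tdens_out // ltNge x0.
have e0 : 0 < tdens f t - x by rewrite subr_gt0.
have [d d0 hd] := tdens_near pt e0; exists d => // s /hd[_].
by rewrite /= ltr_norml => /andP[]; lra.
Qed.

End PosDensity.

Definition jdens f g (z : Tn * Tn) : R := tdens f z.1 * tdens g z.2.

Section JointDensity.
Variables f g : 'M[R]_r -> R.
Hypotheses (f0 : forall x, posdef x -> 0 < f x) (cf : pcont (fun t => f (Mx t))).
Hypotheses (g0 : forall x, posdef x -> 0 < g x) (cg : pcont (fun t => g (Mx t))).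

Lemma jdens_ge0 z : 0 <= jdens f g z.
Proof. by rewrite mulr_ge0 // tdens_ge0. Qed.

Lemma jdens_out z : ~ DD z -> jdens f g z = 0.
Proof.
move=> nz; rewrite /jdens; have [p1|p1] := pselect (DP z.1); last by rewrite tdens_out // mul0r.
by rewrite [tdens g _]tdens_out ?mulr0 // => p2; apply: nz.
Qed.

Lemma jdens_near z e : DD z -> 0 < e ->
  exists2 de : R, 0 < de & forall w, box2 z de w -> `|jdens f g w - jdens f g z| < e.
Proof.
move=> [p1 p2] e0.
have a0 := tdens_ge0 f0 z.1; have b0 := tdens_ge0 g0 z.2.
(* With both errors below e' <= 1, the product changes by at most e' (1 + a + b), where a and b are
   the values at z; this is less than e' s <= e. *)
pose s := tdens f z.1 + tdens g z.2 + 2.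
have s0 : 0 < s by rewrite /s; lra.
pose e' := Num.min 1 (e / s).
have e'0 : 0 < e' by rewrite lt_min ltr01 divr_gt0.
have e'1 : e' <= 1 by rewrite ge_min lexx.
have es : e' * s <= e by rewrite -ler_pdivlMr // ge_min lexx orbT.
have [d1 d10 h1] := tdens_near cf p1 e'0; have [d2 d20 h2] := tdens_near cg p2 e'0.
exists (Num.min d1 d2); first by rewrite lt_min d10.
move=> w [w1 w2].
have [_] : DP w.1 /\ `|tdens f w.1 - tdens f z.1| < e'.
  by apply: h1; apply: box_le w1; rewrite ge_min lexx.
have [_] : DP w.2 /\ `|tdens g w.2 - tdens g z.2| < e'.
  by apply: h2; apply: box_le w2; rewrite ge_min lexx orbT.
rewrite /jdens; move: a0 b0 es; rewrite /s.
move: (tdens f w.1) (tdens g w.2) (tdens f z.1) (tdens g z.2) => x y a b a0 b0 es hy hx.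
have -> : x * y - a * b = (x - a) * (y - b) + a * (y - b) + (x - a) * b by ring.
apply: le_lt_trans (ler_normD _ _) _.
have : `|(x - a) * (y - b) + a * (y - b)| <= `|x - a| * `|y - b| + a * `|y - b|.
  by apply: le_trans (ler_normD _ _) _; rewrite !normrM (ger0_norm a0).
have : `|(x - a) * b| = `|x - a| * b by rewrite normrM (ger0_norm b0).
have := normr_ge0 (x - a); have := normr_ge0 (y - b).
move: `|x - a| `|y - b| hx hy => k l hk hl l0 k0 -> h.
have : k * l <= e' * 1 by apply: ler_pM => //; lra.
have : a * l <= a * e' by apply: ler_wpM2l => //; lra.
have : k * b <= e' * b by apply: ler_wpM2r => //; lra.
lra.
Qed.

Lemma lsc2_jdens : lsc2 (jdens f g).
Proof.
move=> c z /= hc; have [c0|c0] := ltP c 0.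
  by exists 1 => // w _ /=; apply: lt_le_trans c0 _; exact: jdens_ge0.
have Dz : DD z by apply: contrapT => nz; move: hc; rewrite jdens_out // ltNge c0.
have e0 : 0 < jdens f g z - c by rewrite subr_gt0.
have [d d0 hd] := jdens_near Dz e0; exists d => // w /hd.
by rewrite /= ltr_norml => /andP[]; lra.
Qed.

Lemma measurable_jdens : measurable_fun setT (jdens f g).
Proof. by apply: lsc2_measurable; exact: lsc2_jdens. Qed.

End JointDensity.

Lemma indicX (A B : set Tn) z : \1_(A `*` B) z = \1_A z.1 * \1_B z.2 :> R.
Proof. by rewrite !indicE in_setX; case: (_ \in A) => /=; rewrite ?mul1r ?mul0r. Qed.

Lemma int_Omega_indic (A : set Tn) (h : 'M[R]_r -> R) : (forall x, 0 <= h x) ->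
  measurable_fun setT (fun t => \1_A t * h (Mx t)) ->
  int_Omega (fun x => (\1_A (Cx x) * h x)%:E) = (\int[mu]_t (\1_A t * h (Mx t))%:E)%E.
Proof.
move=> h0 mh; rewrite /int_Omega -iint_leb; last 2 first.
- exact/measurable_EFinP.
- by move=> t; rewrite lee_fin mulr_ge0.
by congr iint; apply/funext => t; rewrite smx_tupleK.
Qed.

Section Densities.
Context d (T : measurableType d) (P : probability T R).

(** Since X lies in the cone, A is cut down to the cone before the density is used. This replaces f
    by [tdens f], which is measurable because f is continuous on the cone; outside it f may be
    irregular. *)
Lemma density_law (X : T -> 'M[R]_r) f A : (forall w, posdef (X w)) -> has_density P X f ->
  (forall x, posdef x -> 0 < f x) -> pcont (fun t => f (Mx t)) -> measurable A ->
  P (X @^-1` (Cx @^-1` A)) = (\int[mu]_t (\1_A t * tdens f t)%:E)%E.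
Proof.
move=> pX [f0 fE] fpos cf mA.
have -> : X @^-1` (Cx @^-1` A) = X @^-1` (Cx @^-1` (A `&` DP)).
  apply/seteqP; split => [w /= h|w /= []//]; split=> //.
  by rewrite /DP /= sym_coordsK //; case: (pX w).
have e t : \1_(A `&` DP) t * f (Mx t) = \1_A t * tdens f t.
  by rewrite indicI /= /tdens mulrA.
rewrite fE; last by apply: measurableI => //; exact: measurable_DP.
rewrite int_Omega_indic //; first by apply: eq_integral => t _; rewrite e.
under eq_fun do rewrite e.
by apply: measurable_funM => //; exact: measurable_tdens.
Qed.

Variables (X Y : T -> 'M[R]_r) (f g : 'M[R]_r -> R) (al be : R).
Hypotheses (mX : random_matrix X) (mY : random_matrix Y).
Hypotheses (pX : forall w, posdef (X w)) (pY : forall w, posdef (Y w)).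
Hypotheses (fX : has_density P X f) (gY : has_density P Y g).
Hypotheses (f0 : forall x, posdef x -> 0 < f x) (g0 : forall x, posdef x -> 0 < g x).
Hypotheses (cf : pcont (fun t => f (Mx t))) (cg : pcont (fun t => g (Mx t))).
Hypothesis iXY : indep_mx P X Y.

Lemma integral_prod_fun (h k : Tn -> R) : measurable_fun setT h -> measurable_fun setT k ->
  (forall t, 0 <= h t) -> (forall t, 0 <= k t) ->
  (\int[mu2]_z (h z.1 * k z.2)%:E = (\int[mu]_t (h t)%:E) * (\int[mu]_t (k t)%:E))%E.
Proof.
move=> mh mk h0 k0.
have m1 : measurable_fun setT (fun z : Tn * Tn => (h z.1 * k z.2)%:E).
  apply/measurable_EFinP; apply: measurable_funM.
    by apply: (measurableT_comp mh).
  by apply: (measurableT_comp mk).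
rewrite fubini_tonelli1 //; last by move=> z; rewrite lee_fin mulr_ge0.
rewrite /fubini_F /=.
have i0 : (0 <= \int[mu]_t (k t)%:E)%E by apply: integral_ge0 => t _; rewrite lee_fin.
rewrite -ge0_integralZr //; last 2 first.
- exact/measurable_EFinP.
- by move=> t _; rewrite lee_fin.
apply: eq_integral => s _; under eq_integral do rewrite EFinM.
rewrite ge0_integralZl //; last by rewrite lee_fin.
- exact/measurable_EFinP.
- by move=> t _; rewrite lee_fin.
Qed.

Lemma integral_jdens_rect A B : measurable A -> measurable B ->
  (\int[mu2]_z ((\1_(A `*` B) z)%:E * (jdens f g z)%:E) =
   (\int[mu]_t (\1_A t * tdens f t)%:E) * (\int[mu]_t (\1_B t * tdens g t)%:E))%E.
Proof.
move=> mA mB; rewrite -integral_prod_fun.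
- by apply: eq_integral => z _; rewrite -EFinM indicX /jdens mulrACA.
- by apply: measurable_funM => //; exact: measurable_tdens.
- by apply: measurable_funM => //; exact: measurable_tdens.
- by move=> t; rewrite mulr_ge0 // tdens_ge0.
- by move=> t; rewrite mulr_ge0 // tdens_ge0.
Qed.

Lemma joint_law_density E : measurable E ->
  P [set w | E (Cx (X w), Cx (Y w))] = (\int[mu2]_z ((\1_E z)%:E * (jdens f g z)%:E))%E.
Proof.
move=> mE.
have eK : measurable_fun setT (fun z => (jdens f g z)%:E) by apply/measurable_EFinP; exact: measurable_jdens.
have eK0 z : (0 <= (jdens f g z)%:E)%E by rewrite lee_fin jdens_ge0.
have mXY : measurable_fun setT (fun w => (Cx (X w), Cx (Y w))) by exact: measurable_fun_pair.
pose m1 : {measure set (Tn * Tn)%type -> \bar R} :=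
  measure_function_pushforward__canonical__measure_function_Measure P mXY.
apply: (etrans _ (dens_measureE mu2 eK eK0 E)).
apply: (@rect_measure_unique m1 (dens_measure mu2 eK eK0)) => //.
- move=> A B mA mB; rewrite dens_measureE integral_jdens_rect //.
  by rewrite -(density_law pX fX) // -(density_law pY gY) // -iXY.
- by rewrite /m1 /= /pushforward /= preimage_setT probability_setT ltry.
Qed.

Lemma integral_jdens1 : (\int[mu2]_z (jdens f g z)%:E = 1)%E.
Proof.
have := joint_law_density measurableT; rewrite (_ : [set w | _] = setT) // probability_setT => ->.
by apply: eq_integral => z _; rewrite indicT mul1e.
Qed.

Hypotheses (al0 : 0 < al) (be0 : 0 <= be).

(** The density of (U, V) in coordinates: phi is its own inverse and preserves Lebesgue measure, so
    there is no Jacobian factor. *)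
Definition jdensUV (z : Tn * Tn) : R := \1_DD z * jdens f g (Phi al be z).

Lemma law_UV A B : measurable A -> measurable B ->
  P ((fun w => (phi_ab al be (X w) (Y w)).1) @^-1` (Cx @^-1` A) `&`
     (fun w => (phi_ab al be (X w) (Y w)).2) @^-1` (Cx @^-1` B)) =
  (\int[mu2]_z (\1_A z.1 * \1_B z.2 * jdensUV z)%:E)%E.
Proof.
move=> mA mB; have mAB : measurable (A `*` B) by exact: measurableX.
have mE : measurable (Phi al be @^-1` (A `*` B)).
  by apply: measurable_preimageT => //; exact: measurable_Phi.
transitivity (P [set w | (Phi al be @^-1` (A `*` B)) (Cx (X w), Cx (Y w))]).
  by congr (P _); apply/seteqP; split => w; rewrite /Phi /= !sym_coordsK ?posdef_sym.
rewrite joint_law_density //.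
transitivity (\int[mu2]_z ((\1_(A `*` B) (Phi al be z))%:E * (jdens f g z)%:E))%E.
  by [].
rewrite law_change //.
- by apply: eq_integral => z _; rewrite -!EFinM indicX.
- exact: lsc2_jdens.
- exact: jdens_ge0.
- exact: jdens_out.
- exact: integral_jdens1.
Qed.

End Densities.
End Laws.

(** * Pointwise factorization of a continuous density from independence *)

Section ProductDensity.
Variables (R : realType) (r : nat).
Local Notation n := (sym_dim r).
Local Notation Tn := (n.-tuple R).
Local Notation mu := (leb R n).
Local Notation mu2 := (prod_sf (leb R n) (leb R n)).
Local Notation DP := (@DP R r).
Local Notation DD := (@DD R r).

Variables (p : Tn * Tn -> R) (a b : set Tn -> R).
Hypotheses (p0 : forall z, 0 <= p z) (mp : measurable_fun setT p).
Hypothesis cp : forall z, DD z -> forall e : R, 0 < e ->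
  exists2 d : R, 0 < d & forall w, box2 z d w -> `|p w - p z| < e.
Hypothesis pE : forall A B, measurable A -> measurable B ->
  (\int[mu2]_z (\1_A z.1 * \1_B z.2 * p z)%:E = (a A * b B)%:E)%E.

Let m (u : Tn) (d : R) := fine (mu (box u d)).

Let mE u d : 0 < d -> mu (box u d) = (m u d)%:E /\ 0 < m u d.
Proof.
move=> d0; have /andP[h1 h2] := leb_box u d0; split; last by rewrite fine_gt0 // h1.
by rewrite fineK // ge0_fin_numE.
Qed.

Let boxE (c : R) u v d : 0 < d -> 0 <= c ->
  (\int[mu2]_z ((c * \1_(box u d) z.1) * \1_(box v d) z.2)%:E = (c * m u d * m v d)%:E)%E.
Proof.
move=> d0 c0; rewrite (integral_prod_fun (h := fun t => c * \1_(box u d) t) (k := \1_(box v d))) //.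
- under eq_integral do rewrite EFinM.
  rewrite ge0_integralZl //; last by apply/measurable_EFinP; apply: measurable_indic; exact: measurable_box.
  rewrite !integral_indic ?setIT //; try exact: measurable_box.
  rewrite !EFinM; congr (_ * _ * _)%E; [exact: (mE u d0).1|exact: (mE v d0).1].
- by apply: measurable_funM => //; apply: measurable_indic; exact: measurable_box.
- by apply: measurable_indic; exact: measurable_box.
- by move=> t; rewrite mulr_ge0.
Qed.

Let box_est z d e : 0 < d -> (forall w, box2 z d w -> `|p w - p z| < e) -> e < p z ->
  (p z - e) * m z.1 d * m z.2 d <= a (box z.1 d) * b (box z.2 d) <=
  (p z + e) * m z.1 d * m z.2 d.
Proof.
move=> d0 h ez; have e0 : 0 < e by have := h z (box2_refl z d0); apply: le_lt_trans.
have mb u := measurable_box u d.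
have mi : measurable_fun setT (fun w : Tn * Tn => \1_(box z.1 d) w.1 * \1_(box z.2 d) w.2 : R).
  apply: measurable_funM.
    by apply: (measurableT_comp (measurable_indic _)) => //; exact: mb.
  by apply: (measurableT_comp (measurable_indic _)) => //; exact: mb.
have mc (c : R) : measurable_fun setT (fun w : Tn * Tn => ((c * \1_(box z.1 d) w.1) * \1_(box z.2 d) w.2)%:E).
  apply/measurable_EFinP; under eq_fun do rewrite -mulrA.
  exact: measurable_funM.
have mq : measurable_fun setT (fun w : Tn * Tn => (\1_(box z.1 d) w.1 * \1_(box z.2 d) w.2 * p w)%:E).
  by apply/measurable_EFinP; exact: measurable_funM.
have hb w : `|p w - p z| < e \/ \1_(box z.1 d) w.1 * \1_(box z.2 d) w.2 = 0 :> R.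
  rewrite !indicE; have [/set_mem h1|] := boolP (w.1 \in _); last by rewrite mul0r; right.
  have [/set_mem h2|] := boolP (w.2 \in _); last by rewrite mulr0; right.
  by left; apply: h.
have c1 : 0 <= p z - e by rewrite subr_ge0 ltW.
have c2 : 0 <= p z + e by rewrite addr_ge0 // ltW.
apply/andP; split; rewrite -lee_fin; [move: (boxE z.1 z.2 d0 c1)|move: (boxE z.1 z.2 d0 c2)] => <-;
  rewrite -pE //; try exact: mb.
- apply: ge0_le_integral => //.
  + by move=> w _; rewrite lee_fin !mulr_ge0.
  + move=> w _; rewrite lee_fin -mulrA mulrC; have [|->] := hb w; last by rewrite !mul0r.
    by rewrite ltr_norml => /andP[h1 h2]; apply: ler_wpM2l; [exact: mulr_ge0|lra].
- apply: ge0_le_integral => //.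
  + by move=> w _; rewrite lee_fin !mulr_ge0.
  + move=> w _; rewrite lee_fin -[leRHS]mulrA [leRHS]mulrC; have [|->] := hb w; last by rewrite !mul0r.
    by rewrite ltr_norml => /andP[h1 h2]; apply: ler_wpM2l; [exact: mulr_ge0|lra].
Qed.

(** On rectangles of small boxes the masses factor, so the products of masses at the two pairs of
    opposite corners agree. Each mass is the density at the centre times the volume up to e, and e
    is then made small. *)
Let density_le u v u' v' : DP u -> DP v -> DP u' -> DP v' ->
  0 < p (u, v) -> 0 < p (u', v') -> 0 < p (u, v') -> 0 < p (u', v) ->
  p (u, v) * p (u', v') <= p (u, v') * p (u', v).
Proof.
move=> Du Dv Du' Dv' p1 p2 p3 p4.
have main e : 0 < e -> e < p (u, v) -> e < p (u', v') -> e < p (u, v') -> e < p (u', v) ->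
    (p (u, v) - e) * (p (u', v') - e) <= (p (u, v') + e) * (p (u', v) + e).
  move=> e0 e1 e2 e3 e4.
  have [d1 d10 h1] := cp (z := (u, v)) (conj Du Dv) e0.
  have [d2 d20 h2] := cp (z := (u', v')) (conj Du' Dv') e0.
  have [d3 d30 h3] := cp (z := (u, v')) (conj Du Dv') e0.
  have [d4 d40 h4] := cp (z := (u', v)) (conj Du' Dv) e0.
  pose d := Num.min (Num.min d1 d2) (Num.min d3 d4).
  have d0 : 0 < d by rewrite !lt_min d10 d20 d30.
  have [l1 l2 l3 l4] : [/\ d <= d1, d <= d2, d <= d3 & d <= d4].
    by rewrite /d !ge_min !lexx ?orbT.
  have sub z dd : d <= dd -> (forall w, box2 z dd w -> `|p w - p z| < e) ->
      forall w, box2 z d w -> `|p w - p z| < e.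
    by move=> ld h w hw; apply: h; exact: box2_le hw.
  have /andP[g1 _] := box_est d0 (sub _ _ l1 h1) e1.
  have /andP[g2 _] := box_est d0 (sub _ _ l2 h2) e2.
  have /andP[_ g3] := box_est d0 (sub _ _ l3 h3) e3.
  have /andP[_ g4] := box_est d0 (sub _ _ l4 h4) e4.
  have [[_ mu0] [_ mv0]] := (mE u d0, mE v d0).
  have [[_ mu0'] [_ mv0']] := (mE u' d0, mE v' d0).
  move: g1 g2 g3 g4 => /=.
  set x1 := a _; set y1 := b _; set x2 := a _; set y2 := b _ => g1 g2 g3 g4.
  have k : 0 < m u d * m v d * m u' d * m v' d by rewrite !mulr_gt0.
  rewrite -(ler_pM2r k).
  have A : ((p (u, v) - e) * m u d * m v d) * ((p (u', v') - e) * m u' d * m v' d) <=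
      (x1 * y1) * (x2 * y2).
    by apply: ler_pM => //; rewrite !mulr_ge0 // ?subr_ge0 ltW.
  have B : (x1 * y2) * (x2 * y1) <=
      ((p (u, v') + e) * m u d * m v' d) * ((p (u', v) + e) * m u' d * m v d).
    apply: ler_pM => //.
    - by rewrite -lee_fin -pE; [apply: integral_ge0 => z _; rewrite lee_fin !mulr_ge0|exact: measurable_box|exact: measurable_box].
    - by rewrite -lee_fin -pE; [apply: integral_ge0 => z _; rewrite lee_fin !mulr_ge0|exact: measurable_box|exact: measurable_box].
  lra.
rewrite leNgt; apply/negP; move: p1 p2 p3 p4 main.
move: (p (u, v)) (p (u', v')) (p (u, v')) (p (u', v)) => x y z t x0 y0 z0 t0 main h.
pose D := x * y - z * t; pose S := x + y + z + t.
have S0 : 0 < S by rewrite /S; lra.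
have D0 : 0 < D by rewrite subr_gt0.
(* (x - e)(y - e) - (z + e)(t + e) = D - e S, which stays positive for e <= D / (2 S); the other
   terms of the minimum keep e below all four values. *)
pose e := Num.min (Num.min (Num.min x y) (Num.min z t)) (D / S) / 2.
have m0 : 0 < Num.min (Num.min (Num.min x y) (Num.min z t)) (D / S).
  by rewrite !lt_min x0 y0 z0 t0 divr_gt0.
have e0 : 0 < e by rewrite divr_gt0.
have le1 : Num.min (Num.min (Num.min x y) (Num.min z t)) (D / S) <= x by rewrite !ge_min lexx.
have le2 : Num.min (Num.min (Num.min x y) (Num.min z t)) (D / S) <= y by rewrite !ge_min lexx ?orbT.
have le3 : Num.min (Num.min (Num.min x y) (Num.min z t)) (D / S) <= z by rewrite !ge_min lexx ?orbT.
have le4 : Num.min (Num.min (Num.min x y) (Num.min z t)) (D / S) <= t by rewrite !ge_min lexx ?orbT.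
have le5 : Num.min (Num.min (Num.min x y) (Num.min z t)) (D / S) <= D / S by rewrite !ge_min lexx ?orbT.
have e2 : e * 2 = Num.min (Num.min (Num.min x y) (Num.min z t)) (D / S).
  by rewrite /e mulfVK.
have e5 : e * S <= D / 2.
  have : e * 2 * S <= D by rewrite e2 -ler_pdivlMr.
  by lra.
have := main e e0; rewrite -/D; move: e5; rewrite /D /S => e5 mm.
have := mm; move: e2 le1 le2 le3 le4; move: (Num.min _ _) => q e2 le1 le2 le3 le4.
move=> /(_ _ _ _ _); lra.
Qed.

(** Vanishing 2 by 2 minors are the pointwise form of factorization. The reverse inequality is
    [density_le] with v and v' exchanged. *)
Lemma density_cross u v u' v' : (forall z, DD z -> 0 < p z) ->
  DP u -> DP v -> DP u' -> DP v' -> p (u, v) * p (u', v') = p (u, v') * p (u', v).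
Proof.
move=> pp Du Dv Du' Dv'.
have [h1 h2 h3 h4] : [/\ DD (u, v), DD (u', v'), DD (u, v') & DD (u', v)] by [].
by apply/eqP; rewrite eq_le; apply/andP; split; apply: density_le => //; exact: pp.
Qed.

End ProductDensity.

Section IndependentImage.
Variables (R : realType) (r : nat).
Local Notation n := (sym_dim r).
Local Notation Tn := (n.-tuple R).
Local Notation Mx := (@smx_of_tuple R r).
Local Notation Cx := (@sym_coords R r).
Context d (T : measurableType d) (P : probability T R).
Variables (X Y : T -> 'M[R]_r) (f g : 'M[R]_r -> R) (al be : R).
Hypotheses (mX : random_matrix X) (mY : random_matrix Y).
Hypotheses (pX : forall w, posdef (X w)) (pY : forall w, posdef (Y w)).
Hypotheses (fX : has_density P X f) (gY : has_density P Y g).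
Hypotheses (f0 : forall x, posdef x -> 0 < f x) (g0 : forall x, posdef x -> 0 < g x).
Hypotheses (cf : pcont (fun t => f (Mx t))) (cg : pcont (fun t => g (Mx t))).
Hypothesis iXY : indep_mx P X Y.
Hypotheses (al0 : 0 < al) (be0 : 0 <= be).
Local Notation U := (fun w => (phi_ab al be (X w) (Y w)).1).
Local Notation V := (fun w => (phi_ab al be (X w) (Y w)).2).
Hypothesis iUV : indep_mx P U V.

(** The density [jdensUV] as a function of matrices. *)
Definition phidens (u v : 'M[R]_r) : R := f (phi_ab al be u v).1 * g (phi_ab al be u v).2.

Lemma phidens_gt0 u v : posdef u -> posdef v -> 0 < phidens u v.
Proof. by move=> pu pv; have [h1 h2] := posdef_phi al0 be0 pu pv; rewrite mulr_gt0 ?f0 ?g0. Qed.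

Lemma phidens_cross u v u' v' : posdef u -> posdef v -> posdef u' -> posdef v' ->
  phidens u v * phidens u' v' = phidens u v' * phidens u' v.
Proof.
move=> pu pv pu' pv'.
have jE x y : posdef x -> posdef y -> jdensUV f g al be (Cx x, Cx y) = phidens x y.
  move=> px py; have [q1 q2] := posdef_phi al0 be0 px py.
  have sx := posdef_sym px; have sy := posdef_sym py.
  have Dxy : @DD R r (Cx x, Cx y) by split; rewrite /DP /= sym_coordsK.
  rewrite /jdensUV indicE mem_set // mul1r /jdens /Phi /= !(sym_coordsK sx) !(sym_coordsK sy).
  by rewrite !tdens_in /DP /= ?sym_coordsK ?(posdef_sym q1) ?(posdef_sym q2).
have DC x : posdef x -> @DP R r (Cx x) by move=> px; rewrite /DP /= sym_coordsK // posdef_sym.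
rewrite -!jE //.
pose a A := fine (P (U @^-1` (Cx @^-1` A))); pose b B := fine (P (V @^-1` (Cx @^-1` B))).
have Dpos z : @DD R r z -> 0 < jdensUV f g al be z.
  case: z => s t [p1 p2]; rewrite -[s]smx_tupleK -[t]smx_tupleK jE //.
  exact: phidens_gt0.
have mPhi := @measurable_Phi R r al be.
have mUV (Z : T -> 'M[R]_r) (h : Tn * Tn -> Tn) : measurable_fun setT h ->
    (forall w, Cx (Z w) = h (Cx (X w), Cx (Y w))) -> forall A, measurable A ->
    measurable (Z @^-1` (Cx @^-1` A)).
  move=> mh hE A mA; have -> : Z @^-1` (Cx @^-1` A) = (fun w => h (Cx (X w), Cx (Y w))) @^-1` A.
    by apply/seteqP; split => w /=; rewrite hE.
  apply: measurable_preimageT => //; apply: (measurableT_comp mh).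
  exact: measurable_fun_pair.
apply: (@density_cross R r (jdensUV f g al be) a b) => //.
- move=> z; rewrite /jdensUV mulr_ge0 //; exact: jdens_ge0.
- apply: measurable_funM; first by apply: measurable_indic; exact: measurable_DD.
  by apply: (measurableT_comp (measurable_jdens f0 cf g0 cg)).
- move=> z Dz e e0.
  have DPz := Phi_DD al0 be0 Dz.
  have [de de0 hde] := jdens_near f0 cf g0 cg DPz e0.
  have [d1 d10 h1] := Phi_near (ltW al0) be0 Dz de0.
  have [d2 d20 h2] := DD_open2 Dz.
  exists (Num.min d1 d2); first by rewrite lt_min d10.
  move=> w hw; have Dw : @DD R r w by apply: h2; apply: box2_le hw; rewrite ge_min lexx orbT.
  rewrite /jdensUV !indicE !mem_set // !mul1r; apply: hde; apply: h1.
    by rewrite subrr normr0.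
  by apply: box2_le hw; rewrite ge_min lexx.
- move=> A B mA mB; rewrite -(law_UV mX mY pX pY fX gY f0 g0 cf cg iXY al0 be0 mA mB).
  rewrite iUV // /a /b EFinM !fineK //; apply: fin_num_measure.
    apply: (mUV V (fun z => (Phi al be z).2)) mB; first exact: (measurableT_comp measurable_snd).
    by move=> w; rewrite /Phi /= !sym_coordsK ?posdef_sym.
  apply: (mUV U (fun z => (Phi al be z).1)) mA; first exact: (measurableT_comp measurable_fst).
  by move=> w; rewrite /Phi /= !sym_coordsK ?posdef_sym.
- exact: DC.
- exact: DC.
- exact: DC.
- exact: DC.
Qed.

(** The minor relation with second corner (I, I) separates the variables. *)
Lemma ln_phidens u v : posdef u -> posdef v ->
  ln (phidens u v) = ln (phidens u 1%:M) + (ln (phidens 1%:M v) - ln (phidens 1%:M 1%:M)).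
Proof.
move=> pu pv; have p1 := posdef1 R r.
have := phidens_cross pu pv p1 p1.
have := phidens_gt0 pu pv; have := phidens_gt0 p1 p1.
have := phidens_gt0 pu p1; have := phidens_gt0 p1 pv.
move: (phidens u v) (phidens 1%:M 1%:M) (phidens u 1%:M) (phidens 1%:M v) => a b c k k0 c0 b0 a0.
by move=> /(congr1 (@ln R)); rewrite !lnM ?posrE // => h; lra.
Qed.

Lemma functional_equation x y : posdef x -> posdef y ->
  ln (f x) + ln (g y) = ln (phidens (phi_ab al be x y).1 1%:M) +
    (ln (phidens 1%:M (phi_ab al be x y).2) - ln (phidens 1%:M 1%:M)).
Proof.
move=> px py; have [pu pv] := posdef_phi al0 be0 px py.
rewrite -ln_phidens // -lnM ?posrE ?f0 ?g0 //; congr ln.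
by rewrite /phidens phi_invol.
Qed.

End IndependentImage.

(** * The characterization *)

Section Regularity.
Variables (R : realType) (r : nat).
Local Notation n := (sym_dim r).
Local Notation Mx := (@smx_of_tuple R r).
Local Notation Cx := (@sym_coords R r).
Implicit Types (x y p q e : 'M[R]_r).

Definition rvc x : 'rV[R]_n := \row_k x (spair k).1 (spair k).2.

(* Extends functions of symmetric matrices to all matrices, so that they can be
   differentiated there. *)
Definition sympart x : 'M[R]_r := smx_of_rv (rvc x).

Lemma sympartE x : sympart x = Mx (Cx x).
Proof.
rewrite -smx_of_row; congr smx_of_rv; apply/rowP => k.
by rewrite !mxE tnth_sym_coords.
Qed.

Lemma sympart_id x : posdef x -> sympart x = x.
Proof. by move=> px; rewrite sympartE sym_coordsK // posdef_sym. Qed.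

Lemma mxdiff_rvc p : mxdiff rvc p.
Proof. by move=> i j; under eq_fun do rewrite mxE; exact: differentiable_coord. Qed.

Lemma rvc_line p e (s : R) : rvc (p + s *: e) = rvc p + s *: rvc e.
Proof. by apply/rowP => k; rewrite !mxE. Qed.

Lemma posdef_sympart_near p : posdef p -> \forall q \near p, posdef (sympart q).
Proof.
move=> pp; have [e e0 he] := posdef_open pp.
apply/nbhs_ballP; exists e => // q [_ hq]; apply: he.
  by rewrite sympartE smx_tuple_sym.
move=> i j; have -> : p i j = Mx (Cx p) i j by rewrite sym_coordsK // posdef_sym.
rewrite sympartE !smx_tupleE !tnth_sym_coords.
by rewrite distrC; exact: hq.
Qed.

Variable g : 'M[R]_r -> R.
Hypothesis g0 : forall x, posdef x -> 0 < g x.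
Hypothesis dg : twice_differentiable_on [set v | posdef (smx_of_rv v)] (fun v => g (smx_of_rv v)).

Local Notation gh := (fun v : 'rV[R]_n => g (smx_of_rv v)).

Lemma differentiable_sympart q : posdef (sympart q) -> differentiable (fun x => g (sympart x)) q.
Proof.
move=> pq; have [d1 _] := dg pq.
exact: (differentiable_comp (mxdiffP (mxdiff_rvc q)) d1).
Qed.

Lemma differentiable_ln (W : normedModType R) (h : W -> R) w : differentiable h w -> 0 < h w ->
  differentiable (fun u => ln (h u)) w.
Proof.
move=> dh h0; apply: (differentiable_comp dh).
by apply/derivable1_diffP; apply: ex_derive; exact: is_derive1_ln h0.
Qed.

Lemma derive_ln_sympart q e : posdef (sympart q) ->
  'D_e (fun x => ln (g (sympart x))) q = (g (sympart q))^-1 * 'D_(rvc e) gh (rvc q).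
Proof.
move=> pq; have [d1 _] := dg pq; have gq := g0 pq.
have dG : differentiable (fun x => ln (g (sympart x))) q.
  by apply: differentiable_ln => //; exact: differentiable_sympart.
apply: (etrans (deriveE _ dG)).
have dG0 : differentiable (fun x => ln (g (sympart x))) (q + 0 *: e) by rewrite scale0r addr0.
have d10 : differentiable gh (rvc q + 0 *: rvc e) by rewrite scale0r addr0.
have h1 := is_derive_along dG0.
have h2 := is_derive_along d10.
have h3 : is_derive (gh (rvc q + 0 *: rvc e)) 1 (@ln R) (gh (rvc q + 0 *: rvc e))^-1.
  by apply: is_derive1_ln; rewrite scale0r addr0.
have h4 := is_derive1_comp h3 h2.
have E : (fun s : R => ln (g (sympart (q + s *: e)))) =
    (@ln R) \o (fun s : R => gh (rvc q + s *: rvc e)).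
  by apply/funext => s /=; rewrite /sympart rvc_line.
rewrite E in h1; have := is_derive_uniq h1 h4.
rewrite !scale0r !addr0 => ->.
congr (_ * _); apply: esym; exact: (deriveE _ d1).
Qed.

Lemma tdiff_ln_sympart : tdiff (fun x => ln (g (sympart x))).
Proof.
move=> p pp; have sp := sympart_id pp; have pp' : posdef (sympart p) by rewrite sp.
split; first by apply: differentiable_ln; [exact: differentiable_sympart|exact: g0].
move=> e; have [d1 d2] := dg pp'.
(* The formula for the directional derivative holds at points whose symmetric part is positive
   definite, hence near p, and its factors are differentiable by hypothesis. *)
apply: (@near_eq_differentiable _ _ _ (fun q => (g (sympart q))^-1 * 'D_(rvc e) gh (rvc q))).
  by apply: filterS (posdef_sympart_near pp) => q pq; apply/esym; exact: derive_ln_sympart.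
apply: differentiableM.
  by apply: differentiableV; [exact: differentiable_sympart|rewrite gt_eqF // g0].
exact: (differentiable_comp (mxdiffP (mxdiff_rvc p)) (d2 (rvc e))).
Qed.

End Regularity.

Section KernelIntegrals.
Variables (R : realType) (r : nat).
Local Notation n := (sym_dim r).
Local Notation Tn := (n.-tuple R).
Local Notation mu := (leb R n).
Local Notation Mx := (@smx_of_tuple R r).
Implicit Types (A B : 'M[R]_r) (S : set Tn).

Definition kint c A B S : \bar R := (\int[mu]_t (\1_S t * kfun c A B t)%:E)%E.

Lemma kint_ge0 c A B S : (0 <= kint c A B S)%E.
Proof. by apply: integral_ge0 => t _; rewrite lee_fin mulr_ge0 // kfun_ge0. Qed.

Lemma kintT c A B : kint c A B setT = (\int[mu]_t (kfun c A B t)%:E)%E.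
Proof. by apply: eq_integral => t _; rewrite indicT mul1r. Qed.

Lemma measurable_indic_kfun c A B S : measurable S ->
  measurable_fun setT (fun t => \1_S t * kfun c A B t).
Proof. by move=> mS; apply: measurable_funM => //; exact: measurable_kfun. Qed.

Lemma kint_fin c A B S : measurable S -> (kint c A B setT < +oo)%E ->
  kint c A B S = (fine (kint c A B S))%:E.
Proof.
move=> mS fin; rewrite fineK // ge0_fin_numE ?kint_ge0 //; apply: le_lt_trans fin.
apply: ge0_le_integral => //.
- by move=> t _; rewrite lee_fin mulr_ge0 // kfun_ge0.
- by apply/measurable_EFinP; exact: measurable_indic_kfun.
- by apply/measurable_EFinP; exact: measurable_indic_kfun.
- move=> t _; rewrite lee_fin; apply: ler_wpM2r; first exact: kfun_ge0.
  by rewrite indicT /= indicE; case: (_ \in _).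
Qed.

Lemma int_Omega_kernel c A B S : measurable S ->
  int_Omega (fun x => (\1_S (sym_coords x) * mgig_kernel (c + (r%:R + 1) / 2) A B x)%:E) =
  kint c A B S.
Proof.
move=> mS; have E t : \1_S t * mgig_kernel (c + (r%:R + 1) / 2) A B (Mx t) = \1_S t * kfun c A B t.
  by rewrite mgig_kernelE addrK.
rewrite int_Omega_indic; first by apply: eq_integral => t _; rewrite E.
- move=> x; rewrite /mgig_kernel; case: ifP => // _.
  by rewrite mulr_ge0 ?expR_ge0 ?powR_ge0.
- under eq_fun do rewrite E; exact: measurable_indic_kfun.
Qed.

Lemma mgig_ZE c A B : mgig_Z (c + (r%:R + 1) / 2) A B = kint c A B setT.
Proof.
rewrite -int_Omega_kernel //; congr int_Omega; apply/funext => x.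
by rewrite indicT mul1r.
Qed.

Lemma mgig_lawE c A B S : measurable S ->
  mgig_law (c + (r%:R + 1) / 2) A B S =
  (kint c A B S * ((fine (kint c A B setT))^-1)%:E)%E.
Proof. by move=> mS; rewrite /mgig_law int_Omega_kernel // mgig_ZE. Qed.

Lemma scaled_one (k : R) (x : \bar R) : 0 < k -> (0 <= x)%E -> (k%:E * x)%E = 1%E ->
  (0 < x < +oo)%E.
Proof.
move=> k0; case: x => [x| |] //.
  rewrite !lte_fin lee_fin ltry andbT => x0 [e].
  by rewrite lt_neqAle x0 andbT; apply/eqP => z; move: e; rewrite -z mulr0 => /eqP; rewrite eq_sym oner_eq0.
by rewrite gt0_muley // lte_fin.
Qed.

Lemma scaled_one2 (k : R) (x y : \bar R) : 0 < k -> (0 <= x)%E -> (0 <= y)%E ->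
  (k%:E * x * y)%E = 1%E -> (0 < x < +oo)%E /\ (0 < y < +oo)%E.
Proof.
move=> k0 x0 y0 h.
have xp : (0 < x)%E.
  rewrite lt_neqAle x0 andbT; apply/eqP => z; move: h; rewrite -z mule0 mul0e => /eqP.
  by rewrite eq_sym onee_eq0.
have yp : (0 < y)%E.
  by rewrite lt_neqAle y0 andbT; apply/eqP => z; move: h; rewrite -z mule0 => /eqP; rewrite eq_sym onee_eq0.
move: h; case: x x0 xp => [x| |] //= x0 xp.
  by rewrite -EFinM => h; rewrite xp ltry; split => //; apply: scaled_one h => //; rewrite mulr_gt0.
by rewrite gt0_muley ?lte_fin // gt0_mulye.
Qed.

End KernelIntegrals.

Section PositiveAlpha.
Variables (R : realType) (r : nat) (al be : R).
Local Notation n := (sym_dim r).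
Local Notation Tn := (n.-tuple R).
Local Notation mu := (leb R n).
Local Notation Mx := (@smx_of_tuple R r).
Local Notation Cx := (@sym_coords R r).
Local Notation DP := (@DP R r).
Context d (T : measurableType d) (P : probability T R).
Variables (X Y : T -> 'M[R]_r) (f g : 'M[R]_r -> R).
Hypotheses (al0 : 0 < al) (be0 : 0 <= be) (albe : al != be).
Hypotheses (mX : random_matrix X) (mY : random_matrix Y).
Hypotheses (pX : forall w, posdef (X w)) (pY : forall w, posdef (Y w)).
Hypotheses (fX : has_density P X f) (gY : has_density P Y g).
Hypotheses (f0 : forall x, posdef x -> 0 < f x) (g0 : forall x, posdef x -> 0 < g x).
Hypothesis df : twice_differentiable_on [set v | posdef (smx_of_rv v)]
  (fun v => f (smx_of_rv v)).
Hypothesis dg : twice_differentiable_on [set v | posdef (smx_of_rv v)]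
  (fun v => g (smx_of_rv v)).
Hypothesis iXY : indep_mx P X Y.
Local Notation U := (fun w => (phi_ab al be (X w) (Y w)).1).
Local Notation V := (fun w => (phi_ab al be (X w) (Y w)).2).
Hypothesis iUV : indep_mx P U V.

Let cf := twice_differentiable_pcont df.
Let cg := twice_differentiable_pcont dg.

Local Notation phidens := (phidens f g al be).

Lemma density_forms : exists (c : R) (a b : 'M[R]_r) (cF cG cUV : R),
  [/\ a^T = a, b^T = b & [/\ 0 < cF, 0 < cG, 0 < cUV &
  forall x y, posdef x -> posdef y ->
  [/\ f x = cF * kexp c (al *: a) b x, g y = cG * kexp c (be *: b) a y &
      phidens x y = cUV * (kexp c (al *: b) a x * kexp c (be *: a) b y)]]].
Proof.
have p1 := posdef1 R r.
(* Only G and H are differentiated in [fe_solution], so only they are extended through [sympart]; F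
   and K keep their raw form. *)
pose H u := ln (f (sympart (phi_ab al be u 1%:M).1) * g (sympart (phi_ab al be u 1%:M).2)).
pose K v := ln (phidens 1%:M v) - ln (phidens 1%:M 1%:M).
have HE u : posdef u -> H u = ln (phidens u 1%:M).
  by move=> pu; have [q1 q2] := posdef_phi al0 be0 pu p1; rewrite /H !sympart_id.
have dH p : posdef p -> differentiable H p.
  move=> pp; have [q1 q2] := posdef_phi al0 be0 pp p1.
  have [m1 m2] := @mxdiff_phi _ _ _ al (fun _ => be) id (fun _ => 1%:M) p (ltW al0) be0 pp p1
    (differentiable_cst _ _) (mxdiff_id p) (mxdiff_cst _ _).
  apply: differentiable_ln; last by rewrite !sympart_id // mulr_gt0 ?f0 ?g0.
  have {}q1 : posdef (sympart (phi_ab al be p 1%:M).1) by rewrite sympart_id.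
  have {}q2 : posdef (sympart (phi_ab al be p 1%:M).2) by rewrite sympart_id.
  have d1 := differentiable_comp (mxdiffP m1) (differentiable_sympart df q1).
  have d2 := differentiable_comp (mxdiffP m2) (differentiable_sympart dg q2).
  exact: differentiableM d1 d2.
have FE p z : posdef p -> posdef z ->
    ln (f (invmx (al *: (p + conjw p z)))) + ln (g (sympart (p + z))) =
    H (p + (be / al) *: z) + K (invmx (al *: (conjw p z + (be / al) *: p))).
  move=> pp pz; have px := posdef_xpz al0 pp pz; have py := posdefD pp pz.
  have := functional_equation mX mY pX pY fX gY f0 g0 cf cg iXY al0 be0 iUV px py.
  rewrite phi_pz // sympart_id // => ->; rewrite HE //.
  by apply: posdefDZ => //; rewrite divr_ge0 // ltW.
have [c [a [b [cF [cG [cH [cK [sa [sb sol]]]]]]]]] :=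
  fe_solution (F := fun x => ln (f x)) al0 be0 albe (tdiff_ln_sympart g0 dg) dH FE.
exists c, a, b, (expR cF), (expR cG), (expR (cH + cK)); split=> //.
split; try exact: expR_gt0.
move=> x y px py; have [Fx _ Hx _] := sol x px; have [_ Gy _ Ky] := sol y py.
rewrite sympart_id // in Gy; rewrite HE // in Hx.
have tZ l (A B : 'M[R]_r) : \tr ((l *: A) *m B) = l * \tr (A *m B).
  by rewrite -scalemxAl mxtraceZ.
split; rewrite /kexp !tZ -!expRD.
- by rewrite -[LHS]lnK ?posrE ?f0 // Fx; congr expR; ring.
- by rewrite -[LHS]lnK ?posrE ?g0 // Gy; congr expR; ring.
- have ph := phidens_gt0 f0 g0 al0 be0 px py.
  rewrite -[LHS]lnK ?posrE //.
  rewrite (ln_phidens mX mY pX pY fX gY f0 g0 cf cg iXY al0 be0 iUV px py) Hx -/(K y) Ky.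
  by congr expR; ring.
Qed.

Lemma mgig_characterization_pos : exists (lam : R) (a b : 'M[R]_r),
    posdef a /\ posdef b /\
    mgig_ok lam (al *: a) b /\ mgig_ok lam (be *: b) a /\
    mgig_ok lam (al *: b) a /\ mgig_ok lam (be *: a) b /\
    joint_law_is P X Y (mgig_law lam (al *: a) b) (mgig_law lam (be *: b) a) /\
    joint_law_is P U V (mgig_law lam (al *: b) a) (mgig_law lam (be *: a) b).
Proof.
have [c [a [b [cF [cG [cUV [sa sb [cF0 cG0 cUV0 forms]]]]]]]] := density_forms.
(* The four kernel integrals are made opaque, so that later rewriting treats them as abstract set
   functions. *)
have [I1 I1E] : { I : set Tn -> \bar R | I = kint c (al *: a) b } := exist _ _ erefl.
have [I2 I2E] : { I : set Tn -> \bar R | I = kint c (be *: b) a } := exist _ _ erefl.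
have [I3 I3E] : { I : set Tn -> \bar R | I = kint c (al *: b) a } := exist _ _ erefl.
have [I4 I4E] : { I : set Tn -> \bar R | I = kint c (be *: a) b } := exist _ _ erefl.
have I1_0 S : (0 <= I1 S)%E by rewrite I1E; exact: kint_ge0.
have I2_0 S : (0 <= I2 S)%E by rewrite I2E; exact: kint_ge0.
have I3_0 S : (0 <= I3 S)%E by rewrite I3E; exact: kint_ge0.
have I4_0 S : (0 <= I4 S)%E by rewrite I4E; exact: kint_ge0.
have tf t : tdens f t = cF * kfun c (al *: a) b t.
  rewrite /tdens /kfun indicE; case: (boolP (t \in DP)) => [/set_mem pt|_]; last by rewrite !mul0r mulr0.
  by rewrite !mul1r; have [-> _ _] := forms _ _ pt pt.
have tg t : tdens g t = cG * kfun c (be *: b) a t.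
  rewrite /tdens /kfun indicE; case: (boolP (t \in DP)) => [/set_mem pt|_]; last by rewrite !mul0r mulr0.
  by rewrite !mul1r; have [_ -> _] := forms _ _ pt pt.
have tuv z : jdensUV f g al be z = cUV * (kfun c (al *: b) a z.1 * kfun c (be *: a) b z.2).
  case: z => s t; rewrite /jdensUV /kfun /= !indicE /DD in_setX /=.
  have [/set_mem ps|_] := boolP (s \in DP); last by rewrite !mul0r mulr0.
  have [/set_mem pt|_] := boolP (t \in DP); last by rewrite !mul0r !mulr0.
  rewrite !mul1r; have [_ _ <-] := forms _ _ ps pt.
  have [q1 q2] := posdef_phi al0 be0 ps pt.
  have s1 := posdef_sym q1; have s2 := posdef_sym q2.
  by rewrite /jdens /Phi /= !tdens_in /DP /= ?(sym_coordsK s1) ?(sym_coordsK s2).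
have kI (k : R) (A B : 'M[R]_r) S : 0 < k -> measurable S ->
    (\int[mu]_t (\1_S t * (k * kfun c A B t))%:E = k%:E * kint c A B S)%E.
  move=> k0 mS; rewrite /kint -ge0_integralZl //; last 3 first.
  - by apply/measurable_EFinP; exact: measurable_indic_kfun.
  - by move=> t _; rewrite lee_fin mulr_ge0 // kfun_ge0.
  - by rewrite lee_fin ltW.
  by apply: eq_integral => t _; rewrite -EFinM mulrCA.
have lawX S : measurable S -> P (X @^-1` (Cx @^-1` S)) = (cF%:E * I1 S)%E.
  move=> mS; rewrite (density_law pX fX f0 cf mS) I1E -kI //.
  by apply: eq_integral => t _; rewrite tf.
have lawY S : measurable S -> P (Y @^-1` (Cx @^-1` S)) = (cG%:E * I2 S)%E.
  move=> mS; rewrite (density_law pY gY g0 cg mS) I2E -kI //.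
  by apply: eq_integral => t _; rewrite tg.
have lawUV S S' : measurable S -> measurable S' ->
    P (U @^-1` (Cx @^-1` S) `&` V @^-1` (Cx @^-1` S')) = (cUV%:E * I3 S * I4 S')%E.
  move=> mS mS'; rewrite (law_UV mX mY pX pY fX gY f0 g0 cf cg iXY al0 be0 mS mS').
  rewrite I3E I4E -kI // /kint -integral_prod_fun.
  - apply: eq_integral => z _; rewrite tuv; congr EFin.
    by rewrite mulrACA [in LHS]mulrCA; ring.
  - by under eq_fun do rewrite mulrCA; apply: measurable_funM => //; exact: measurable_indic_kfun.
  - exact: measurable_indic_kfun.
  - move=> t; apply: mulr_ge0 => //; apply: mulr_ge0; [exact: ltW|exact: kfun_ge0].
  - by move=> t; apply: mulr_ge0 => //; exact: kfun_ge0.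
have ok1 : (0 < I1 setT < +oo)%E.
  by apply: (scaled_one cF0 (I1_0 setT)); rewrite -lawX // !preimage_setT probability_setT.
have ok2 : (0 < I2 setT < +oo)%E.
  by apply: (scaled_one cG0 (I2_0 setT)); rewrite -lawY // !preimage_setT probability_setT.
have h34 := lawUV setT setT measurableT measurableT.
rewrite !preimage_setT setIT probability_setT in h34.
(* The total mass 1 of (U, V) yields finiteness of both normalizing integrals at once, since both
   are nonnegative. *)
have [ok3 ok4] := scaled_one2 cUV0 (I3_0 setT) (I4_0 setT) (esym h34).
have [/andP[p1 fin1] /andP[p2 fin2]] := (ok1, ok2).
have [/andP[p3 fin3] /andP[p4 fin4]] := (ok3, ok4).
(* The densities of X and U have linear parts al a and al b and inverse parts b and a, so exchanging
   them proves the same for b. *)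
have pa : posdef a.
  by apply: (@coef_posdef _ _ al a b c al0 sa sb); rewrite -kintT; [rewrite -I1E|rewrite -I3E].
have pb : posdef b.
  by apply: (@coef_posdef _ _ al b a c al0 sb sa); rewrite -kintT; [rewrite -I3E|rewrite -I1E].
(* The shift undoes the exponent lambda - (r + 1) / 2 of the MGIG density. *)
exists (c + (r%:R + 1) / 2), a, b; rewrite /mgig_ok !mgig_ZE -I1E -I2E -I3E -I4E.
split; first exact: pa.
split; first exact: pb.
do 4![split; first by []].
have [m1 M1] : exists m, forall S, measurable S -> I1 S = (m S)%:E.
  by exists (fun S => fine (I1 S)) => S mS; rewrite I1E; apply: kint_fin; rewrite -?I1E.
have [m2 M2] : exists m, forall S, measurable S -> I2 S = (m S)%:E.
  by exists (fun S => fine (I2 S)) => S mS; rewrite I2E; apply: kint_fin; rewrite -?I2E.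
have [m3 M3] : exists m, forall S, measurable S -> I3 S = (m S)%:E.
  by exists (fun S => fine (I3 S)) => S mS; rewrite I3E; apply: kint_fin; rewrite -?I3E.
have [m4 M4] : exists m, forall S, measurable S -> I4 S = (m S)%:E.
  by exists (fun S => fine (I4 S)) => S mS; rewrite I4E; apply: kint_fin; rewrite -?I4E.
have f1 : m1 setT != 0 by rewrite gt_eqF // -lte_fin -M1.
have f2 : m2 setT != 0 by rewrite gt_eqF // -lte_fin -M2.
have f3 : m3 setT != 0 by rewrite gt_eqF // -lte_fin -M3.
have f4 : m4 setT != 0 by rewrite gt_eqF // -lte_fin -M4.
(* The multiplicative constants of the densities are determined by total mass 1. *)
have normal (k m : R) : m != 0 -> 1%E = (k * m)%:E -> k = m^-1.
  by move=> m0 [e]; apply: (mulIf m0); rewrite -e mulVf.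
split=> S S' mS mS'.
  have eF : cF = (m1 setT)^-1.
    by apply: normal => //; rewrite EFinM -M1 // -lawX // !preimage_setT probability_setT.
  have eG : cG = (m2 setT)^-1.
    by apply: normal => //; rewrite EFinM -M2 // -lawY // !preimage_setT probability_setT.
  rewrite iXY // lawX // lawY // !mgig_lawE // -I1E -I2E !M1 // !M2 // eF eG -!EFinM.
  by rewrite /= (mulrC (m1 S)) (mulrC (m2 S')).
rewrite lawUV // !mgig_lawE // -I3E -I4E !M3 // !M4 // -!EFinM /=.
have -> : cUV = (m3 setT * m4 setT)^-1.
  by apply: normal; [rewrite mulf_neq0|rewrite h34 M3 // M4 // -!EFinM mulrA].
by rewrite invfM; congr EFin; move: (m3 setT)^-1 (m4 setT)^-1 => x y; ring.
Qed.

End PositiveAlpha.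

Lemma joint_law_swap (R : realType) (r : nat) (d : measure_display) (T : measurableType d)
    (P : probability T R) (X Y : T -> 'M[R]_r) (mu nu : set ((sym_dim r).-tuple R) -> \bar R) :
  joint_law_is P X Y mu nu -> joint_law_is P Y X nu mu.
Proof. by move=> h A B mA mB; rewrite setIC h // muleC. Qed.

Lemma indep_mx_swap (R : realType) (r : nat) (d : measure_display) (T : measurableType d)
    (P : probability T R) (X Y : T -> 'M[R]_r) : indep_mx P X Y -> indep_mx P Y X.
Proof. by move=> h A B mA mB; rewrite setIC h // muleC. Qed.

Theorem theorem2 (R : realType) (r : nat) (alpha beta : R)
    (d : measure_display) (T : measurableType d) (P : probability T R)
    (X Y : T -> 'M[R]_r) (f g : 'M[R]_r -> R) :
  (1 <= r)%N ->
  0 <= alpha -> 0 <= beta -> alpha != beta ->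
  random_matrix X -> random_matrix Y ->
  (forall w, posdef (X w)) -> (forall w, posdef (Y w)) ->
  has_density P X f -> has_density P Y g ->
  (forall x, posdef x -> 0 < f x) -> (forall x, posdef x -> 0 < g x) ->
  twice_differentiable_on [set v | posdef (smx_of_rv v)]
    (fun v => f (smx_of_rv v)) ->
  twice_differentiable_on [set v | posdef (smx_of_rv v)]
    (fun v => g (smx_of_rv v)) ->
  indep_mx P X Y ->
  indep_mx P (fun w => (phi_ab alpha beta (X w) (Y w)).1)
             (fun w => (phi_ab alpha beta (X w) (Y w)).2) ->
  exists (lam : R) (a b : 'M[R]_r),
    posdef a /\ posdef b /\
    mgig_ok lam (alpha *: a) b /\ mgig_ok lam (beta *: b) a /\
    mgig_ok lam (alpha *: b) a /\ mgig_ok lam (beta *: a) b /\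
    joint_law_is P X Y (mgig_law lam (alpha *: a) b)
                        (mgig_law lam (beta *: b) a) /\
     joint_law_is P (fun w => (phi_ab alpha beta (X w) (Y w)).1)
                    (fun w => (phi_ab alpha beta (X w) (Y w)).2)
                    (mgig_law lam (alpha *: b) a)
                    (mgig_law lam (beta *: a) b).
Proof.
move=> _ al0 be0 albe mX mY pX pY fX gY f0 g0 df dg iXY iUV.
have [alp|] := ltP 0 alpha.
  exact: (mgig_characterization_pos alp be0 albe mX mY pX pY fX gY f0 g0 df dg iXY iUV).
move=> al_le; have alE : alpha = 0 by apply/eqP; rewrite eq_le al_le.
(* For alpha = 0 the positive case is applied to (Y, X) and (V, U) with alpha and beta exchanged:
   the components of phi are exchanged by definition, and the resulting a and b trade places. *)
have bep : 0 < beta by rewrite lt_neqAle be0 andbT -alE.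
have beal : beta != alpha by rewrite eq_sym.
have [lam [a [b [pa [pb [ok1 [ok2 [ok3 [ok4 [lXY lUV]]]]]]]]]] :=
  mgig_characterization_pos bep al0 beal mY mX pY pX gY fX g0 f0 dg df
    (indep_mx_swap iXY) (indep_mx_swap iUV).
have hXY := joint_law_swap lXY; have hUV := joint_law_swap lUV.
exact: (ex_intro _ lam (ex_intro _ b (ex_intro _ a (conj pb (conj pa
  (conj ok2 (conj ok1 (conj ok4 (conj ok3 (conj hXY hUV)))))))))).
Qed.
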